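(* Let $B$ be a commutative complex $*$-algebra with a left action of a group $\Gamma$ preserving the involution, let $\gamma_1,\dots,\gamma_n\in\Gamma$ and $\nabla=\mathrm{diag}(\gamma_1,\dots,\gamma_n)\in M_n(B\rtimes\Gamma)$. Let $F,G\in GL_n(B)$ be $\nabla$-odd, i.e. $\nabla F\nabla,\nabla G\nabla\in M_n(B)$, assume $GF^*=FG^*$, and put $Q:=G(\nabla\overline G\nabla)$. Let $A^B_{\mathrm o}(\nabla,F,G)$ be the universal $(B,\Gamma)$-algebra with an invertible $n\times n$-matrix $v$ such that $v_{ij}$ has degree $(\gamma_i,\gamma_j)$ for all $i,j$ and $$r_n(\nabla F\nabla)v^{-\mathsf T}=v\,s_n(F),\qquad r_n(\nabla Q\nabla^{-1})v=v\,s_n(Q).$$ Then $A^B_{\mathrm o}(\nabla,F,G)$ can be equipped with a unique structure of a $(B,\Gamma)$-Hopf $*$-algebroid (involution, $\Delta,\epsilon,S$) such that $r_n(\nabla G\nabla)\overline v=v\,s_n(G)$ and $v$ is a matrix corepresentation, i.e. $\Delta(v_{ij})=\sum_kv_{ik}\tilde\otimes v_{kj}$, $\epsilon(v_{ij})=\delta_{i,j}\gamma_i$, $S(v_{ij})=(v^{-1})_{ij}$ for all $i,j$.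
   Context: All algebras and homomorphisms are unital over $\mathbb C$. $B$ is a commutative $*$-algebra on which the group $\Gamma$ acts from the left by $*$-automorphisms; $e\in\Gamma$ is the unit. A $(B,\Gamma)$-algebra is an algebra $A$ with a grading $A=\bigoplus_{\gamma,\gamma'\in\Gamma}A_{\gamma,\gamma'}$ (with $A_{\gamma,\gamma'}A_{\beta,\beta'}\subseteq A_{\gamma\beta,\gamma'\beta'}$) and homomorphisms $r,s\colon B\to A_{e,e}$ with commuting images such that $a\,r(b)=r(\gamma(b))a$ and $a\,s(b)=s(\gamma'(b))a$ for all $a\in A_{\gamma,\gamma'}$, $b\in B$. Morphisms are grading-preserving homomorphisms compatible with $r$ and $s$. A $(B,\Gamma)$-$*$-algebra is a $(B,\Gamma)$-algebra with an involution such that $(A_{\gamma,\gamma'})^*=A_{\gamma^{-1},\gamma'^{-1}}$, $r(b)^*=r(b^* )$, $s(b)^*=s(b^* )$; morphisms are required to preserve the involution. The crossed product $B\rtimes\Gamma$ is spanned by elements $b\gamma$ with $b\gamma\cdot b'\gamma'=b\gamma(b')\gamma\gamma'$ and $(b\gamma)^*=\gamma^{-1}b^*$; it is a $(B,\Gamma)$-$*$-algebra with $b\gamma$ in degree $(\gamma,\gamma)$ and $r(b)=s(b)=b$. $M_n(B)$ is viewed inside $M_n(B\rtimes\Gamma)$. Fiber product: for $(B,\Gamma)$-algebras $A,C$ let $A\overset{\Gamma}{\otimes}C=\sum_{\gamma,\gamma',\gamma''}A_{\gamma,\gamma'}\otimes C_{\gamma',\gamma''}\subseteq A\otimes C$,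 and let $A\tilde\otimes C$ be its quotient by the ideal generated by $\{s_A(b)\otimes1-1\otimes r_C(b):b\in B\}$. It is a $(B,\Gamma)$-algebra with $A_{\gamma,\gamma'}\tilde\otimes C_{\gamma',\gamma''}$ in degree $(\gamma,\gamma'')$ and $r(b)=r_A(b)\tilde\otimes1$, $s(b)=1\tilde\otimes s_C(b)$; $a\tilde\otimes c$ denotes the class of $a\otimes c$; for $(B,\Gamma)$-$*$-algebras, $(a\tilde\otimes c)^*=a^*\tilde\otimes c^*$. It is functorial and associative, and $(B\rtimes\Gamma)\tilde\otimes A\cong A$ via $b\gamma\tilde\otimes a\mapsto r(b)a$, $A\tilde\otimes(B\rtimes\Gamma)\cong A$ via $a\tilde\otimes b\gamma\mapsto s(b)a$. $A^{\mathsf{co},\mathsf{op}}$ is the opposite algebra of $A$ with $(A^{\mathsf{co},\mathsf{op}})_{\gamma,\gamma'}=A_{\gamma'^{-1},\gamma^{-1}}$, $r_{A^{\mathsf{co},\mathsf{op}}}=s_A$, $s_{A^{\mathsf{co},\mathsf{op}}}=r_A$. A $(B,\Gamma)$-Hopf algebroid is a $(B,\Gamma)$-algebra $A$ with morphisms of $(B,\Gamma)$-algebras $\Delta\colon A\to A\tilde\otimes A$, $\epsilon\colon A\to B\rtimes\Gamma$, $S\colon A\to A^{\mathsf{co},\mathsf{op}}$ such that $(\Delta\tilde\otimes\mathrm{id})\Delta=(\mathrm{id}\tilde\otimes\Delta)\Delta$, $(\epsilon\tilde\otimes\mathrm{id})\Delta=\mathrm{id}=(\mathrm{id}\tilde\otimes\epsilon)\Delta$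 (using the isomorphisms above), and, writing $\Delta(a)=\sum a_{(1)}\tilde\otimes a_{(2)}$, $\sum S(a_{(1)})a_{(2)}=\check s(\epsilon(a))$ and $\sum a_{(1)}S(a_{(2)})=\hat r(\epsilon(a))$ for all $a\in A$, where $\check s,\hat r\colon B\rtimes\Gamma\to A$ are the linear maps $\check s(\gamma b)=s(b)$, $\hat r(b\gamma)=r(b)$. It is a $(B,\Gamma)$-Hopf $*$-algebroid if moreover $A$ is a $(B,\Gamma)$-$*$-algebra and $\Delta,\epsilon$ are $*$-preserving. For a linear map $\phi$, $\phi_n$ denotes its entrywise extension to $n\times n$-matrices. $v^{-\mathsf T}:=(v^{-1})^{\mathsf T}$; $\overline X:=(X_{ij}^* )_{i,j}$ and $X^*=\overline X^{\mathsf T}$ for matrices over a $*$-algebra. *)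

(* Defs.v *)
From HB Require Import structures.
From mathcomp Require Import all_boot all_order all_algebra.
From mathcomp Require Import all_classical.

Set Implicit Arguments.
Unset Strict Implicit.
Unset Printing Implicit Defensive.

Import Order.TTheory GRing.Theory Num.Theory.

Local Open Scope quotient_scope.
Local Open Scope classical_set_scope.
Local Open Scope ring_scope.

(* Unital algebras.  The library's [algType] excludes the zero algebra, but a
   fiber product of nonzero algebras may vanish; hence this variant. *)

Record alg (K : pzRingType) := Alg {
  alg_ring : pzRingType;
  alg_scale : K -> alg_ring -> alg_ring;
  alg_scaleA : forall a b v, alg_scale a (alg_scale b v) = alg_scale (a * b) v;
  alg_scale1 : left_id 1 alg_scale;
  alg_scaleDr : right_distributive alg_scale +%R;
  alg_scaleDl : forall v, {morph alg_scale^~ v : a b / a + b};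
  alg_scaleAl : forall a x y, alg_scale a (x * y) = alg_scale a x * y;
  alg_scaleAr : forall a x y, alg_scale a (x * y) = x * alg_scale a y }.

Definition alg_sort (K : pzRingType) (A : alg K) : Type := alg_ring A.
Coercion alg_sort : alg >-> Sortclass.

HB.instance Definition _ (K : pzRingType) (A : alg K) :=
  GRing.PzRing.copy (alg_sort A) (alg_ring A).
HB.instance Definition _ (K : pzRingType) (A : alg K) :=
  GRing.Zmodule_isLmodule.Build K (alg_sort A)
    (@alg_scaleA K A) (@alg_scale1 K A) (@alg_scaleDr K A) (@alg_scaleDl K A).

Lemma algZl (K : pzRingType) (A : alg K) (z : K) (x y : A) :
  z *: (x * y) = (z *: x) * y.
Proof. exact: alg_scaleAl. Qed.

Lemma algZr (K : pzRingType) (A : alg K) (z : K) (x y : A) :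
  z *: (x * y) = x * (z *: y).
Proof. exact: alg_scaleAr. Qed.

Definition is_alg_hom (K : pzRingType) (A C : alg K) (f : A -> C) : Prop :=
  linear f /\ monoid_morphism f.

Definition is_star (K : numClosedFieldType) (A : alg K) (star : A -> A) : Prop :=
  [/\ {morph star : x y / x + y},
      forall (z : K) x, star (z *: x) = z^* *: star x,
      forall x y, star (x * y) = star y * star x
    & involutive star].

Definition op_alg (K : pzRingType) (A : alg K) : alg K :=
  @Alg K ((A : pzRingType)^c : pzRingType) (@alg_scale K A)
    (@alg_scaleA K A) (@alg_scale1 K A) (@alg_scaleDr K A) (@alg_scaleDl K A)
    (fun a x y => @alg_scaleAr K A a y x) (fun a x y => @alg_scaleAl K A a y x).

(* Presents an algebra by a spanning set [sp_gen] which is closed under products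
   and scalars.  The linear relations are given by the maps [sp_test] from the
   spanning set to abelian groups that respect them: the elements of the algebra
   [span_alg D] are the formal sums of elements of [sp_gen D], and two sums are
   equal if every test takes the same value on them. *)

Record span_data (K : pzRingType) := SpanData {
  sp_gen : choiceType;
  sp_test : forall V : zmodType, (sp_gen -> V) -> Prop;
  sp_scale : K -> sp_gen -> sp_gen;
  sp_mul : sp_gen -> sp_gen -> sp_gen;
  sp_one : sp_gen;
  sp_testZ : forall (V : zmodType) (t : sp_gen -> V) z, sp_test t -> sp_test (t \o sp_scale z);
  sp_testM : forall (V : zmodType) (t : sp_gen -> V) x, sp_test t -> sp_test (t \o sp_mul x);
  sp_testMr : forall (V : zmodType) (t : sp_gen -> V) x,
    sp_test t -> sp_test (fun y => t (sp_mul y x));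
  sp_testD : forall (V : zmodType) (t : sp_gen -> V) y z x, sp_test t ->
    t (sp_scale (y + z) x) = t (sp_scale y x) + t (sp_scale z x);
  sp_scale1 : forall x, sp_scale 1 x = x;
  sp_scaleA : forall y z x, sp_scale y (sp_scale z x) = sp_scale (y * z) x;
  sp_mulA : associative sp_mul;
  sp_mul1 : left_id sp_one sp_mul;
  sp_mulr1 : right_id sp_one sp_mul;
  sp_scaleAl : forall z x y, sp_scale z (sp_mul x y) = sp_mul (sp_scale z x) y;
  sp_scaleAr : forall z x y, sp_scale z (sp_mul x y) = sp_mul x (sp_scale z y) }.

Section SpanAlg.
Variables (K : pzRingType) (D : span_data K).
Local Notation X := (sp_gen D).

Definition span_eqP (s t : seq X) : Prop :=
  forall (V : zmodType) (f : X -> V), sp_test f ->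
    \sum_(x <- s) f x = \sum_(x <- t) f x.

Definition span_eq : rel (seq X) := fun s t => `[< span_eqP s t >].

Fact span_eq_refl : reflexive span_eq. Proof. by move=> s; apply/asboolP. Qed.
Fact span_eq_sym : symmetric span_eq.
Proof. by move=> s t; apply/asboolP/asboolP => + V f hf => ->. Qed.
Fact span_eq_trans : transitive span_eq.
Proof.
by move=> t s u /asboolP h1 /asboolP h2; apply/asboolP => V f hf; rewrite h1 ?h2.
Qed.
Canonical span_equiv := EquivRel span_eq span_eq_refl span_eq_sym span_eq_trans.

Definition span_sort : Type := {eq_quot span_equiv}.
HB.instance Definition _ := Choice.on span_sort.

Definition span_class (s : seq X) : span_sort := \pi_{eq_quot span_equiv} s.
Definition span_repr (x : span_sort) : seq X := @repr _ {eq_quot span_equiv} x.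

Lemma span_classP s t : span_class s = span_class t <-> span_eqP s t.
Proof. by split=> [/eqmodP/asboolP|h]; last apply/eqmodP/asboolP. Qed.

Lemma span_reprK x : span_class (span_repr x) = x.
Proof. exact: (@reprK _ {eq_quot span_equiv}). Qed.

Lemma span_reprP s : span_eqP (span_repr (span_class s)) s.
Proof. by apply/span_classP; rewrite span_reprK. Qed.

Definition span_add (x y : span_sort) := span_class (span_repr x ++ span_repr y).
Definition span_scale z (x : span_sort) :=
  span_class (map (sp_scale z) (span_repr x)).
Definition span_mul (x y : span_sort) :=
  span_class [seq sp_mul a b | a <- span_repr x, b <- span_repr y].

Lemma span_addE s t : span_add (span_class s) (span_class t) = span_class (s ++ t).
Proof. by apply/span_classP => V f hf; rewrite !big_cat /= !span_reprP. Qed.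

Lemma span_scaleE z s :
  span_scale z (span_class s) = span_class (map (sp_scale z) s).
Proof.
by apply/span_classP => V f hf; rewrite !big_map (@span_reprP _ _ _ (sp_testZ _ hf)).
Qed.

Lemma span_mulE s t : span_mul (span_class s) (span_class t) =
  span_class [seq sp_mul a b | a <- s, b <- t].
Proof.
apply/span_classP => V f hf; rewrite !big_allpairs_dep /=.
under eq_bigr do rewrite (@span_reprP _ _ _ (sp_testM _ hf)).
rewrite exchange_big /= [RHS]exchange_big /=; apply: eq_bigr => b _.
exact: (@span_reprP _ _ _ (sp_testMr _ hf)).
Qed.

Lemma span_ind (P : span_sort -> Prop) :
  (forall s, P (span_class s)) -> forall x, P x.
Proof. by move=> h x; rewrite -(span_reprK x). Qed.

Fact span_addA : associative span_add.
Proof.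
elim/span_ind=> s; elim/span_ind=> t; elim/span_ind=> u.
by rewrite !span_addE catA.
Qed.
Fact span_addC : commutative span_add.
Proof.
elim/span_ind=> s; elim/span_ind=> t; rewrite !span_addE.
by apply/span_classP => V f hf; rewrite !big_cat /= addrC.
Qed.
Fact span_add0 : left_id (span_class [::]) span_add.
Proof. by elim/span_ind=> s; rewrite span_addE. Qed.

Lemma sp_test0 (V : zmodType) (f : X -> V) x : sp_test f -> f (sp_scale 0 x) = 0.
Proof.
by move=> hf; apply: (addIr (f (sp_scale 0 x))); rewrite -sp_testD // !add0r.
Qed.
Lemma sp_testN (V : zmodType) (f : X -> V) x :
  sp_test f -> f (sp_scale (-1) x) = - f x.
Proof.
move=> hf; apply: (addIr (f x)); rewrite addNr -[X in _ + f X]sp_scale1.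
by rewrite -sp_testD // addNr sp_test0.
Qed.

Fact span_addN : left_inverse (span_class [::]) (span_scale (-1)) span_add.
Proof.
elim/span_ind=> s; rewrite span_scaleE span_addE; apply/span_classP => V f hf.
rewrite big_cat big_map big_nil /= -big_split big1 //= => x _.
by rewrite sp_testN // addNr.
Qed.

HB.instance Definition _ :=
  GRing.isZmodule.Build span_sort span_addA span_addC span_add0 span_addN.

Lemma span_classD s t : span_class s + span_class t = span_class (s ++ t).
Proof. exact: span_addE. Qed.

Fact span_mulA : associative span_mul.
Proof.
elim/span_ind=> s; elim/span_ind=> t; elim/span_ind=> u; rewrite !span_mulE.
apply/span_classP => V f hf; rewrite !big_allpairs_dep /=.
apply: eq_bigr => a _; rewrite big_allpairs_dep; apply: eq_bigr => b _.
by apply: eq_bigr => c _; rewrite sp_mulA.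
Qed.
Fact span_mul1 : left_id (span_class [:: sp_one D]) span_mul.
Proof.
elim/span_ind=> s; rewrite !span_mulE; apply/span_classP => V f hf.
rewrite !big_allpairs_dep /= big_seq1.
by apply: eq_bigr => a _; rewrite sp_mul1.
Qed.
Fact span_mulr1 : right_id (span_class [:: sp_one D]) span_mul.
Proof.
elim/span_ind=> s; rewrite !span_mulE; apply/span_classP => V f hf.
rewrite !big_allpairs_dep /=.
by apply: eq_bigr => a _; rewrite big_seq1 sp_mulr1.
Qed.
Fact span_mulDl : left_distributive span_mul span_add.
Proof.
elim/span_ind=> s; elim/span_ind=> t; elim/span_ind=> u.
rewrite !(span_mulE, span_addE); apply/span_classP => V f hf.
by rewrite !(big_cat, big_allpairs_dep).
Qed.
Fact span_mulDr : right_distributive span_mul span_add.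
Proof.
elim/span_ind=> s; elim/span_ind=> t; elim/span_ind=> u.
rewrite !(span_mulE, span_addE); apply/span_classP => V f hf.
rewrite !(big_cat, big_allpairs_dep) /= -big_split; apply: eq_bigr => a _.
by rewrite big_cat.
Qed.

HB.instance Definition _ := GRing.Zmodule_isPzRing.Build span_sort
  span_mulA span_mul1 span_mulr1 span_mulDl span_mulDr.

Lemma span_classM s t :
  span_class s * span_class t = span_class [seq sp_mul a b | a <- s, b <- t].
Proof. exact: span_mulE. Qed.

Fact span_scaleA a b v : span_scale a (span_scale b v) = span_scale (a * b) v.
Proof.
elim/span_ind: v => s; rewrite !span_scaleE -map_comp; congr span_class.
by apply: eq_map => x /=; rewrite sp_scaleA.
Qed.
Fact span_scale1 : left_id 1 span_scale.
Proof.
elim/span_ind=> s; rewrite span_scaleE; congr span_class.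
by apply: map_id_in => x _; apply: sp_scale1.
Qed.
Fact span_scaleDr : right_distributive span_scale (+%R : span_sort -> _).
Proof.
move=> z; elim/span_ind=> s; elim/span_ind=> t.
by rewrite !(span_classD, span_scaleE) map_cat.
Qed.
Fact span_scaleDl v : {morph span_scale^~ v : a b / a + b}.
Proof.
move=> a b; elim/span_ind: v => s; rewrite !(span_classD, span_scaleE).
apply/span_classP => V f hf; rewrite big_cat !big_map /= -big_split.
by apply: eq_bigr => x _; rewrite sp_testD.
Qed.
Fact span_scaleAl z (x y : span_sort) : span_scale z (x * y) = span_scale z x * y.
Proof.
elim/span_ind: x => s; elim/span_ind: y => t.
rewrite !(span_classM, span_scaleE); apply/span_classP => V f hf.
rewrite big_map !big_allpairs_dep /= big_map; apply: eq_bigr => a _.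
by apply: eq_bigr => b _; rewrite sp_scaleAl.
Qed.
Fact span_scaleAr z (x y : span_sort) : span_scale z (x * y) = x * span_scale z y.
Proof.
elim/span_ind: x => s; elim/span_ind: y => t.
rewrite !(span_classM, span_scaleE); apply/span_classP => V f hf.
rewrite big_map !big_allpairs_dep; apply: eq_bigr => a _.
by rewrite big_map; apply: eq_bigr => b _; rewrite sp_scaleAr.
Qed.

Definition span_alg : alg K := @Alg K span_sort span_scale
  span_scaleA span_scale1 span_scaleDr span_scaleDl span_scaleAl span_scaleAr.

Definition span_in (x : X) : span_alg := span_class [:: x].

(* The additive extension of a test [f]; a junk value if [f] is not a test. *)
Definition span_lift (V : zmodType) (f : X -> V) (x : span_alg) : V :=
  \sum_(a <- span_repr x) f a.

Lemma span_liftE (V : zmodType) (f : X -> V) s : sp_test f ->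
  span_lift f (span_class s) = \sum_(a <- s) f a.
Proof. exact: span_reprP. Qed.

Lemma span_lift_in (V : zmodType) (f : X -> V) x : sp_test f ->
  span_lift f (span_in x) = f x.
Proof. by move=> hf; rewrite span_liftE // big_seq1. Qed.

Lemma span_liftD (V : zmodType) (f : X -> V) : sp_test f ->
  {morph span_lift f : x y / x + y}.
Proof.
move=> hf; elim/span_ind=> s; elim/span_ind=> t.
by rewrite [_ + _]span_classD !span_liftE // big_cat.
Qed.

Lemma span_lift0 (V : zmodType) (f : X -> V) : sp_test f -> span_lift f 0 = 0.
Proof. by move=> hf; rewrite (span_liftE [::] hf) big_nil. Qed.

Lemma span_lift_sum (V : zmodType) (f : X -> V) (J : Type) (r : seq J) F :
  sp_test f -> span_lift f (\sum_(j <- r) F j) = \sum_(j <- r) span_lift f (F j).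
Proof.
move=> hf; apply: (big_morph _ (span_liftD hf) (span_lift0 hf)).
Qed.

Lemma span_classE s : span_class s = \sum_(a <- s) span_in a :> span_alg.
Proof.
elim: s => [|a s IHs]; first by rewrite big_nil.
by rewrite big_cons -IHs [RHS]span_classD.
Qed.

Lemma span_sumE (x : span_alg) : x = \sum_(a <- span_repr x) span_in a.
Proof. by rewrite -span_classE [RHS]span_reprK. Qed.

Lemma span_inM x y : span_in x * span_in y = span_in (sp_mul x y).
Proof. exact: span_classM. Qed.

Lemma span_inZ z x : z *: span_in x = span_in (sp_scale z x).
Proof. exact: span_scaleE. Qed.

End SpanAlg.

Section QuotAlg.
Variables (K : pzRingType) (T : alg K) (X : set T).

(* the two-sided ideal generated by [X] *)
Definition ideal : set T := [set x | exists s : seq (T * T * T),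
  (forall p, p \in s -> X p.1.2) /\ x = \sum_(p <- s) p.1.1 * p.1.2 * p.2].

Lemma ideal0 : ideal 0. Proof. by exists [::]; rewrite big_nil. Qed.
Lemma idealD x y : ideal x -> ideal y -> ideal (x + y).
Proof.
move=> [s [hs ->]] [t [ht ->]]; exists (s ++ t); rewrite big_cat; split=> // p.
by rewrite mem_cat => /orP[/hs|/ht].
Qed.
Lemma idealMl a x : ideal x -> ideal (a * x).
Proof.
move=> [s [hs ->]]; exists [seq (a * p.1.1, p.1.2, p.2) | p <- s]; split.
  by move=> p /mapP[q /hs + ->].
by rewrite big_map mulr_sumr; apply: eq_bigr => p _; rewrite /= !mulrA.
Qed.
Lemma idealMr a x : ideal x -> ideal (x * a).
Proof.
move=> [s [hs ->]]; exists [seq (p.1.1, p.1.2, p.2 * a) | p <- s]; split.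
  by move=> p /mapP[q /hs + ->].
by rewrite big_map mulr_suml; apply: eq_bigr => p _; rewrite /= !mulrA.
Qed.
Lemma idealN x : ideal x -> ideal (- x).
Proof. by move=> h; rewrite -mulN1r; apply: idealMl. Qed.
Lemma idealB x y : ideal x -> ideal y -> ideal (x - y).
Proof. by move=> hx hy; apply/idealD/idealN. Qed.
Lemma idealZ z x : ideal x -> ideal (z *: x).
Proof. by move=> h; rewrite -[x]mul1r algZl; apply: idealMl. Qed.
Lemma ideal_gen x : X x -> ideal x.
Proof.
move=> hx; exists [:: (1, x, 1)]; rewrite big_seq1 mul1r mulr1; split=> // p.
by rewrite inE => /eqP ->.
Qed.

Definition quot_eq : rel T := fun x y => `[< ideal (x - y) >].

Fact quot_eq_refl : reflexive quot_eq.
Proof. by move=> x; apply/asboolP; rewrite subrr; apply: ideal0. Qed.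
Fact quot_eq_sym : symmetric quot_eq.
Proof. by move=> x y; apply/asboolP/asboolP => /idealN; rewrite opprB. Qed.
Fact quot_eq_trans : transitive quot_eq.
Proof.
move=> y x z /asboolP h1 /asboolP h2; apply/asboolP.
by rewrite -(subrKA y); apply: idealD.
Qed.
Canonical quot_equiv := EquivRel quot_eq quot_eq_refl quot_eq_sym quot_eq_trans.

Definition quot_sort : Type := {eq_quot quot_equiv}.
HB.instance Definition _ := Choice.on quot_sort.

Definition quot_in (x : T) : quot_sort := \pi_{eq_quot quot_equiv} x.
Definition quot_repr (x : quot_sort) : T := @repr _ {eq_quot quot_equiv} x.

Lemma quot_inP x y : quot_in x = quot_in y <-> ideal (x - y).
Proof. by split=> [/eqmodP/asboolP|h]; last apply/eqmodP/asboolP. Qed.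
Lemma quot_reprK x : quot_in (quot_repr x) = x.
Proof. exact: (@reprK _ {eq_quot quot_equiv}). Qed.
Lemma quot_reprP x : ideal (quot_repr (quot_in x) - x).
Proof. by apply/quot_inP; rewrite quot_reprK. Qed.
Lemma quot_ind (P : quot_sort -> Prop) : (forall x, P (quot_in x)) -> forall x, P x.
Proof. by move=> h x; rewrite -(quot_reprK x). Qed.

Definition quot_add x y := quot_in (quot_repr x + quot_repr y).
Definition quot_opp x := quot_in (- quot_repr x).
Definition quot_mul x y := quot_in (quot_repr x * quot_repr y).
Definition quot_scale z x := quot_in (z *: quot_repr x).

Lemma quot_addE x y : quot_add (quot_in x) (quot_in y) = quot_in (x + y).
Proof.
by apply/quot_inP; rewrite opprD addrACA; apply: idealD; apply: quot_reprP.
Qed.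
Lemma quot_oppE x : quot_opp (quot_in x) = quot_in (- x).
Proof. by apply/quot_inP; rewrite -opprD; apply/idealN/quot_reprP. Qed.
Lemma quot_scaleE z x : quot_scale z (quot_in x) = quot_in (z *: x).
Proof. by apply/quot_inP; rewrite -scalerBr; apply/idealZ/quot_reprP. Qed.
Lemma quot_mulE x y : quot_mul (quot_in x) (quot_in y) = quot_in (x * y).
Proof.
apply/quot_inP; rewrite -(subrKA (x * quot_repr (quot_in y))) -mulrBl -mulrBr.
by apply: idealD; [apply: idealMr|apply: idealMl]; apply: quot_reprP.
Qed.

Fact quot_addA : associative quot_add.
Proof.
by elim/quot_ind=> x; elim/quot_ind=> y; elim/quot_ind=> z; rewrite !quot_addE addrA.
Qed.
Fact quot_addC : commutative quot_add.
Proof. by elim/quot_ind=> x; elim/quot_ind=> y; rewrite !quot_addE addrC. Qed.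
Fact quot_add0 : left_id (quot_in 0) quot_add.
Proof. by elim/quot_ind=> x; rewrite quot_addE add0r. Qed.
Fact quot_addN : left_inverse (quot_in 0) quot_opp quot_add.
Proof. by elim/quot_ind=> x; rewrite quot_oppE quot_addE addNr. Qed.
HB.instance Definition _ :=
  GRing.isZmodule.Build quot_sort quot_addA quot_addC quot_add0 quot_addN.

Fact quot_mulA : associative quot_mul.
Proof.
by elim/quot_ind=> x; elim/quot_ind=> y; elim/quot_ind=> z; rewrite !quot_mulE mulrA.
Qed.
Fact quot_mul1 : left_id (quot_in 1) quot_mul.
Proof. by elim/quot_ind=> x; rewrite quot_mulE mul1r. Qed.
Fact quot_mulr1 : right_id (quot_in 1) quot_mul.
Proof. by elim/quot_ind=> x; rewrite quot_mulE mulr1. Qed.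
Fact quot_mulDl : left_distributive quot_mul quot_add.
Proof.
elim/quot_ind=> x; elim/quot_ind=> y; elim/quot_ind=> z.
by rewrite !(quot_addE, quot_mulE) mulrDl.
Qed.
Fact quot_mulDr : right_distributive quot_mul quot_add.
Proof.
elim/quot_ind=> x; elim/quot_ind=> y; elim/quot_ind=> z.
by rewrite !(quot_addE, quot_mulE) mulrDr.
Qed.
HB.instance Definition _ := GRing.Zmodule_isPzRing.Build quot_sort
  quot_mulA quot_mul1 quot_mulr1 quot_mulDl quot_mulDr.

Lemma quot_inD x y : quot_in (x + y) = quot_in x + quot_in y.
Proof. by rewrite [RHS]quot_addE. Qed.
Lemma quot_inM x y : quot_in (x * y) = quot_in x * quot_in y.
Proof. by rewrite [RHS]quot_mulE. Qed.

Fact quot_scaleA a b v : quot_scale a (quot_scale b v) = quot_scale (a * b) v.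
Proof. by elim/quot_ind: v => x; rewrite !quot_scaleE scalerA. Qed.
Fact quot_scale1 : left_id 1 quot_scale.
Proof. by elim/quot_ind=> x; rewrite quot_scaleE scale1r. Qed.
Fact quot_scaleDr : right_distributive quot_scale (+%R : quot_sort -> _).
Proof.
move=> z; elim/quot_ind=> x; elim/quot_ind=> y.
by rewrite -quot_inD !quot_scaleE -quot_inD scalerDr.
Qed.
Fact quot_scaleDl v : {morph quot_scale^~ v : a b / a + b}.
Proof.
by move=> a b; elim/quot_ind: v => x; rewrite !quot_scaleE -quot_inD scalerDl.
Qed.
Fact quot_scaleAl z (x y : quot_sort) : quot_scale z (x * y) = quot_scale z x * y.
Proof.
elim/quot_ind: x => x; elim/quot_ind: y => y.
by rewrite -quot_inM !quot_scaleE -quot_inM algZl.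
Qed.
Fact quot_scaleAr z (x y : quot_sort) : quot_scale z (x * y) = x * quot_scale z y.
Proof.
elim/quot_ind: x => x; elim/quot_ind: y => y.
by rewrite -quot_inM !quot_scaleE -quot_inM algZr.
Qed.

Definition quot_alg : alg K := @Alg K quot_sort quot_scale
  quot_scaleA quot_scale1 quot_scaleDr quot_scaleDl quot_scaleAl quot_scaleAr.

Lemma quot_inZ z x : quot_in (z *: x) = z *: (quot_in x : quot_alg).
Proof. by rewrite -[LHS]quot_scaleE. Qed.

Lemma quot_in_sum (J : Type) (r : seq J) F :
  quot_in (\sum_(j <- r) F j) = \sum_(j <- r) quot_in (F j) :> quot_alg.
Proof. exact: (big_morph _ quot_inD erefl). Qed.

End QuotAlg.

(* A commutative *-algebra [B] with an action of a group [Gamma]. *)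
Record base (K : numClosedFieldType) := Base {
  base_alg :> alg K;
  base_comm : forall x y : base_alg, x * y = y * x;
  base_star : base_alg -> base_alg;
  base_starP : is_star base_star;
  base_grp : groupType;
  act : base_grp -> base_alg -> base_alg;
  act_hom : forall g, is_alg_hom (act g);
  act1 : forall b, act 1%g b = b;
  actM : forall g h b, act (g * h)%g b = act g (act h b);
  act_star : forall g b, act g (base_star b) = base_star (act g b) }.

(* [V] is the direct sum of the subspaces [W i]. *)
Definition is_grading (K : pzRingType) (V : lmodType K) (I : choiceType)
    (W : I -> set V) : Prop :=
  [/\ forall i, W i 0,
      forall i z x y, W i x -> W i y -> W i (z *: x + y),
      forall x, exists s : seq I, exists f : I -> V,
        [/\ uniq s, forall i, W i (f i) & x = \sum_(i <- s) f i]
    & forall (s : seq I) (f : I -> V), uniq s -> (forall i, W i (f i)) ->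
        \sum_(i <- s) f i = 0 -> forall i, i \in s -> f i = 0].

Lemma sum_pred1_uniq (V : nmodType) (I : eqType) (r : seq I) i (F : I -> V) :
  uniq r -> i \in r -> \sum_(j <- r | j == i) F j = F i.
Proof.
move=> ur ir; rewrite big_mkcond (bigD1_seq i) //= eqxx big1 ?addr0 // => j.
by move=> /negPf ->.
Qed.

Lemma sum_sub_uniq (V : nmodType) (I : eqType) (Q : pred I) (u r : seq I) (h : I -> V) :
  uniq u -> uniq r -> {subset r <= u} ->
  \sum_(i <- u | Q i) (if i \in r then h i else 0) = \sum_(i <- r | Q i) h i.
Proof.
move=> uu ur hr; rewrite -big_mkcondr /=; under eq_bigl do rewrite andbC.
rewrite -big_filter_cond; apply: perm_big; apply: uniq_perm => //.
  exact: filter_uniq.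
by move=> i; rewrite mem_filter andb_idr // => /hr.
Qed.

Section Grading.
Variables (K : pzRingType) (V : lmodType K) (I : choiceType) (W : I -> set V).

Lemma grading_span (s : seq V) : (forall i, W i 0) ->
  (forall i z x y, W i x -> W i y -> W i (z *: x + y)) ->
  (forall y, y \in s -> exists i, W i y) ->
  exists t : seq I, exists f : I -> V,
    [/\ uniq t, forall i, W i (f i) & \sum_(y <- s) y = \sum_(i <- t) f i].
Proof.
move=> W0 WD; elim: s => [|y s IHs] hs.
  by exists [::], (fun=> 0); rewrite !big_nil.
have [t [f [ut hf sE]]] : exists t : seq I, exists f : I -> V,
    [/\ uniq t, forall i, W i (f i) & \sum_(y <- s) y = \sum_(i <- t) f i].
  by apply: IHs => z zs; apply: hs; rewrite inE zs orbT.
have [i0 hy] := hs y (mem_head _ _).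
pose f' i := (if i == i0 then y else 0) + (if i \in t then f i else 0).
have W' i : W i (f' i).
  rewrite /f' -[X in X + _]scale1r; apply: WD; case: ifP => //.
  by move=> /eqP ->.
have E (r : seq I) : uniq r -> i0 \in r -> {subset t <= r} ->
    \sum_(i <- r) f' i = y + \sum_(i <- t) f i.
  move=> ur ir tr; rewrite big_split /= -[X in X + _]big_mkcond /=.
  by rewrite sum_pred1_uniq // sum_sub_uniq.
exists (undup (i0 :: t)), f'; split => //; first exact: undup_uniq.
rewrite big_cons sE E //; first exact: undup_uniq.
  by rewrite mem_undup mem_head.
by move=> i it; rewrite mem_undup inE it orbT.
Qed.

Lemma grading_proj (P : pred I) : is_grading W -> exists pr : V -> V,
  linear pr /\ forall i x, W i x -> pr x = if P i then x else 0.
Proof.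
move=> [W0 WD sp ind].
have WN i x : W i x -> W i (- x).
  by move=> h; rewrite -[- x]addr0 -scaleN1r; apply: WD.
have /choice[d hd] x : exists d : seq I * (I -> V),
    [/\ uniq d.1, forall i, W i (d.2 i) & x = \sum_(i <- d.1) d.2 i].
  by have [s [f h]] := sp x; exists (s, f).
pose pr x := \sum_(i <- (d x).1 | P i) (d x).2 i.
have prE s f : uniq s -> (forall i, W i (f i)) ->
    pr (\sum_(i <- s) f i) = \sum_(i <- s | P i) f i.
  move=> us hf; rewrite /pr; set x := \sum_(i <- s) f i.
  case: (hd x) => ut hg; set t := (d x).1; set g := (d x).2 => xE.
  pose u := undup (s ++ t).
  pose k i := (if i \in s then f i else 0) - (if i \in t then g i else 0).
  have kW i : W i (k i).
    rewrite /k -[X in X - _]scale1r; apply: WD; first by case: ifP.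
    by apply: WN; case: ifP.
  have uu : uniq u by exact: undup_uniq.
  have su : {subset s <= u} by move=> i h; rewrite mem_undup mem_cat h.
  have tu : {subset t <= u} by move=> i h; rewrite mem_undup mem_cat h orbT.
  have k0 i : i \in u -> k i = 0.
    apply: ind => //; rewrite sumrB !sum_sub_uniq //.
    by apply/eqP; rewrite subr_eq0 -xE.
  apply/eqP; rewrite -(sum_sub_uniq P f uu) // -(sum_sub_uniq P g uu) // eq_sym -subr_eq0 -sumrB.
  by rewrite big_seq_cond big1 // => i /andP[/k0].
have prW i x : W i x -> pr x = if P i then x else 0.
  move=> hx; have := prE [:: i] (fun j => if j == i then x else 0) isT.
  rewrite big_seq1 eqxx big_mkcond big_seq1 eqxx; apply=> j.
  by case: eqP => [->|].
exists pr; split=> // z x y.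
have [us hf xE] := hd x; have [ut hg yE] := hd y.
set s := (d x).1 in us xE; set t := (d y).1 in ut yE.
set f := (d x).2 in hf xE; set g := (d y).2 in hg yE.
pose u := undup (s ++ t).
pose k i := z *: (if i \in s then f i else 0) + (if i \in t then g i else 0).
have uu : uniq u by exact: undup_uniq.
have kW i : W i (k i) by apply: WD; case: ifP.
have sumE (Q : pred I) (r : seq I) (h : I -> V) : uniq r -> {subset r <= u} ->
    \sum_(i <- u | Q i) (if i \in r then h i else 0) = \sum_(i <- r | Q i) h i.
  move=> ur hr; rewrite -big_mkcondr /=.
  under eq_bigl do rewrite andbC.
  rewrite -big_filter_cond; apply: perm_big; apply: uniq_perm => //.
    exact: filter_uniq.
  by move=> i; rewrite mem_filter andb_idr // => /hr.
have su : {subset s <= u} by move=> i h; rewrite mem_undup mem_cat h.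
have tu : {subset t <= u} by move=> i h; rewrite mem_undup mem_cat h orbT.
have kE (Q : pred I) : \sum_(i <- u | Q i) k i =
    z *: (\sum_(i <- s | Q i) f i) + \sum_(i <- t | Q i) g i.
  by rewrite big_split /= -scaler_sumr !sum_sub_uniq.
by rewrite {1}xE {1}yE -(kE predT) prE // kE.
Qed.

End Grading.

(* A [(B, Gamma)]-algebra, with the degrees [deg] and the maps [r] and [s]. *)
Record bgAlg (K : numClosedFieldType) (X : base K) := BGAlg {
  bg_alg :> alg K;
  deg : base_grp X -> base_grp X -> set bg_alg;
  rmap : X -> bg_alg;
  smap : X -> bg_alg;
  deg_grading : is_grading (fun p : base_grp X * base_grp X => deg p.1 p.2);
  degM : forall g h g' h' x y,
    deg g h x -> deg g' h' y -> deg (g * g')%g (h * h')%g (x * y);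
  rmap_hom : is_alg_hom rmap;
  smap_hom : is_alg_hom smap;
  rmap_deg : forall b, deg 1%g 1%g (rmap b);
  smap_deg : forall b, deg 1%g 1%g (smap b);
  rsmapC : forall b c, rmap b * smap c = smap c * rmap b;
  rmap_act : forall g h a b, deg g h a -> a * rmap b = rmap (act g b) * a;
  smap_act : forall g h a b, deg g h a -> a * smap b = smap (act h b) * a }.

Definition is_bg_mor (K : numClosedFieldType) (X : base K) (A C : bgAlg X)
    (f : A -> C) : Prop :=
  [/\ is_alg_hom f,
      forall g h a, deg g h a -> deg g h (f a),
      forall b, f (rmap A b) = rmap C b
    & forall b, f (smap A b) = smap C b].

Definition is_bg_star (K : numClosedFieldType) (X : base K) (A : bgAlg X)
    (star : A -> A) : Prop :=
  [/\ is_star star,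
      forall g h, star @` deg g h = deg g^-1%g h^-1%g,
      forall b, star (rmap A b) = rmap A (base_star b)
    & forall b, star (smap A b) = smap A (base_star b)].

Section AlgHom.
Variables (K : pzRingType) (A C : alg K) (f : A -> C).
Hypothesis hf : is_alg_hom f.
Lemma alg_homP z x y : f (z *: x + y) = z *: f x + f y.
Proof. exact: (proj1 hf z x y). Qed.
Lemma alg_homD x y : f (x + y) = f x + f y.
Proof. by rewrite -[x in LHS]scale1r alg_homP scale1r. Qed.
Lemma alg_hom0 : f 0 = 0.
Proof. by apply: (addIr (f 0)); rewrite -alg_homD !add0r. Qed.
Lemma alg_homZ z x : f (z *: x) = z *: f x.
Proof. by rewrite -[z *: x]addr0 alg_homP alg_hom0 addr0. Qed.
Lemma alg_hom1 : f 1 = 1. Proof. exact: (proj2 hf).1. Qed.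
Lemma alg_homM x y : f (x * y) = f x * f y.
Proof. exact: ((proj2 hf).2 x y). Qed.
End AlgHom.

Section BGTheory.
Variables (K : numClosedFieldType) (X : base K) (A : bgAlg X).
Lemma deg0 g h : @deg _ _ A g h 0.
Proof. by case: (deg_grading A) => /(_ (g, h)). Qed.
Lemma degP g h z (x y : A) : deg g h x -> deg g h y -> deg g h (z *: x + y).
Proof. by case: (deg_grading A) => _ /(_ (g, h)) /= H _ _; apply: H. Qed.
Lemma deg1 : deg 1%g 1%g (1 : A).
Proof. by rewrite -(alg_hom1 (rmap_hom A)); apply: rmap_deg. Qed.
End BGTheory.

Section Crossed.
Variables (K : numClosedFieldType) (X : base K).
Local Notation G := (base_grp X).

(* The elements of the crossed product are formal sums of pairs [(b, g)], read as
   [b g]; by [crossP] below they are determined by their coefficients in [B]. *)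
Definition cross_test (V : zmodType) (f : X * G -> V) : Prop :=
  forall b c g, f (b + c, g) = f (b, g) + f (c, g).

Program Definition cross_data : span_data K := {|
  sp_gen := (X * G)%type;
  sp_test := cross_test;
  sp_scale z p := (z *: p.1, p.2);
  sp_mul p q := (p.1 * act p.2 q.1, (p.2 * q.2)%g);
  sp_one := (1, 1%g) |}.
Next Obligation. by move=> V t z ht b c g /=; rewrite scalerDr ht. Qed.
Next Obligation.
by move=> V t x ht b c g /=; rewrite (alg_homD (act_hom _)) mulrDr ht.
Qed.
Next Obligation. by move=> V t x ht b c g /=; rewrite mulrDl ht. Qed.
Next Obligation. by move=> V t y z x ht /=; rewrite scalerDl ht. Qed.
Next Obligation. by move=> [b g]; rewrite scale1r. Qed.
Next Obligation. by move=> y z [b g] /=; rewrite scalerA. Qed.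
Next Obligation.
by move=> [b g] [c h] [d k] /=; rewrite (alg_homM (act_hom _)) actM !mulrA mulgA.
Qed.
Next Obligation. by move=> [b g] /=; rewrite act1 mul1r mul1g. Qed.
Next Obligation.
by move=> [b g] /=; rewrite (alg_hom1 (act_hom _)) mulr1 mulg1.
Qed.
Next Obligation. by move=> z [b g] [c h] /=; rewrite algZl. Qed.
Next Obligation.
by move=> z [b g] [c h] /=; rewrite algZr (alg_homZ (act_hom _)).
Qed.

Definition cross_alg : alg K := span_alg cross_data.

Definition cross_in (b : X) (g : G) : cross_alg := @span_in K cross_data (b, g).

Definition cross_coef (g : G) : cross_alg -> X :=
  @span_lift K cross_data X (fun p => if p.2 == g then p.1 else 0).

Fact cross_coef_test g :
  @sp_test K cross_data X (fun p : X * G => if p.2 == g then p.1 else 0).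
Proof. by move=> b c h /=; case: ifP; rewrite ?addr0. Qed.

Lemma cross_coef_in g b h : cross_coef g (cross_in b h) = if h == g then b else 0.
Proof. exact: (@span_lift_in _ cross_data _ _ (b, h) (cross_coef_test g)). Qed.

Lemma cross_inD b c g : cross_in (b + c) g = cross_in b g + cross_in c g.
Proof.
apply/esym; rewrite [LHS]span_classD; apply/span_classP => V f hf.
by rewrite big_cons !big_seq1 hf.
Qed.
Lemma cross_in0 g : cross_in 0 g = 0.
Proof. by apply: (addIr (cross_in 0 g)); rewrite -cross_inD !add0r. Qed.
Lemma cross_inZ z b g : cross_in (z *: b) g = z *: cross_in b g.
Proof. by rewrite [RHS]span_inZ. Qed.
Lemma cross_inM b g c h :
  cross_in b g * cross_in c h = cross_in (b * act g c) (g * h)%g.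
Proof. exact: span_inM. Qed.

Lemma crossP (x y : cross_alg) : (forall g, cross_coef g x = cross_coef g y) -> x = y.
Proof.
elim/span_ind: x => s; elim/span_ind: y => t h.
have E g : \sum_(p <- s | p.2 == g) p.1 = \sum_(p <- t | p.2 == g) p.1.
  have := h g; rewrite /cross_coef (@span_liftE _ _ _ _ s (cross_coef_test g)).
  by rewrite (@span_liftE _ _ _ _ t (cross_coef_test g)) -!big_mkcond.
apply/span_classP => V f hf.
have f0 g : f (0, g) = 0.
  by apply: (addIr (f (0, g))); rewrite -[LHS]hf !add0r.
have F (r : seq (X * G)) (u : seq G) : uniq u -> {subset map snd r <= u} ->
    \sum_(p <- r) f p = \sum_(g <- u) f (\sum_(p <- r | p.2 == g) p.1, g).
  move=> uu ru; under [RHS]eq_bigr => g _.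
    rewrite (big_morph (fun b => f (b, g)) (fun b c => hf b c g) (f0 g)); over.
  under [RHS]eq_bigr do rewrite big_mkcond.
  rewrite exchange_big /=; apply: eq_big_seq => -[b g] pr /=.
  rewrite -big_mkcond /=; under eq_bigl do rewrite eq_sym.
  by rewrite sum_pred1_uniq //; apply: ru; apply/mapP; exists (b, g).
pose u := undup (map snd (s ++ t)).
rewrite !(F _ u) ?undup_uniq //; first by apply: eq_bigr => g _; rewrite E.
  by move=> g; rewrite mem_undup map_cat mem_cat => ->; rewrite orbT.
by move=> g; rewrite mem_undup map_cat mem_cat => ->.
Qed.

Definition cross_deg (g h : G) : set cross_alg :=
  [set x | exists b, x = if g == h then cross_in b g else 0].

Fact cross_grading : is_grading (fun p : G * G => cross_deg p.1 p.2).
Proof.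
have W0 (i : G * G) : cross_deg i.1 i.2 0.
  by exists 0; rewrite cross_in0 if_same.
have WD (i : G * G) z x y : cross_deg i.1 i.2 x -> cross_deg i.1 i.2 y ->
    cross_deg i.1 i.2 (z *: x + y).
  move=> [b ->] [c ->]; exists (z *: b + c); case: ifP => _.
    by rewrite cross_inD cross_inZ.
  by rewrite scaler0 addr0.
split=> // [x|s f us hf s0 [g h] gs].
  have [|t [f [ut hf E]]] := @grading_span _ _ _ (fun p : G * G => cross_deg p.1 p.2)
    [seq @span_in K cross_data p | p <- span_repr x] W0 WD.
    move=> y /mapP[[b g] _ ->]; exists (g, g), b; by rewrite /= eqxx.
  by exists t, f; split; rewrite // -E big_map -span_sumE.
have [/= b fE] := hf (g, h); rewrite fE.
case: (g =P h) gs fE => // <- gs fE.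
have : cross_coef g (\sum_(i <- s) f i) = 0.
  by rewrite s0 [LHS]span_lift0 //; apply: cross_coef_test.
rewrite [LHS]span_lift_sum; last exact: cross_coef_test.
rewrite (bigD1_seq (g, g)) //= big1 => [|[g' h'] ne].
  by rewrite -/(cross_coef g _) fE cross_coef_in eqxx addr0 => ->; apply: cross_in0.
rewrite -/(cross_coef g _); have [/= c ->] := hf (g', h').
case: (g' =P h') ne => [<-|_ _]; last by rewrite [LHS]span_lift0 //; apply: cross_coef_test.
by rewrite cross_coef_in; case: (g' =P g) => // ->; rewrite eqxx.
Qed.
Fact cross_degM g h g' h' x y : cross_deg g h x -> cross_deg g' h' y ->
  cross_deg (g * g')%g (h * h')%g (x * y).
Proof.
move=> [b ->] [c ->]; case: (g =P h) => [->|_]; last first.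
  by exists 0; rewrite cross_in0 if_same mul0r.
case: (g' =P h') => [->|_]; last by exists 0; rewrite cross_in0 if_same mulr0.
by exists (b * act h c); rewrite eqxx cross_inM.
Qed.

Definition cross_base (b : X) : cross_alg := cross_in b 1%g.

Fact cross_base_hom : is_alg_hom cross_base.
Proof.
split=> [z b c|]; first by rewrite /cross_base cross_inD cross_inZ.
by split=> // b c; rewrite /cross_base cross_inM act1 mulg1.
Qed.

Fact cross_base_deg b : cross_deg 1%g 1%g (cross_base b).
Proof. by exists b; rewrite eqxx. Qed.

Fact cross_baseC b c : cross_base b * cross_base c = cross_base c * cross_base b.
Proof. by rewrite !cross_inM !act1 base_comm. Qed.

Fact cross_base_actl g h a b : cross_deg g h a ->
  a * cross_base b = cross_base (act g b) * a.
Proof.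
move=> [c ->]; case: eqP => _; last by rewrite mul0r mulr0.
by rewrite !cross_inM mulg1 mul1g act1 base_comm.
Qed.

Fact cross_base_actr g h a b : cross_deg g h a ->
  a * cross_base b = cross_base (act h b) * a.
Proof.
move=> [c ->]; case: eqP => [->|_]; last by rewrite mul0r mulr0.
by rewrite !cross_inM mulg1 mul1g act1 base_comm.
Qed.

Definition cross : bgAlg X := @BGAlg K X cross_alg cross_deg cross_base cross_base
  cross_grading cross_degM cross_base_hom cross_base_hom cross_base_deg
  cross_base_deg cross_baseC cross_base_actl cross_base_actr.

Definition cross_star : cross -> cross := @span_lift K cross_data cross
  (fun p => cross_in (act p.2^-1%g (base_star p.1)) p.2^-1%g).

Lemma cross_starE b g :
  cross_star (cross_in b g) = cross_in 1 g^-1%g * cross_base (base_star b).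
Proof.
rewrite [LHS]span_lift_in /= => [|c d h /=].
  by rewrite cross_inM mul1r mulg1.
have [sD _ _ _] := @base_starP K X.
by rewrite sD (alg_homD (act_hom _)) cross_inD.
Qed.

(* the inverse of [cross_base] on its image *)
Definition cross_to_base : cross -> X := cross_coef 1%g.

Lemma cross_baseK : cancel cross_base cross_to_base.
Proof. by move=> b; rewrite /cross_to_base cross_coef_in eqxx. Qed.

(* the linear maps [b g |-> r(b)] and [g b |-> s(b)] *)
Definition rhat (A : bgAlg X) : cross -> A :=
  @span_lift K cross_data A (fun p => rmap A p.1).
Definition scheck (A : bgAlg X) : cross -> A :=
  @span_lift K cross_data A (fun p => smap A (act p.2^-1%g p.1)).
(* the linear map [b g |-> s(b)] *)
Definition shat (A : bgAlg X) : cross -> A :=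
  @span_lift K cross_data A (fun p => smap A p.1).

Lemma rhatE A b g : rhat A (cross_in b g) = rmap A b.
Proof.
by rewrite [LHS]span_lift_in // => c d h; rewrite (alg_homD (rmap_hom A)).
Qed.
Lemma shatE A b g : shat A (cross_in b g) = smap A b.
Proof.
by rewrite [LHS]span_lift_in // => c d h; rewrite (alg_homD (smap_hom A)).
Qed.
Lemma scheckE A b g : scheck A (cross_in 1 g * cross_base b) = smap A b.
Proof.
rewrite cross_inM mul1r mulg1 [LHS]span_lift_in /= => [|c d h /=].
  by rewrite -actM mulVg act1.
by rewrite (alg_homD (act_hom _)) (alg_homD (smap_hom A)).
Qed.

End Crossed.

Section CoOpposite.
Variables (K : numClosedFieldType) (X : base K) (A : bgAlg X).
Local Notation G := (base_grp X).

Definition coop_deg (g h : G) : set (op_alg A) := @deg K X A h^-1%g g^-1%g.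
Definition coop_rmap : X -> op_alg A := smap A.
Definition coop_smap : X -> op_alg A := rmap A.

Fact coop_grading : is_grading (fun p : G * G => coop_deg p.1 p.2).
Proof.
have [W0 WD sp ind] := deg_grading A.
pose k (p : G * G) := (p.2^-1, p.1^-1)%g.
have kK : involutive k by move=> [g h]; rewrite /k /= !invgK.
split=> [i|i z x y|x|s f us hf s0 i si].
- exact: (W0 (k i)).
- exact: (WD (k i)).
- have [s [f [us hf ->]]] := sp x; exists (map k s), (f \o k); split.
  + by rewrite map_inj_uniq //; apply: inv_inj.
  + by move=> i; apply: (hf (k i)).
  + by rewrite big_map; apply: eq_bigr => i _; rewrite /= kK.
- rewrite -[i]kK; apply: (ind (map k s) (f \o k)) => [|j||].
  + by rewrite map_inj_uniq //; apply: inv_inj.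
  + by have := hf (k j); rewrite /coop_deg /= !invgK.
  + by rewrite big_map -[RHS]s0; apply: eq_bigr => j _; rewrite /= kK.
  + by rewrite map_f.
Qed.

Fact coop_degM g h g' h' x y : coop_deg g h x -> coop_deg g' h' y ->
  coop_deg (g * g')%g (h * h')%g (x * y).
Proof. by move=> hx hy; rewrite /coop_deg !invgM; apply: (degM hy hx). Qed.

Fact coop_rmap_hom : is_alg_hom coop_rmap.
Proof.
have h := smap_hom A; split; first exact: (proj1 h).
split=> [|b c]; first exact: (alg_hom1 h).
by rewrite /coop_rmap base_comm (alg_homM h).
Qed.
Fact coop_smap_hom : is_alg_hom coop_smap.
Proof.
have h := rmap_hom A; split; first exact: (proj1 h).
split=> [|b c]; first exact: (alg_hom1 h).
by rewrite /coop_smap base_comm (alg_homM h).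
Qed.
Fact coop_rmap_deg b : coop_deg 1%g 1%g (coop_rmap b).
Proof. by rewrite /coop_deg invg1; apply: smap_deg. Qed.
Fact coop_smap_deg b : coop_deg 1%g 1%g (coop_smap b).
Proof. by rewrite /coop_deg invg1; apply: rmap_deg. Qed.
Fact coop_rsmapC b c : coop_rmap b * coop_smap c = coop_smap c * coop_rmap b.
Proof. exact: (rsmapC A c b). Qed.
Fact coop_rmap_act g h a b : coop_deg g h a ->
  a * coop_rmap b = coop_rmap (act g b) * a.
Proof.
move=> ha; transitivity ((smap A b : A) * (a : A)) => //.
transitivity ((a : A) * smap A (act g b)) => //.
by rewrite (smap_act _ ha) -actM mulVg act1.
Qed.
Fact coop_smap_act g h a b : coop_deg g h a ->
  a * coop_smap b = coop_smap (act h b) * a.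
Proof.
move=> ha; transitivity ((rmap A b : A) * (a : A)) => //.
transitivity ((a : A) * rmap A (act h b)) => //.
by rewrite (rmap_act _ ha) -actM mulVg act1.
Qed.

Definition coop : bgAlg X := @BGAlg K X (op_alg A) coop_deg coop_rmap coop_smap
  coop_grading coop_degM coop_rmap_hom coop_smap_hom coop_rmap_deg
  coop_smap_deg coop_rsmapC coop_rmap_act coop_smap_act.

End CoOpposite.

Section Tensor.
Variables (K : comPzRingType) (A C : alg K).

(* By the universal property of the tensor product over [K], two formal sums of
   elementary tensors are equal in it if and only if all biadditive [K]-balanced
   maps take the same value on them. *)
Definition tens_test (V : zmodType) (f : A * C -> V) : Prop :=
  [/\ forall a b c, f (a + b, c) = f (a, c) + f (b, c),
      forall a c d, f (a, c + d) = f (a, c) + f (a, d)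
    & forall (z : K) a c, f (z *: a, c) = f (a, z *: c)].

Program Definition tens_data : span_data K := {|
  sp_gen := (A * C)%type;
  sp_test := tens_test;
  sp_scale z p := (z *: p.1, p.2);
  sp_mul p q := (p.1 * q.1, p.2 * q.2);
  sp_one := (1, 1) |}.
Next Obligation.
move=> V t z [Dl Dr Z]; split=> [a b c|a c d|y a c] /=.
- by rewrite scalerDr Dl.
- by rewrite Dr.
- by rewrite -Z !scalerA mulrC.
Qed.
Next Obligation.
move=> V t x [Dl Dr Z]; split=> [a b c|a c d|y a c] /=.
- by rewrite mulrDr Dl.
- by rewrite mulrDr Dr.
- by rewrite -!algZr Z.
Qed.
Next Obligation.
move=> V t x [Dl Dr Z]; split=> [a b c|a c d|y a c] /=.
- by rewrite mulrDl Dl.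
- by rewrite mulrDl Dr.
- by rewrite -!algZl Z.
Qed.
Next Obligation. by move=> V t y z x [Dl Dr Z] /=; rewrite scalerDl Dl. Qed.
Next Obligation. by move=> [a c]; rewrite scale1r. Qed.
Next Obligation. by move=> y z [a c] /=; rewrite scalerA. Qed.
Next Obligation. by move=> [a c] [b d] [e f] /=; rewrite !mulrA. Qed.
Next Obligation. by move=> [a c] /=; rewrite !mul1r. Qed.
Next Obligation. by move=> [a c] /=; rewrite !mulr1. Qed.
Next Obligation. by move=> z [a c] [b d] /=; rewrite algZl. Qed.
Next Obligation. by move=> z [a c] [b d] /=; rewrite algZr. Qed.

Definition tens : alg K := span_alg tens_data.
Definition tens_in (a : A) (c : C) : tens := @span_in K tens_data (a, c).

Lemma tens_inDl a b c : tens_in (a + b) c = tens_in a c + tens_in b c.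
Proof.
apply/esym; rewrite [LHS]span_classD; apply/span_classP => V f [Dl _ _].
by rewrite big_cons !big_seq1 Dl.
Qed.
Lemma tens_inDr a c d : tens_in a (c + d) = tens_in a c + tens_in a d.
Proof.
apply/esym; rewrite [LHS]span_classD; apply/span_classP => V f [_ Dr _].
by rewrite big_cons !big_seq1 Dr.
Qed.
Lemma tens_inZl z a c : tens_in (z *: a) c = z *: tens_in a c.
Proof. by rewrite [RHS]span_inZ. Qed.
Lemma tens_inZr z a c : tens_in a (z *: c) = z *: tens_in a c.
Proof.
rewrite -tens_inZl; apply/esym/span_classP => V f [_ _ Z].
by rewrite !big_seq1 Z.
Qed.
Lemma tens_inM a c b d : tens_in a c * tens_in b d = tens_in (a * b) (c * d).
Proof. exact: span_inM. Qed.
Lemma tens_in0 c : tens_in 0 c = 0.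
Proof. by apply: (addIr (tens_in 0 c)); rewrite -tens_inDl !add0r. Qed.
Lemma tens_inr0 a : tens_in a 0 = 0.
Proof. by apply: (addIr (tens_in a 0)); rewrite -tens_inDr !add0r. Qed.

End Tensor.

Section Fiber.
Variables (K : numClosedFieldType) (X : base K) (A C : bgAlg X).
Local Notation G := (base_grp X).

Definition composable (p : A * C) : Prop :=
  exists g h k, deg g h p.1 /\ deg h k p.2.

(* the subalgebra [sum_(g, h, k) A_(g, h) (x) C_(h, k)] of the tensor product *)
Definition gtens_set : set (tens A C) := [set x | exists s : seq (A * C),
  (forall p, p \in s -> composable p) /\ x = \sum_(p <- s) tens_in p.1 p.2].
Definition gtens_pred : {pred tens A C} := fun x => `[< gtens_set x >].

Fact gtens_zmod_closed : zmod_closed gtens_pred.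
Proof.
split=> [|x y /asboolP[s [hs ->]] /asboolP[t [ht ->]]]; apply/asboolP.
  by exists [::]; rewrite big_nil.
exists (s ++ [seq (- p.1, p.2) | p <- t]); split.
  move=> p; rewrite mem_cat => /orP[/hs //|/mapP[q /ht [g [h [k [h1 h2]]]] ->]].
  exists g, h, k; split=> //=; rewrite -[- _]addr0 -scaleN1r.
  by apply: degP => //; apply: deg0.
rewrite big_cat big_map /= -sumrN; congr (_ + _); apply: eq_bigr => p _ /=.
by rewrite -[- p.1]scaleN1r tens_inZl scaleN1r.
Qed.

Fact gtens_mulr_closed : mulr_closed gtens_pred.
Proof.
split=> [|x y /asboolP[s [hs ->]] /asboolP[t [ht ->]]]; apply/asboolP.
  exists [:: (1, 1)]; rewrite big_seq1; split=> // p; rewrite inE => /eqP ->.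
  by exists 1%g, 1%g, 1%g; split; apply: deg1.
exists [seq (p.1 * q.1, p.2 * q.2) | p <- s, q <- t]; split.
  move=> p /allpairsP[[u v] [/hs [g [h [k [h1 h2]]]]]].
  move=> /ht [g' [h' [k' [h1' h2']]]] ->.
  by exists (g * g')%g, (h * h')%g, (k * k')%g; split; apply: degM.
rewrite big_allpairs_dep /= mulr_suml; apply: eq_bigr => p _.
by rewrite mulr_sumr; apply: eq_bigr => q _; rewrite tens_inM.
Qed.

Fact gtens_submod_closed : submod_closed gtens_pred.
Proof.
split=> [|z x y /asboolP[s [hs ->]] hy]; first by case: gtens_zmod_closed.
rewrite -[y]opprK; apply: (proj2 gtens_zmod_closed); last first.
  by rewrite -[- y]sub0r; apply: (proj2 gtens_zmod_closed) => //;
    case: gtens_zmod_closed.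
apply/asboolP; exists [seq (z *: p.1, p.2) | p <- s]; split.
  move=> p /mapP[q /hs [g [h [k [h1 h2]]]] ->].
  exists g, h, k; split=> //=; rewrite -[_ *: _]addr0.
  by apply: degP => //; apply: deg0.
by rewrite big_map scaler_sumr; apply: eq_bigr => p _ /=; rewrite tens_inZl.
Qed.

HB.instance Definition _ := GRing.isZmodClosed.Build _ gtens_pred gtens_zmod_closed.
HB.instance Definition _ := GRing.isMulClosed.Build _ gtens_pred gtens_mulr_closed.

Record gtens_sort := Gtens { gtens_val : tens A C; _ : gtens_val \in gtens_pred }.
HB.instance Definition _ := [isSub for gtens_val].
HB.instance Definition _ := [Choice of gtens_sort by <:].
HB.instance Definition _ := [SubChoice_isSubZmodule of gtens_sort by <:].
HB.instance Definition _ :=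
  GRing.SubZmodule_isSubPzRing.Build _ _ gtens_sort (GRing.subringClosedP _).

Definition gtens_scale (z : K) (x : gtens_sort) : gtens_sort :=
  insubd (0 : gtens_sort) (z *: val x).
Lemma gtens_scaleE z x : val (gtens_scale z x) = z *: val x.
Proof.
rewrite val_insubd; have -> // : z *: val x \in gtens_pred.
rewrite -[_ *: _]addr0; apply: (proj2 gtens_submod_closed); first exact: valP.
by case: gtens_zmod_closed.
Qed.
Fact gtens_scaleA a b v : gtens_scale a (gtens_scale b v) = gtens_scale (a * b) v.
Proof. by apply: val_inj; rewrite !gtens_scaleE scalerA. Qed.
Fact gtens_scale1 : left_id 1 gtens_scale.
Proof. by move=> v; apply: val_inj; rewrite !gtens_scaleE scale1r. Qed.
Fact gtens_scaleDr : right_distributive gtens_scale +%R.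
Proof. by move=> z v w; apply: val_inj; rewrite raddfD /= !gtens_scaleE scalerDr. Qed.
Fact gtens_scaleDl v : {morph gtens_scale^~ v : a b / a + b}.
Proof. by move=> a b; apply: val_inj; rewrite raddfD /= !gtens_scaleE scalerDl. Qed.
Fact gtens_scaleAl a x y : gtens_scale a (x * y) = gtens_scale a x * y.
Proof. by apply: val_inj; rewrite rmorphM /= !gtens_scaleE rmorphM algZl. Qed.
Fact gtens_scaleAr a x y : gtens_scale a (x * y) = x * gtens_scale a y.
Proof. by apply: val_inj; rewrite rmorphM /= !gtens_scaleE rmorphM algZr. Qed.
Definition gtens : alg K := @Alg K gtens_sort gtens_scale gtens_scaleA
  gtens_scale1 gtens_scaleDr gtens_scaleDl gtens_scaleAl gtens_scaleAr.

(* The fiber product is the quotient of [gtens] by the ideal generated by the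
   elements [s(b) (x) 1 - 1 (x) r(b)]. *)
Definition fib_rel : set gtens := [set x | exists b,
  gtens_val x = tens_in (smap A b) 1 - tens_in 1 (rmap C b)].

Definition fib_alg : alg K := quot_alg fib_rel.

(* the class of [t], which is meaningful if [t] lies in [gtens_set] *)
Definition fib_class (t : tens A C) : fib_alg :=
  quot_in fib_rel (insubd (0 : gtens_sort) t).

(* the class of the elementary tensor of [a] and [c] if [composable (a, c)] *)
Definition fib_in (a : A) (c : C) : fib_alg := fib_class (tens_in a c).

Lemma composable_gtens a c : composable (a, c) -> tens_in a c \in gtens_pred.
Proof.
move=> h; apply/asboolP; exists [:: (a, c)]; rewrite big_seq1; split=> // p.
by rewrite inE => /eqP ->.
Qed.

Lemma composable1 : composable (1, 1).
Proof. by exists 1%g, 1%g, 1%g; split; apply: deg1. Qed.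

Lemma val_gtens t : t \in gtens_pred -> val (insubd (0 : gtens_sort) t) = t.
Proof. exact: insubdK. Qed.

Lemma fib_classD t u : t \in gtens_pred -> u \in gtens_pred ->
  fib_class (t + u) = fib_class t + fib_class u.
Proof.
move=> ht hu; rewrite -[RHS]quot_inD; congr quot_in; apply: val_inj.
by rewrite raddfD /= !val_gtens ?rpredD.
Qed.

Lemma fib_classM t u : t \in gtens_pred -> u \in gtens_pred ->
  fib_class (t * u) = fib_class t * fib_class u.
Proof.
move=> ht hu; rewrite -[RHS]quot_inM; congr quot_in; apply: val_inj.
by rewrite rmorphM /= !val_gtens ?rpredM.
Qed.

Lemma gtensZ z t : t \in gtens_pred -> z *: t \in gtens_pred.
Proof.
move=> ht; rewrite -[_ *: _]addr0; apply: (proj2 gtens_submod_closed) => //.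
by case: gtens_zmod_closed.
Qed.

Lemma fib_classZ z t : t \in gtens_pred -> fib_class (z *: t) = z *: fib_class t.
Proof.
move=> ht; rewrite -[RHS]quot_inZ; congr quot_in; apply: val_inj.
by rewrite /= gtens_scaleE !val_gtens ?gtensZ.
Qed.

Lemma fib_class0 : fib_class 0 = 0.
Proof.
by rewrite -[LHS](addKr (fib_class 0)) -fib_classD ?rpred0 // addr0 addNr.
Qed.

Lemma fib_class_sum (J : eqType) (s : seq J) (F : J -> tens A C) :
  (forall j, j \in s -> F j \in gtens_pred) ->
  fib_class (\sum_(j <- s) F j) = \sum_(j <- s) fib_class (F j).
Proof.
elim: s => [|j s IHs] hs; first by rewrite !big_nil fib_class0.
have hs' i : i \in s -> F i \in gtens_pred.
  by move=> si; apply: hs; rewrite inE si orbT.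
rewrite !big_cons fib_classD ?IHs ?hs ?mem_head //.
by rewrite big_seq; apply: rpred_sum.
Qed.

Lemma fib_inDl a b c : composable (a, c) -> composable (b, c) ->
  fib_in (a + b) c = fib_in a c + fib_in b c.
Proof.
by move=> ha hb; rewrite /fib_in tens_inDl fib_classD //; apply: composable_gtens.
Qed.
Lemma fib_inDr a c d : composable (a, c) -> composable (a, d) ->
  fib_in a (c + d) = fib_in a c + fib_in a d.
Proof.
by move=> ha hb; rewrite /fib_in tens_inDr fib_classD //; apply: composable_gtens.
Qed.
Lemma fib_inZl z a c : composable (a, c) -> fib_in (z *: a) c = z *: fib_in a c.
Proof.
by move=> ha; rewrite /fib_in tens_inZl fib_classZ //; apply: composable_gtens.
Qed.
Lemma fib_inZr z a c : composable (a, c) -> fib_in a (z *: c) = z *: fib_in a c.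
Proof.
by move=> ha; rewrite /fib_in tens_inZr fib_classZ //; apply: composable_gtens.
Qed.
Lemma fib_inM a c b d : composable (a, c) -> composable (b, d) ->
  fib_in a c * fib_in b d = fib_in (a * b) (c * d).
Proof.
move=> ha hb; rewrite /fib_in -tens_inM fib_classM //; exact: composable_gtens.
Qed.
Lemma fib_in11 : fib_in 1 1 = 1.
Proof.
rewrite /fib_in -[RHS]/(quot_in _ 1); congr quot_in; apply: val_inj.
by rewrite val_gtens //; apply: (composable_gtens composable1).
Qed.

Lemma fib_repr (x : fib_alg) : exists2 t, t \in gtens_pred & x = fib_class t.
Proof.
rewrite -(quot_reprK x); exists (val (quot_repr x)); first exact: valP.
by rewrite /fib_class valKd.
Qed.

(* [s] is a decomposition of [x] into elementary tensors of homogeneous elements *)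
Definition sweedler (x : fib_alg) (s : seq (A * C)) : Prop :=
  (forall p, p \in s -> composable p) /\ x = \sum_(p <- s) fib_in p.1 p.2.

Lemma sweedler_ex x : exists s, sweedler x s.
Proof.
have [t /asboolP[s [hs ->]] ->] := fib_repr x; exists s; split=> //.
by rewrite fib_class_sum // => p /hs; case: p => a c; apply: composable_gtens.
Qed.

Lemma composable_s b : composable (smap A b, 1).
Proof. by exists 1%g, 1%g, 1%g; split; [apply: smap_deg|apply: deg1]. Qed.
Lemma composable_r b : composable (1, rmap C b).
Proof. by exists 1%g, 1%g, 1%g; split; [apply: deg1|apply: rmap_deg]. Qed.

Lemma fib_in_sr b : fib_in (smap A b) 1 = fib_in 1 (rmap C b).
Proof.
apply/quot_inP/ideal_gen; exists b; rewrite [LHS](raddfB val).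
congr (_ - _); apply/val_gtens/composable_gtens; first exact: composable_s.
exact: composable_r.
Qed.

Definition composable_at (g k : G) (p : A * C) : Prop :=
  exists h, deg g h p.1 /\ deg h k p.2.

Lemma composable_atW g k p : composable_at g k p -> composable p.
Proof. by move=> [h hh]; exists g, h, k. Qed.

(* the image of [sum_h A_(g, h) (x) C_(h, k)] *)
Definition fib_deg (g k : G) : set fib_alg := [set x | exists s : seq (A * C),
  (forall p, p \in s -> composable_at g k p) /\
  x = \sum_(p <- s) fib_in p.1 p.2].

Definition fib_rmap (b : X) : fib_alg := fib_in (rmap A b) 1.
Definition fib_smap (b : X) : fib_alg := fib_in 1 (smap C b).

Let tdeg (g k : G) : set (tens A C) := [set t | exists s : seq (A * C),
  (forall p, p \in s -> composable_at g k p) /\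
  t = \sum_(p <- s) tens_in p.1 p.2].

Lemma tdeg_gtens g k t : tdeg g k t -> t \in gtens_pred.
Proof.
by move=> [s [hs ->]]; apply/asboolP; exists s; split=> // p /hs/composable_atW.
Qed.

Lemma fib_degE g k x : fib_deg g k x -> exists2 t, tdeg g k t & x = fib_class t.
Proof.
move=> [s [hs ->]]; exists (\sum_(p <- s) tens_in p.1 p.2); first by exists s.
by rewrite fib_class_sum // => -[a c] /hs/composable_atW/composable_gtens.
Qed.

Fact tens_pr : exists pq : G -> G -> tens A C -> tens A C,
  (forall g k, {morph pq g k : x y / x + y}) /\
  (forall g k g' k' t, tdeg g' k' t ->
    pq g k t = if (g' == g) && (k' == k) then t else 0).
Proof.
have /choice[pa hpa] g := grading_proj (fun p => p.1 == g) (deg_grading A).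
have /choice[pc hpc] k := grading_proj (fun p => p.2 == k) (deg_grading C).
pose f g k (p : A * C) := tens_in (pa g p.1) (pc k p.2).
have linD (U : lmodType K) (q : U -> U) : linear q -> {morph q : x y / x + y}.
  by move=> ql x y; rewrite -[x in LHS]scale1r ql scale1r.
have linZ (U : lmodType K) (q : U -> U) : linear q -> forall z x, q (z *: x) = z *: q x.
  move=> ql z x; rewrite -[z *: x]addr0 ql.
  suff -> : q 0 = 0 by rewrite addr0.
  by apply: (addIr (q 0)); rewrite -linD // !add0r.
have ft g k : @sp_test K (tens_data A C) _ (f g k).
  have [la _] := hpa g; have [lc _] := hpc k.
  split=> [a b c|a c d|z a c]; rewrite /f /=.
  - by rewrite (linD _ _ la) tens_inDl.
  - by rewrite (linD _ _ lc) tens_inDr.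
  - by rewrite (linZ _ _ la) (linZ _ _ lc) tens_inZl tens_inZr.
exists (fun g k => @span_lift K (tens_data A C) (tens A C) (f g k)); split.
  by move=> g k; apply: span_liftD.
move=> g k g' k' t [s [hs ->]]; rewrite [LHS]span_lift_sum //.
transitivity (\sum_(p <- s) if (g' == g) && (k' == k) then tens_in p.1 p.2 else 0).
  apply: eq_big_seq => -[a c] /hs [h [/= ha hc]].
  rewrite [LHS]span_lift_in // /f /=.
  rewrite ((hpa g).2 (g', h)) // ((hpc k).2 (h, k')) //=.
  by case: (g' == g); case: (k' == k) => //=; rewrite ?tens_in0 ?tens_inr0.
by case: ifP => // _; rewrite big1.
Qed.

Lemma ideal_pr pq g k :
  (forall g k, {morph pq g k : x y / x + y}) ->
  (forall g k g' k' t, tdeg g' k' t ->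
    pq g k t = if (g' == g) && (k' == k) then t else 0) ->
  forall x, ideal fib_rel x -> exists2 y, ideal fib_rel y & gtens_val y = pq g k (gtens_val x).
Proof.
move=> pqD pqE.
pose R (x : gtens) := exists2 y, ideal fib_rel y & gtens_val y = pq g k (gtens_val x).
have R0 : R 0.
  exists 0; first exact: ideal0.
  have /(pqE g k) -> : tdeg 1%g 1%g 0 by exists [::]; rewrite big_nil.
  by rewrite if_same.
have RD x y : R x -> R y -> R (x + y).
  move=> [u hu uE] [v hv vE]; exists (u + v); first exact: idealD.
  by rewrite [LHS](raddfD val) [gtens_val (x + y)](raddfD val) pqD /= uE vE.
have Rsum (J : eqType) (s : seq J) (F : J -> gtens) :
    (forall j, j \in s -> R (F j)) -> R (\sum_(j <- s) F j).
  elim: s => [|j s IHs] hs; first by rewrite big_nil.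
  rewrite big_cons; apply: RD; first by apply: hs; rewrite mem_head.
  by apply: IHs => i si; apply: hs; rewrite inE si orbT.
pose E (p : A * C) : gtens := insubd (0 : gtens_sort) (tens_in p.1 p.2).
have EP p : composable p -> gtens_val (E p) = tens_in p.1 p.2.
  by case: p => a c /composable_gtens h; apply: (val_gtens h).
have span (u : gtens) : exists s : seq (A * C),
    (forall p, p \in s -> composable p) /\ u = \sum_(p <- s) E p.
  have /asboolP[s [hs uE]] := valP (u : gtens_sort).
  exists s; split=> //; apply: val_inj; rewrite [LHS]uE.
  rewrite [RHS](raddf_sum val); apply: eq_big_seq => p /hs hp.
  by rewrite [RHS]EP.
move=> _ [s [hs ->]]; apply: (@Rsum _ s (fun p => p.1.1 * p.1.2 * p.2)).
move=> [[u x] w] /hs /= hx; have [b xE] := hx.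
have [s1 [hs1 ->]] := span u; have [s2 [hs2 ->]] := span w.
rewrite mulr_suml mulr_suml; apply: (Rsum) => p /hs1 hp.
rewrite mulr_sumr; apply: (Rsum) => q /hs2 hq.
have vE : gtens_val (E p * x * E q) =
    tens_in (p.1 * smap A b * q.1) (p.2 * 1 * q.2) -
    tens_in (p.1 * 1 * q.1) (p.2 * rmap C b * q.2).
  have vM (a a' : gtens) : gtens_val (a * a') = gtens_val a * gtens_val a'.
    exact: (rmorphM val).
  by rewrite !vM !EP // xE mulrBr mulrBl !tens_inM.
have [g1 [h1 [k1 [dp1 dp2]]]] := hp; have [g2 [h2 [k2 [dq1 dq2]]]] := hq.
have /(pqE g k) pE : tdeg (g1 * g2)%g (k1 * k2)%g (gtens_val (E p * x * E q)).
  exists [:: (p.1 * smap A b * q.1, p.2 * 1 * q.2);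
             (- (p.1 * 1 * q.1), p.2 * rmap C b * q.2)]; split; last first.
    rewrite vE big_cons big_seq1 /=; congr (_ + _).
    by rewrite -[in RHS]scaleN1r tens_inZl scaleN1r.
  move=> r; rewrite !inE => /orP[] /eqP ->; exists (h1 * h2)%g => /=; split.
  - by have := degM (degM dp1 (smap_deg A b)) dq1; rewrite !mulg1.
  - by rewrite mulr1; apply: degM.
  - rewrite mulr1 -[- _]addr0 -scaleN1r; apply: degP; last exact: deg0.
    exact: degM.
  - by have := degM (degM dp2 (rmap_deg C b)) dq2; rewrite !mulg1.
rewrite /R pE; case: ifP => _; last by exists 0; [apply: ideal0|].
by exists (E p * x * E q) => //; apply/idealMr/idealMl/ideal_gen.
Qed.

Fact fib_grading : is_grading (fun p : G * G => fib_deg p.1 p.2).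
Proof.
have W0 (i : G * G) : fib_deg i.1 i.2 0 by exists [::]; rewrite big_nil.
have WD (i : G * G) z x y : fib_deg i.1 i.2 x -> fib_deg i.1 i.2 y ->
    fib_deg i.1 i.2 (z *: x + y).
  move=> [s [hs ->]] [t [ht ->]]; exists ([seq (z *: p.1, p.2) | p <- s] ++ t).
  split=> [p|].
    rewrite mem_cat => /orP[/mapP[q /hs [h [h1 h2]] ->]|/ht //].
    by exists h; split=> //=; rewrite -[_ *: _]addr0; apply: degP => //; apply: deg0.
  rewrite big_cat big_map scaler_sumr; congr (_ + _); apply: eq_big_seq => -[a c].
  by move=> /hs/composable_atW hp; rewrite /= fib_inZl.
split=> // [x|s f us hf s0 [g k] gs].
  have [s [hs ->]] := sweedler_ex x.
  have [|t [f [ut hf E]]] := @grading_span _ _ _ (fun p : G * G => fib_deg p.1 p.2)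
    [seq fib_in p.1 p.2 | p <- s] W0 WD; last first.
    by exists t, f; split; rewrite // -E big_map.
  move=> _ /mapP[p /hs [g [h [k [h1 h2]]]] ->]; exists (g, k), [:: p].
  by rewrite big_seq1; split=> // q; rewrite inE => /eqP ->; exists h.
have [pq [pqD pqE]] := tens_pr.
have /choice[F hF] i : exists t, tdeg i.1 i.2 t /\ f i = fib_class t.
  by have [t h1 h2] := fib_degE (hf i); exists t.
have hF1 i : tdeg i.1 i.2 (F i) by case: (hF i).
have hF2 i : f i = fib_class (F i) by case: (hF i).
pose T i : gtens := insubd (0 : gtens_sort) (F i).
have TE i : gtens_val (T i) = F i by apply/val_gtens/tdeg_gtens/hF1.
have /(ideal_pr g k pqD pqE) [y hy yE] : ideal fib_rel (\sum_(i <- s) T i).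
  rewrite -[X in ideal _ X]subr0; apply/quot_inP; rewrite [LHS]quot_in_sum.
  by rewrite -[RHS]s0; apply: eq_bigr => i _; rewrite hF2.
suff -> : f (g, k) = quot_in fib_rel y by apply/quot_inP; rewrite subr0.
rewrite hF2; congr quot_in; apply: val_inj; rewrite [LHS]TE [RHS]yE.
rewrite [gtens_val _](raddf_sum val) /=.
have pq0 : pq g k 0 = 0 by apply: (addIr (pq g k 0)); rewrite -pqD !add0r.
rewrite (big_morph _ (pqD g k) pq0) (bigD1_seq (g, k)) //= big1 => [|i ne].
  by rewrite addr0 TE (pqE _ _ _ _ _ (hF1 _)) /= !eqxx.
by rewrite TE (pqE _ _ _ _ _ (hF1 _)) -xpair_eqE -surjective_pairing (negPf ne).
Qed.

Fact fib_degM g h g' h' x y : fib_deg g h x -> fib_deg g' h' y ->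
  fib_deg (g * g')%g (h * h')%g (x * y).
Proof.
move=> [s [hs ->]] [t [ht ->]].
exists [seq (p.1 * q.1, p.2 * q.2) | p <- s, q <- t]; split.
  move=> p /allpairsP[[u v] [/hs [k [h1 h2]] /ht [k' [h1' h2']] ->]].
  by exists (k * k')%g; split; apply: degM.
rewrite big_allpairs_dep /= mulr_suml; apply: eq_big_seq => -[a c] /hs hp.
rewrite mulr_sumr; apply: eq_big_seq => -[b d] /ht hq /=.
by rewrite fib_inM //; apply: composable_atW; [apply: hp|apply: hq].
Qed.

Lemma composable_rl b : composable (rmap A b, 1).
Proof. by exists 1%g, 1%g, 1%g; split; [apply: rmap_deg|apply: deg1]. Qed.
Lemma composable_sr b : composable (1, smap C b).
Proof. by exists 1%g, 1%g, 1%g; split; [apply: deg1|apply: smap_deg]. Qed.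

Lemma composableZ z p : composable p -> composable (z *: p.1, p.2).
Proof.
move=> [g [h [k [h1 h2]]]]; exists g, h, k; split=> //=.
by rewrite -[_ *: _]addr0; apply: degP => //; apply: deg0.
Qed.
Lemma composableZr z p : composable p -> composable (p.1, z *: p.2).
Proof.
move=> [g [h [k [h1 h2]]]]; exists g, h, k; split=> //=.
by rewrite -[_ *: _]addr0; apply: degP => //; apply: deg0.
Qed.

Fact fib_rmap_hom : is_alg_hom fib_rmap.
Proof.
have hr := rmap_hom A; rewrite /fib_rmap; split=> [z b c|].
  rewrite (alg_homP hr) fib_inDl; last exact: composable_rl.
    by rewrite fib_inZl //; apply: composable_rl.
  exact: (composableZ z (composable_rl b)).
split=> [|b c]; first by rewrite (alg_hom1 hr) fib_in11.
by rewrite (alg_homM hr) fib_inM ?mulr1 //; apply: composable_rl.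
Qed.
Fact fib_smap_hom : is_alg_hom fib_smap.
Proof.
have hr := smap_hom C; rewrite /fib_smap; split=> [z b c|].
  rewrite (alg_homP hr) fib_inDr; last exact: composable_sr.
    by rewrite fib_inZr //; apply: composable_sr.
  exact: (composableZr z (composable_sr b)).
split=> [|b c]; first by rewrite (alg_hom1 hr) fib_in11.
by rewrite (alg_homM hr) fib_inM ?mulr1 //; apply: composable_sr.
Qed.
Fact fib_rmap_deg b : fib_deg 1%g 1%g (fib_rmap b).
Proof.
exists [:: (rmap A b, 1)]; rewrite big_seq1; split=> // p; rewrite inE => /eqP ->.
by exists 1%g; split; [apply: rmap_deg|apply: deg1].
Qed.
Fact fib_smap_deg b : fib_deg 1%g 1%g (fib_smap b).
Proof.
exists [:: (1, smap C b)]; rewrite big_seq1; split=> // p; rewrite inE => /eqP ->.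
by exists 1%g; split; [apply: deg1|apply: smap_deg].
Qed.
Fact fib_rsmapC b c : fib_rmap b * fib_smap c = fib_smap c * fib_rmap b.
Proof.
rewrite !fib_inM ?mulr1 ?mul1r //.
all: first [exact: composable_rl | exact: composable_sr].
Qed.
Fact fib_rmap_act g h a b : fib_deg g h a -> a * fib_rmap b = fib_rmap (act g b) * a.
Proof.
move=> [s [hs ->]]; rewrite mulr_suml mulr_sumr; apply: eq_big_seq => -[x y] /hs hp /=.
have [k [/= h1 h2]] := hp; rewrite !fib_inM ?mulr1 ?mul1r ?(rmap_act _ h1) //.
all: try exact: composable_rl.
all: exact: (composable_atW hp).
Qed.
Fact fib_smap_act g h a b : fib_deg g h a -> a * fib_smap b = fib_smap (act h b) * a.
Proof.
move=> [s [hs ->]]; rewrite mulr_suml mulr_sumr; apply: eq_big_seq => -[x y] /hs hp /=.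
have [k [/= h1 h2]] := hp; rewrite !fib_inM ?mulr1 ?mul1r ?(smap_act _ h2) //.
all: try exact: composable_sr.
all: exact: (composable_atW hp).
Qed.

Definition fib : bgAlg X := @BGAlg K X fib_alg fib_deg fib_rmap fib_smap
  fib_grading fib_degM fib_rmap_hom fib_smap_hom fib_rmap_deg fib_smap_deg
  fib_rsmapC fib_rmap_act fib_smap_act.

End Fiber.

Section Associator.
Variables (K : numClosedFieldType) (X : base K) (A C D : bgAlg X).

(* The graph of the associativity isomorphism, which identifies the class of
   [(a (x) c) (x) d] with that of [a (x) (c (x) d)]. *)
Definition fib_assoc (u : fib (fib A C) D) (w : fib A (fib C D)) : Prop :=
  exists t : seq (A * C * D),
  [/\ forall q, q \in t -> exists g h k l,
        [/\ deg g h q.1.1, deg h k q.1.2 & deg k l q.2],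
      u = \sum_(q <- t) (fib_in (fib_in q.1.1 q.1.2 : fib A C) q.2 : fib _ _)
    & w = \sum_(q <- t) (fib_in q.1.1 (fib_in q.1.2 q.2 : fib C D) : fib _ _)].

End Associator.

(* Below, a sum over [s] with [sweedler (Delta a) s] is a Sweedler sum over the
   components [a_(1)] and [a_(2)] of [Delta a]; decompositions [s] exist by
   [sweedler_ex], and the sums that occur do not depend on their choice when the
   maps involved are morphisms. *)

Section Hopf.
Variables (K : numClosedFieldType) (X : base K) (A : bgAlg X).

Record hopf_data := HopfData {
  h_star : A -> A;
  h_Delta : A -> fib A A;
  h_eps : A -> cross X;
  h_S : A -> coop A }.

Definition coassociative (Delta : A -> fib A A) : Prop :=
  forall a s, sweedler (Delta a) s ->
    fib_assoc (\sum_(p <- s) (fib_in (Delta p.1) p.2 : fib _ _))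
              (\sum_(p <- s) (fib_in p.1 (Delta p.2) : fib _ _)).

(* The identifications of [cross X] fibered with [A], on either side, with [A]
   send [x (x) a] to [rhat x * a] and [a (x) x] to [shat x * a]. *)
Definition counital (Delta : A -> fib A A) (eps : A -> cross X) : Prop :=
  forall a s, sweedler (Delta a) s ->
    \sum_(p <- s) rhat A (eps p.1) * p.2 = a /\
    \sum_(p <- s) shat A (eps p.2) * p.1 = a.

Definition antipodal (Delta : A -> fib A A) (eps : A -> cross X)
    (S : A -> coop A) : Prop :=
  forall a s, sweedler (Delta a) s ->
    \sum_(p <- s) (S p.1 : A) * p.2 = scheck A (eps a) /\
    \sum_(p <- s) p.1 * (S p.2 : A) = rhat A (eps a).

Definition is_hopf (H : hopf_data) : Prop :=
  [/\ is_bg_mor (h_Delta H), is_bg_mor (h_eps H), is_bg_mor (h_S H)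
    & [/\ coassociative (h_Delta H), counital (h_Delta H) (h_eps H)
        & antipodal (h_Delta H) (h_eps H) (h_S H)]].

Definition is_hopf_star (H : hopf_data) : Prop :=
  [/\ is_hopf H,
      is_bg_star (h_star H),
      forall a s, sweedler (h_Delta H a) s ->
        h_Delta H (h_star H a) =
          \sum_(p <- s) (fib_in (h_star H p.1) (h_star H p.2) : fib A A)
    & forall a, h_eps H (h_star H a) = cross_star (h_eps H a)].

End Hopf.

Definition mx_inverse (R : pzRingType) n (v w : 'M[R]_n) : Prop :=
  v *m w = 1%:M /\ w *m v = 1%:M.

Definition GLmx (R : pzRingType) n (v : 'M[R]_n) : Prop :=
  exists w, mx_inverse v w.

Section Universal.
Variables (K : numClosedFieldType) (X : base K) (n : nat).
Variable (g : 'I_n -> base_grp X).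

(* diag(g_1, ..., g_n) and its inverse *)
Definition nabla : 'M[cross X]_n := diag_mx (\row_i cross_in 1 (g i)).
Definition nablaV : 'M[cross X]_n := diag_mx (\row_i cross_in 1 (g i)^-1%g).

Definition in_cross (F : 'M[X]_n) : 'M[cross X]_n :=
  map_mx (@cross_base K X : X -> cross X) F.
(* the inverse of [in_cross] on its image *)
Definition to_base (M : 'M[cross X]_n) : 'M[X]_n := map_mx (@cross_to_base K X) M.

Definition nabla_odd (F : 'M[X]_n) : Prop :=
  exists M, nabla *m in_cross F *m nabla = in_cross M.

Definition conj_mx (A : Type) (star : A -> A) (M : 'M[A]_n) : 'M[A]_n :=
  map_mx star M.
Definition adj_mx (F : 'M[X]_n) : 'M[X]_n := (conj_mx (@base_star K X) F)^T.

Definition Qmx (G : 'M[X]_n) : 'M[X]_n :=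
  to_base (in_cross G *m
    (nabla *m in_cross (conj_mx (@base_star K X) G) *m nabla)).

(* [r_n] and [s_n] are applied to matrices over the crossed product which lie in
   the image of the matrices over [B], hence [to_base]. *)
Definition Ao_matrix (F G : 'M[X]_n) (A : bgAlg X) (v : 'M[A]_n) : Prop :=
  (forall i j, deg (g i) (g j) (v i j)) /\
  exists w : 'M[A]_n,
  [/\ mx_inverse v w,
      map_mx (rmap A) (to_base (nabla *m in_cross F *m nabla)) *m w^T =
        v *m map_mx (smap A) F
    & map_mx (rmap A) (to_base (nabla *m in_cross (Qmx G) *m nablaV)) *m v =
        v *m map_mx (smap A) (Qmx G)].

Definition is_Ao (F G : 'M[X]_n) (A : bgAlg X) (v : 'M[A]_n) : Prop :=
  Ao_matrix F G v /\
  forall (C : bgAlg X) (u : 'M[C]_n), Ao_matrix F G u ->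
    exists! f : A -> C, is_bg_mor f /\ map_mx f v = u.

Definition matrix_corep (A : bgAlg X) (H : hopf_data A) (v : 'M[A]_n) : Prop :=
  [/\ forall i j, h_Delta H (v i j) =
        \sum_k (fib_in (v i k) (v k j) : fib A A),
      forall i j, h_eps H (v i j) = if i == j then cross_in 1 (g i) else 0
    & exists2 w : 'M[A]_n, mx_inverse v w & forall i j, h_S H (v i j) = w i j].

End Universal.

(* Main.v *)
(* Both the existence of the universal algebra and its Hopf *-algebroid structure
   rest on matrix identities.  The algebra is generated by [r(b)], [s(b)] and the
   [v_ij] alone, as the first relation forces
   [(v^-1)^T = r(nabla F nabla)^-1 v s(F)].  By the universal property it then
   suffices to exhibit four matrices satisfying the defining relations: in the
   fiber product of [A] with itself the matrix with entries
   [sum_k v_ik (x) v_kj], over the crossed product [nabla], in the co-opposite of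
   [A] the matrix [v^-1], and in the conjugate opposite of [A] (whose morphisms
   from [A] are the candidate involutions) the matrix
   [r(nabla G nabla)^-1 v s(G)].  The recurring tool is that transposing a product
   [v s(P)] or [r(P) v] moves the coefficients to the other side at the price of
   twisting the entries of [P] by the degrees of [v].  The Hopf axioms are stable
   under sums and under products of homogeneous elements, so they need only be
   checked on the generators; uniqueness is again the universal property, as the
   composition of two candidate involutions is a morphism fixing [v]. *)

Require Import Defs.
From mathcomp Require Import all_boot all_order all_algebra.
From mathcomp Require Import all_classical.
From mathcomp Require Import reals complex.

Set Implicit Arguments.
Unset Strict Implicit.
Unset Printing Implicit Defensive.

Import Order.TTheory GRing.Theory Num.Theory.

Local Open Scope ring_scope.
Local Open Scope complex_scope.

(** Oddness makes [F i j] vanish unless [g i] and [g j] are inverse to each other, so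
    [nabla F nabla] is [F] with row [i] acted on by [g i]. Hence the crossed product leaves almost
    no trace in the matrix identities except [supp] and [twist]. The obstacle is noncommutativity:
    transposition does not reverse products over [A], so invertibility of [v] says nothing about
    [v^T], whereas opposite algebras call for inverses of transposes. The first relation supplies
    them. The second relation makes the involution square to the identity: the candidate applied
    twice to [v] gives [r(conj G)^-1 r(nabla G nabla)^-1 v s(Q)], which is [v] because [nabla Q
    nabla^-1 = (nabla G nabla) (conj G)]. The other difficulty is the fiber product: a tensor is
    meaningful only if the middle degrees match, and the maps in the counit and antipode axioms,
    such as [a (x) c |-> S(a) c], are not given by functoriality. They are built as additive maps,
    and their behaviour on products is found by tracking degrees. *)

Section AlgHomTheory.
Variables (K : pzRingType) (A C : alg K) (f : A -> C).
Hypothesis hf : is_alg_hom f.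

Lemma alg_hom_sum (I : Type) (r : seq I) (P : pred I) F :
  f (\sum_(i <- r | P i) F i) = \sum_(i <- r | P i) f (F i).
Proof. exact: (big_morph _ (alg_homD hf) (alg_hom0 hf)). Qed.

Lemma map_mx_homM m n p (M : 'M[A]_(m, n)) (N : 'M[A]_(n, p)) :
  map_mx f (M *m N) = map_mx f M *m map_mx f N.
Proof.
apply/matrixP => i j; rewrite !mxE alg_hom_sum; apply: eq_bigr => k _.
by rewrite !mxE (alg_homM hf).
Qed.

Lemma map_mx_hom1 n : map_mx f 1%:M = 1%:M :> 'M_n.
Proof.
apply/matrixP => i j; rewrite !mxE; case: eqP => _; first exact: alg_hom1.
exact: alg_hom0.
Qed.

Lemma mx_inverse_hom n (M N : 'M[A]_n) :
  mx_inverse M N -> mx_inverse (map_mx f M) (map_mx f N).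
Proof. by move=> [MN NM]; split; rewrite -map_mx_homM ?MN ?NM map_mx_hom1. Qed.

End AlgHomTheory.

Lemma alg_hom_comp (K : pzRingType) (A C D : alg K) (f : A -> C) (h : C -> D) :
  is_alg_hom f -> is_alg_hom h -> is_alg_hom (h \o f).
Proof.
move=> hf hh; split=> [z x y|] /=; first by rewrite (alg_homP hf) (alg_homP hh).
split=> [|x y] /=; first by rewrite (alg_hom1 hf) (alg_hom1 hh).
by rewrite (alg_homM hf) (alg_homM hh).
Qed.

Lemma mulmx_op (K : pzRingType) (A : alg K) m n p
    (M : 'M[op_alg A]_(m, n)) (N : 'M[op_alg A]_(n, p)) :
  M *m N = ((N^T : 'M[A]_(p, n)) *m (M^T : 'M[A]_(n, m)))^T.
Proof. by apply/matrixP => i j; rewrite !mxE; apply: eq_bigr => k _; rewrite !mxE. Qed.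

Lemma mx_inverse_uniq (R : pzRingType) n (v w w' : 'M[R]_n) :
  mx_inverse v w -> mx_inverse v w' -> w = w'.
Proof. by move=> [_ wv] [vw' _]; rewrite -[w]mulmx1 -vw' mulmxA wv mul1mx. Qed.

(** * Twisted matrices over the base *)

Section Twist.
Variables (K : numClosedFieldType) (X : base K) (n : nat).
Implicit Types (a b c : 'I_n -> base_grp X) (P Q : 'M[X]_n).
Local Notation inv a := (fun i => (a i)^-1%g).
Local Notation conjB := (@conj_mx n X (@base_star K X)).

(** What remains of [nabla P nabla] for odd [P], and of [nabla P nabla^-1] if [supp g g P]: the
    group elements cancel and only the action of the row degree survives. *)
Definition twist a P : 'M[X]_n := \matrix_(i, j) act (a i) (P i j).

(* The paper's odd matrices for [nabla = diag(g_1, ..., g_n)] are the matrices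
   [P] with [supp g (fun i => (g i)^-1) P]. *)
Definition supp a b P : Prop := forall i j, P i j = 0 \/ a i = b j.

Lemma act0 (h : base_grp X) : act h (0 : X) = 0.
Proof. exact: alg_hom0 (act_hom h). Qed.

Lemma supp_inv a b P : supp a b P -> supp (inv a) (inv b) P.
Proof. by move=> h i j; case: (h i j) => [->|->]; [left|right]. Qed.

Lemma supp_invl a b P : supp (inv a) b P -> supp a (inv b) P.
Proof. by move=> h i j; case: (h i j) => [->|<-]; [left|right; rewrite invgK]. Qed.

Lemma supp_invr a b P : supp a (inv b) P -> supp (inv a) b P.
Proof. by move=> h i j; case: (h i j) => [->|->]; [left|right; rewrite invgK]. Qed.

Lemma supp_tr a b P : supp a b P -> supp b a P^T.
Proof. by move=> h i j; rewrite mxE; case: (h j i) => [->|->]; [left|right]. Qed.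

Lemma supp_twist a b c P : supp a b P -> supp a b (twist c P).
Proof.
by move=> h i j; rewrite mxE; case: (h i j) => [->|->]; [left; rewrite act0|right].
Qed.

Lemma base_star0 : base_star (0 : X) = 0.
Proof.
have [sD _ _ _] := base_starP X.
by apply: (addIr (base_star 0)); rewrite -sD !add0r.
Qed.

Lemma base_star_sum (I : Type) (r : seq I) (P : pred I) (F : I -> X) :
  base_star (\sum_(i <- r | P i) F i) = \sum_(i <- r | P i) base_star (F i).
Proof. have [sD _ _ _] := base_starP X; exact: (big_morph _ sD base_star0). Qed.

Lemma base_starM (x y : X) : base_star (x * y) = base_star x * base_star y.
Proof. by have [_ _ sM _] := base_starP X; rewrite sM base_comm. Qed.

Lemma supp_conj a b P : supp a b P -> supp a b (conjB P).
Proof.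
move=> h i j; rewrite mxE; case: (h i j) => [->|->]; last by right.
by left; rewrite base_star0.
Qed.

Lemma supp_mul a b c P Q : supp a b P -> supp b c Q -> supp a c (P *m Q).
Proof.
move=> hP hQ i j; have [->|ne] := pselect (a i = c j); first by right.
left; rewrite mxE big1 // => k _.
case: (hP i k) => [->|e1]; first by rewrite mul0r.
by case: (hQ k j) => [->|e2]; [rewrite mulr0|case: ne; rewrite e1 e2].
Qed.

(** Acting by [a i] on [P i k * Q k j] acts on [Q k j] by [a i], which is [b k] whenever [P i k] is
    nonzero. *)
Lemma twist_mul a b P Q : supp a b P -> twist a (P *m Q) = twist a P *m twist b Q.
Proof.
move=> h; apply/matrixP => i j; rewrite !mxE (alg_hom_sum (act_hom _)).
apply: eq_bigr => k _; rewrite !mxE (alg_homM (act_hom _)).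
by case: (h i k) => [->|->] //; rewrite act0 !mul0r.
Qed.

Lemma twist1 a : twist a 1%:M = 1%:M.
Proof.
apply/matrixP => i j; rewrite !mxE; case: eqP => _; last exact: act0.
exact: alg_hom1 (act_hom _).
Qed.

Lemma twist_tr a b P : supp a b P -> (twist a P)^T = twist b P^T.
Proof.
by move=> h; apply/matrixP => i j; rewrite !mxE; case: (h j i) => ->; rewrite ?act0.
Qed.

Lemma twistK a : cancel (twist a) (twist (inv a)).
Proof. by move=> P; apply/matrixP => i j; rewrite !mxE -actM mulVg act1. Qed.

Lemma twistVK a : cancel (twist (inv a)) (twist a).
Proof. by move=> P; apply/matrixP => i j; rewrite !mxE -actM mulgV act1. Qed.

Lemma twist_invK a P : twist (inv (inv a)) P = twist a P.
Proof. by apply/matrixP => i j; rewrite !mxE invgK. Qed.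

Lemma twist_conj a P : twist a (conjB P) = conjB (twist a P).
Proof. by apply/matrixP => i j; rewrite !mxE act_star. Qed.

Lemma base_star1 : base_star (1 : X) = 1.
Proof.
have [_ _ _ sK] := base_starP X.
by rewrite -[LHS]mul1r -{1}(sK 1) -base_starM mulr1 sK.
Qed.

Lemma conjB1 : conjB 1%:M = 1%:M.
Proof.
by apply/matrixP => i j; rewrite !mxE; case: eqP; rewrite ?base_star0 ?base_star1.
Qed.

Lemma conjBM P Q : conjB (P *m Q) = conjB P *m conjB Q.
Proof.
apply/matrixP => i j; rewrite !mxE base_star_sum; apply: eq_bigr => k _.
by rewrite !mxE base_starM.
Qed.

Lemma conjBK : involutive conjB.
Proof.
by have [_ _ _ sK] := base_starP X; move=> P; apply/matrixP => i j; rewrite !mxE sK.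
Qed.

Lemma trmx_mulB P Q : (P *m Q)^T = Q^T *m P^T.
Proof.
apply/matrixP => i j; rewrite !mxE; apply: eq_bigr => k _.
by rewrite !mxE base_comm.
Qed.

Lemma mx_inverse_tr P Q : mx_inverse P Q -> mx_inverse P^T Q^T.
Proof. by move=> [PQ QP]; split; rewrite -trmx_mulB ?PQ ?QP trmx1. Qed.

(** Deleting from [Q] the entries of incompatible degrees leaves a right inverse of [P], since [P]
    connects only equal degrees; a two-sided inverse must coincide with it. *)
Lemma supp_mx_inverse a b P Q : supp a b P -> mx_inverse P Q -> supp b a Q.
Proof.
move=> hP [PQ QP].
pose Q' : 'M[X]_n := \matrix_(i, j) (if b i == a j then Q i j else 0).
have PQ' : P *m Q' = 1%:M.
  apply/matrixP => i j; rewrite -PQ !mxE.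
  have [eij|neij] := eqVneq (a i) (a j).
    apply: eq_bigr => k _; rewrite mxE; case: (hP i k) => [->|e]; first by rewrite !mul0r.
    by rewrite -e eij eqxx.
  have -> : \sum_k P i k * Q k j = 0.
    have := congr1 (fun M : 'M[X]_n => M i j) PQ; rewrite !mxE => ->.
    by case: (i =P j) neij => [->|]; rewrite ?eqxx.
  rewrite big1 // => k _; rewrite mxE; case: (hP i k) => [->|e]; first by rewrite !mul0r.
  by rewrite -e (negPf neij) mulr0.
have -> : Q = Q' by rewrite -[LHS]mulmx1 -PQ' mulmxA QP mul1mx.
by move=> i j; rewrite mxE; case: eqP => e; [right|left].
Qed.

Lemma mx_inverse_twist a b P Q :
  supp a b P -> mx_inverse P Q -> mx_inverse (twist a P) (twist b Q).
Proof.
move=> hP h; have hQ := supp_mx_inverse hP h; case: h => PQ QP.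
by split; rewrite -twist_mul // ?PQ ?QP twist1.
Qed.

End Twist.

(** * Conjugation by [nabla] in the crossed product *)

Section CrossedMatrices.
Variables (K : numClosedFieldType) (X : base K) (n : nat) (g : 'I_n -> base_grp X).
Implicit Types P Q : 'M[X]_n.
Local Notation ginv := (fun i => (g i)^-1%g).
Local Notation conjB := (@conj_mx n X (@base_star K X)).

Lemma nablaE i j : nabla g i j = if i == j then cross_in 1 (g i) else 0.
Proof. by rewrite !mxE; case: eqP => _; rewrite ?mulr1n ?mulr0n. Qed.

Lemma nablaVE i j : nablaV g i j = if i == j then cross_in 1 (g i)^-1%g else 0.
Proof. by rewrite !mxE; case: eqP => _; rewrite ?mulr1n ?mulr0n. Qed.

Lemma nablaK : mx_inverse (nabla g) (nablaV g).
Proof.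
split; apply/matrixP => i j; rewrite !mxE (bigD1 i) //= big1 => [|k /negPf ne].
- rewrite addr0 nablaE nablaVE eqxx; case: eqP => _; last by rewrite mulr0.
  by rewrite [LHS]cross_inM (alg_hom1 (act_hom _)) mulr1 mulgV.
- by rewrite nablaE eq_sym ne mul0r.
- rewrite addr0 nablaE nablaVE eqxx; case: eqP => _; last by rewrite mulr0.
  by rewrite [LHS]cross_inM (alg_hom1 (act_hom _)) mulr1 mulVg.
- by rewrite nablaVE eq_sym ne mul0r.
Qed.

Lemma mul_nabla (M : 'M[cross X]_n) i j :
  (nabla g *m M) i j = (cross_in 1 (g i) : cross X) * M i j.
Proof.
rewrite mxE (bigD1 i) //= big1 ?addr0 => [|k /negPf ne]; first by rewrite nablaE eqxx.
by rewrite nablaE eq_sym ne mul0r.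
Qed.

Lemma mul_mx_nabla (M : 'M[cross X]_n) i j :
  (M *m nabla g) i j = M i j * (cross_in 1 (g j) : cross X).
Proof.
rewrite mxE (bigD1 j) //= big1 ?addr0 => [|k /negPf ne]; first by rewrite nablaE eqxx.
by rewrite nablaE ne mulr0.
Qed.

Lemma mul_mx_nablaV (M : 'M[cross X]_n) i j :
  (M *m nablaV g) i j = M i j * (cross_in 1 (g j)^-1%g : cross X).
Proof.
rewrite mxE (bigD1 j) //= big1 ?addr0 => [|k /negPf ne]; first by rewrite nablaVE eqxx.
by rewrite nablaVE ne mulr0.
Qed.

Lemma in_crossM P Q : in_cross (P *m Q) = in_cross P *m in_cross Q.
Proof. exact: (map_mx_homM (cross_base_hom X)). Qed.

Lemma in_crossK P : to_base (in_cross P) = P.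
Proof. by apply/matrixP => i j; rewrite !mxE cross_baseK. Qed.

Lemma nabla_in_cross P i j :
  (nabla g *m in_cross P *m nabla g) i j = cross_in (act (g i) (P i j)) (g i * g j)%g.
Proof.
rewrite mul_mx_nabla mul_nabla mxE [X in X * _]cross_inM mul1r mulg1 [LHS]cross_inM.
by rewrite (alg_hom1 (act_hom _)) mulr1.
Qed.

(** The entry [(i, j)] of [nabla P nabla] is concentrated at the group element [g i * g j], whereas
    matrices over the base are concentrated at the unit; compare coefficients. *)
Lemma nabla_odd_supp P : nabla_odd g P -> supp g ginv P.
Proof.
move=> [M ME] i j; have [->|ne] := eqVneq (g i) (g j)^-1%g; first by right.
left; have := congr1 (fun N : 'M[cross X]_n => cross_coef (g i * g j)%g (N i j)) ME.
rewrite /= nabla_in_cross mxE !cross_coef_in eqxx; case: eqP => [e|_ e0].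
  by move: ne; rewrite -[(_^-1)%g]mul1g e mulgK eqxx.
by rewrite -[P i j]act1 -(mulVg (g i)) actM e0 act0.
Qed.

Lemma nabla_supp P : supp g ginv P ->
  nabla g *m in_cross P *m nabla g = in_cross (twist g P).
Proof.
move=> h; apply/matrixP => i j; rewrite nabla_in_cross !mxE.
case: (h i j) => ->; last by rewrite mulVg.
by rewrite act0 [LHS]cross_in0 [RHS]cross_in0.
Qed.

Lemma nablaV_supp P : supp g g P ->
  nabla g *m in_cross P *m nablaV g = in_cross (twist g P).
Proof.
move=> h; apply/matrixP => i j; rewrite mul_mx_nablaV mul_nabla !mxE.
rewrite [X in X * _]cross_inM mul1r mulg1 [LHS]cross_inM.
rewrite (alg_hom1 (act_hom _)) mulr1; case: (h i j) => ->; last by rewrite mulgV.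
by rewrite act0 [LHS]cross_in0 [RHS]cross_in0.
Qed.

Lemma QmxE P : supp g ginv P -> Qmx g P = P *m conjB (twist g P).
Proof.
move=> h; rewrite /Qmx nabla_supp; last exact: supp_conj.
by rewrite twist_conj -in_crossM in_crossK.
Qed.

End CrossedMatrices.

(** * Matrices of homogeneous elements and the fiber product *)

Section Degrees.
Variables (K : numClosedFieldType) (X : base K) (A : bgAlg X) (n : nat).
Implicit Types (a b c : 'I_n -> base_grp X) (P : 'M[X]_n) (M : 'M[A]_n).
Local Notation rM := (map_mx (rmap A)).
Local Notation sM := (map_mx (smap A)).

Lemma degZ (g h : base_grp X) z (x : A) : deg g h x -> deg g h (z *: x).
Proof. by move=> hx; rewrite -[_ *: _]addr0; apply: degP => //; apply: deg0. Qed.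

Lemma degD (g h : base_grp X) (x y : A) : deg g h x -> deg g h y -> deg g h (x + y).
Proof. by move=> hx hy; rewrite -[x]scale1r; apply: degP. Qed.

Lemma deg_sum (g h : base_grp X) (I : Type) (r : seq I) (P : pred I) (F : I -> A) :
  (forall i, P i -> deg g h (F i)) -> deg g h (\sum_(i <- r | P i) F i).
Proof. by move=> hF; elim/big_ind: _ => //; [apply: deg0|apply: degD]. Qed.

Definition bideg a b M : Prop := forall i j, deg (a i) (b j) (M i j).

Lemma trmx_mul_smap a b M P :
  bideg a b M -> (M *m sM P)^T = sM (twist b P)^T *m M^T.
Proof.
move=> hM; apply/matrixP => i j; rewrite !mxE; apply: eq_bigr => k _.
by rewrite !mxE (smap_act _ (hM _ _)).
Qed.

Lemma trmx_mul_rmap a b M P :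
  bideg a b M -> M^T *m rM P = (rM (twist a P)^T *m M)^T.
Proof.
move=> hM; apply/matrixP => i j; rewrite !mxE; apply: eq_bigr => k _.
by rewrite !mxE (rmap_act _ (hM _ _)).
Qed.

Lemma bideg_rmap a' a b P M : supp a' a P -> bideg a b M -> bideg a' b (rM P *m M).
Proof.
move=> hP hM i j; rewrite mxE; apply: deg_sum => k _; rewrite mxE.
case: (hP i k) => e; first by rewrite e (alg_hom0 (rmap_hom A)) mul0r; apply: deg0.
by have := degM (rmap_deg A (P i k)) (hM k j); rewrite !mul1g e.
Qed.

Lemma bideg_smap a b b' P M : supp b b' P -> bideg a b M -> bideg a b' (M *m sM P).
Proof.
move=> hP hM i j; rewrite mxE; apply: deg_sum => k _; rewrite mxE.
case: (hP k j) => e; first by rewrite e (alg_hom0 (smap_hom A)) mulr0; apply: deg0.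
by have := degM (hM i k) (smap_deg A (P k j)); rewrite !mulg1 e.
Qed.

End Degrees.

Section FiberMatrices.
Variables (K : numClosedFieldType) (X : base K) (A C : bgAlg X) (n : nat).
Implicit Types (a b c : 'I_n -> base_grp X) (P : 'M[X]_n).
Implicit Types (M : 'M[A]_n) (N : 'M[C]_n).

Lemma composable_deg g h k (x : A) (y : C) : deg g h x -> deg h k y -> composable (x, y).
Proof. by exists g, h, k. Qed.

Lemma fib_in0l (y : C) : fib_in (0 : A) y = 0.
Proof. by rewrite /fib_in tens_in0 fib_class0. Qed.

Lemma fib_in0r (x : A) : fib_in x (0 : C) = 0.
Proof. by rewrite /fib_in tens_inr0 fib_class0. Qed.

(** [fib_in] is additive only on composable pairs, its other values being junk; so the induction
    carries along the degree of the partial sum. *)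
Lemma fib_in_suml g h k (I : Type) (r : seq I) (P : pred I) (F : I -> A) (y : C) :
  (forall i, P i -> deg g h (F i)) -> deg h k y ->
  fib_in (\sum_(i <- r | P i) F i) y = \sum_(i <- r | P i) fib_in (F i) y.
Proof.
move=> hF hy; suff [] : deg g h (\sum_(i <- r | P i) F i) /\
  fib_in (\sum_(i <- r | P i) F i) y = \sum_(i <- r | P i) fib_in (F i) y by [].
elim/big_rec2: _ => [|i u v hi [hv e]]; first
  by rewrite fib_in0l; split=> //; apply: deg0.
split; first by apply: degD => //; apply: hF.
rewrite fib_inDl ?e //; first exact: composable_deg (hF _ hi) hy.
exact: composable_deg hv hy.
Qed.

Lemma fib_in_sumr g h k (I : Type) (r : seq I) (P : pred I) (x : A) (F : I -> C) :
  deg g h x -> (forall i, P i -> deg h k (F i)) ->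
  fib_in x (\sum_(i <- r | P i) F i) = \sum_(i <- r | P i) fib_in x (F i).
Proof.
move=> hx hF; suff [] : deg h k (\sum_(i <- r | P i) F i) /\
  fib_in x (\sum_(i <- r | P i) F i) = \sum_(i <- r | P i) fib_in x (F i) by [].
elim/big_rec2: _ => [|i u v hi [hv e]]; first
  by rewrite fib_in0r; split=> //; apply: deg0.
split; first by apply: degD => //; apply: hF.
rewrite fib_inDr ?e //; first exact: composable_deg hx (hF _ hi).
exact: composable_deg hx hv.
Qed.

Lemma fib_deg_in g h k (x : A) (y : C) : deg g h x -> deg h k y ->
  deg g k (fib_in x y : fib A C).
Proof.
move=> hx hy; exists [:: (x, y)]; rewrite big_seq1; split=> // p.
by rewrite inE => /eqP ->; exists h.
Qed.

Lemma fib_in_balance (b : X) (p : A * C) : composable p ->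
  fib_in (smap A b * p.1) p.2 = fib_in p.1 (rmap C b * p.2).
Proof.
case: p => x y /= hp.
rewrite -[y in LHS]mul1r -fib_inM //; last exact: composable_s.
by rewrite fib_in_sr fib_inM ?mul1r //; apply: composable_r.
Qed.

(** A matrix product with the tensor sign in place of multiplication; [fibmx v v] is the coproduct
    of [v]. *)
Definition fibmx M N : 'M[fib A C]_n := \matrix_(i, j) \sum_k fib_in (M i k) (N k j).

Lemma bideg_fibmx a b c M N : bideg a b M -> bideg b c N -> bideg a c (fibmx M N).
Proof.
move=> hM hN i j; rewrite mxE; apply: deg_sum => k _.
exact: fib_deg_in (hM i k) (hN k j).
Qed.

Lemma fibmx_rmap a' a b c P M N : supp a' a P -> bideg a b M -> bideg b c N ->
  map_mx (rmap (fib A C)) P *m fibmx M N = fibmx (map_mx (rmap A) P *m M) N.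
Proof.
move=> hP hM hN; apply/matrixP => i j; rewrite !mxE.
transitivity (\sum_k \sum_l (fib_in (rmap A (P i l) * M l k) (N k j) : fib A C)).
  rewrite exchange_big; apply: eq_bigr => l _; rewrite !mxE mulr_sumr.
  apply: eq_bigr => k _; rewrite [LHS]fib_inM ?mul1r //; first exact: composable_rl.
  exact: composable_deg (hM _ _) (hN _ _).
apply: eq_bigr => k _; rewrite mxE -(@fib_in_suml (a' i) (b k) (c j)) //.
  by congr fib_in; apply: eq_bigr => l _; rewrite mxE.
move=> l _; case: (hP i l) => e.
  by rewrite e (alg_hom0 (rmap_hom A)) mul0r; apply: deg0.
by have := degM (rmap_deg A (P i l)) (hM l k); rewrite !mul1g e.
Qed.

Lemma fibmx_smap a b c c' P M N : supp c c' P -> bideg a b M -> bideg b c N ->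
  fibmx M N *m map_mx (smap (fib A C)) P = fibmx M (N *m map_mx (smap C) P).
Proof.
move=> hP hM hN; apply/matrixP => i j; rewrite !mxE.
transitivity (\sum_k \sum_l (fib_in (M i k) (N k l * smap C (P l j)) : fib A C)).
  rewrite exchange_big; apply: eq_bigr => l _; rewrite !mxE mulr_suml.
  apply: eq_bigr => k _; rewrite [LHS]fib_inM ?mulr1 //; last exact: composable_sr.
  exact: composable_deg (hM _ _) (hN _ _).
apply: eq_bigr => k _; rewrite mxE -(@fib_in_sumr (a i) (b k) (c' j)) //.
  by congr fib_in; apply: eq_bigr => l _; rewrite mxE.
move=> l _; case: (hP l j) => e.
  by rewrite e (alg_hom0 (smap_hom C)) mulr0; apply: deg0.
by have := degM (hN k l) (smap_deg C (P l j)); rewrite !mulg1 e.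
Qed.

(** To reach the tensor sign, [s(P)] has to pass from the right of the entries of [M] to their left,
    which twists it by their column degrees [b]; it then reappears as [r] in the second factor. *)
Lemma fibmx_balance a b b' c P M N : supp b b' P -> bideg a b M -> bideg b' c N ->
  fibmx (M *m map_mx (smap A) P) N = fibmx M (map_mx (rmap C) (twist b P) *m N).
Proof.
move=> hP hM hN; apply/matrixP => i j; rewrite !mxE.
transitivity (\sum_k \sum_l
    (fib_in (M i l) (rmap C (act (b l) (P l k)) * N k j) : fib A C)).
  apply: eq_bigr => k _; rewrite mxE (@fib_in_suml (a i) (b' k) (c j)) //.
    apply: eq_bigr => l _; rewrite mxE (smap_act _ (hM i l)).
    case: (hP l k) => e.
      rewrite e act0 (alg_hom0 (smap_hom A)) (alg_hom0 (rmap_hom C)) !mul0r.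
      by rewrite fib_in0l fib_in0r.
    apply: (@fib_in_balance _ (_, _)); apply: composable_deg (hM _ _) _.
    by rewrite e; apply: hN.
  move=> l _; rewrite mxE; case: (hP l k) => e.
    by rewrite e (alg_hom0 (smap_hom A)) mulr0; apply: deg0.
  by have := degM (hM i l) (smap_deg A (P l k)); rewrite !mulg1 e.
rewrite exchange_big; apply: eq_bigr => l _; rewrite mxE.
rewrite (@fib_in_sumr (a i) (b l) (c j)) //.
  by apply: eq_bigr => k _; rewrite !mxE.
move=> k _; rewrite !mxE; case: (hP l k) => e.
  by rewrite e act0 (alg_hom0 (rmap_hom C)) mul0r; apply: deg0.
by have := degM (rmap_deg C (act (b l) (P l k))) (hN k j); rewrite !mul1g -e.
Qed.

(** Products of tensors multiply both legs in the same order, so the inverse is built from the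
    transposes [M'] and [N'] of the inverses. One leg contracts to a Kronecker symbol, after which
    the other one does. *)
Lemma fibmx_inverse a b c M M' N N' :
  bideg a b M -> bideg b c N ->
  bideg (fun i => (a i)^-1%g) (fun i => (b i)^-1%g) M' ->
  bideg (fun i => (b i)^-1%g) (fun i => (c i)^-1%g) N' ->
  mx_inverse M M'^T -> mx_inverse N N'^T ->
  mx_inverse (fibmx M N) (fibmx M' N')^T.
Proof.
move=> hM hN hM' hN' [MM' M'M] [NN' N'N]; split; apply/matrixP => i j; rewrite !mxE.
- transitivity (\sum_k \sum_l \sum_m
      (fib_in (M i l * M' j m) (N l k * N' m k) : fib A C)).
    apply: eq_bigr => k _; rewrite !mxE mulr_suml; apply: eq_bigr => l _.
    rewrite mulr_sumr; apply: eq_bigr => m _; apply: fib_inM.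
      exact: composable_deg (hM _ _) (hN _ _).
    exact: composable_deg (hM' _ _) (hN' _ _).
  rewrite exchange_big.
  transitivity (\sum_l (fib_in (M i l * M' j l) 1 : fib A C)).
    apply: eq_bigr => l _; rewrite exchange_big (bigD1 l) //= [X in _ + X]big1 ?addr0.
      rewrite -(@fib_in_sumr (a i * (a j)^-1) (b l * (b l)^-1) 1)%g.
      - congr fib_in; have := congr1 (fun R : 'M[C]_n => R l l) NN'.
        by rewrite !mxE eqxx mulr1n => <-; apply: eq_bigr => k _; rewrite !mxE.
      - exact: degM (hM _ _) (hM' _ _).
      - by move=> k _; rewrite -[X in deg _ X](mulgV (c k)); apply: degM (hN _ _) (hN' _ _).
    move=> m ne; rewrite -(@fib_in_sumr (a i * (a j)^-1) (b l * (b m)^-1) 1)%g.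
    - rewrite [X in fib_in _ X](_ : _ = 0) ?fib_in0r //.
      have := congr1 (fun R : 'M[C]_n => R l m) NN'.
      rewrite !mxE eq_sym (negPf ne) => e; rewrite -[RHS]e.
      by apply: eq_bigr => k _; rewrite !mxE.
    - exact: degM (hM _ _) (hM' _ _).
    - by move=> k _; rewrite -[X in deg _ X](mulgV (c k)); apply: degM (hN _ _) (hN' _ _).
  rewrite -(@fib_in_suml (a i * (a j)^-1) 1 1)%g.
  - have := congr1 (fun R : 'M[A]_n => R i j) MM'; rewrite !mxE => e.
    rewrite (eq_bigr (fun k => M i k * M'^T k j)); last by move=> k _; rewrite mxE.
    by rewrite e; case: eqP => _; rewrite ?fib_in0l //; apply: fib_in11.
  - by move=> k _; rewrite -[X in deg _ X](mulgV (b k)); apply: degM (hM _ _) (hM' _ _).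
  - exact: deg1.
- transitivity (\sum_k \sum_l \sum_m
      (fib_in (M' k l * M k m) (N' l i * N m j) : fib A C)).
    apply: eq_bigr => k _; rewrite !mxE mulr_suml; apply: eq_bigr => l _.
    rewrite mulr_sumr; apply: eq_bigr => m _; apply: fib_inM.
      exact: composable_deg (hM' _ _) (hN' _ _).
    exact: composable_deg (hM _ _) (hN _ _).
  rewrite exchange_big.
  transitivity (\sum_l (fib_in 1 (N' l i * N l j) : fib A C)).
    (* For the product in the other order, the index [k] sits in the first leg, which contracts by
       [M'^T *m M]. *)
    apply: eq_bigr => l _; rewrite exchange_big (bigD1 l) //= [X in _ + X]big1 ?addr0.
      rewrite -(@fib_in_suml 1 ((b l)^-1 * b l) ((c i)^-1 * c j))%g.
      - congr fib_in; have := congr1 (fun R : 'M[A]_n => R l l) M'M.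
        by rewrite !mxE eqxx mulr1n => <-; apply: eq_bigr => k _; rewrite !mxE.
      - by move=> k _; rewrite -[X in deg X](mulVg (a k)); apply: degM (hM' _ _) (hM _ _).
      - exact: degM (hN' _ _) (hN _ _).
    move=> m ne; rewrite -(@fib_in_suml 1 ((b l)^-1 * b m) ((c i)^-1 * c j))%g.
    - rewrite [X in fib_in X _](_ : _ = 0) ?fib_in0l //.
      have := congr1 (fun R : 'M[A]_n => R l m) M'M.
      rewrite !mxE eq_sym (negPf ne) => e; rewrite -[RHS]e.
      by apply: eq_bigr => k _; rewrite !mxE.
    - by move=> k _; rewrite -[X in deg X](mulVg (a k)); apply: degM (hM' _ _) (hM _ _).
    - exact: degM (hN' _ _) (hN _ _).
  rewrite -(@fib_in_sumr 1 1 ((c i)^-1 * c j))%g.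
  - have := congr1 (fun R : 'M[C]_n => R i j) N'N; rewrite !mxE => e.
    rewrite (eq_bigr (fun k => N'^T i k * N k j)); last by move=> k _; rewrite mxE.
    by rewrite e; case: eqP => _; rewrite ?fib_in0r //; apply: fib_in11.
  - exact: deg1.
  - by move=> k _; rewrite -[X in deg X](mulVg (b k)); apply: degM (hN' _ _) (hN _ _).
Qed.

End FiberMatrices.

(** * Additive maps out of the fiber product *)

Section FiberLift.
Variables (K : numClosedFieldType) (X : base K) (A C : bgAlg X).

(* [q] need only be defined on [S]: this covers [q := @fib_class _ _ A' C'],
   which is additive only on the subspace of composable tensors. *)
Lemma fib_lift (U V : zmodType) (f : A * C -> U) (S : {pred U}) (q : U -> V) :
  @tens_test K A C U f -> zmod_closed S ->
  {in S &, forall x y, q (x + y) = q x + q y} ->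
  (forall p, composable p -> f p \in S) ->
  (forall b p, composable p ->
    q (f (smap A b * p.1, p.2)) = q (f (p.1, rmap C b * p.2))) ->
  exists F : fib A C -> V, {morph F : x y / x + y} /\
    forall p, composable p -> F (fib_in p.1 p.2) = q (f p).
Proof.
move=> hf [S0 SB] qD fS fbal.
have SN x : x \in S -> - x \in S by move=> hx; rewrite -sub0r; apply: SB.
have SD x y : x \in S -> y \in S -> x + y \in S.
  by move=> hx hy; rewrite -[y]opprK; apply/SB/SN.
have q0 : q 0 = 0 by apply: (addIr (q 0)); rewrite -qD // !add0r.
have qB x y : x \in S -> y \in S -> q (x - y) = q x - q y.
  move=> hx hy; apply: (addIr (q y)); rewrite subrK -qD ?subrK //; exact: SB.
pose L : tens A C -> U := @span_lift K (tens_data A C) U f.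
have LD : {morph L : x y / x + y} := @span_liftD K (tens_data A C) U f hf.
have L0 : L 0 = 0 := @span_lift0 K (tens_data A C) U f hf.
have LB x y : L (x - y) = L x - L y.
  by apply: (addIr (L y)); rewrite -LD !subrK.
have Lin p : L (tens_in p.1 p.2) = f p.
  by case: p => a c; apply: (@span_lift_in _ (tens_data A C) _ _ (a, c) hf).
have LS t : t \in gtens_pred (A:=A) (C:=C) -> L t \in S.
  move=> /asboolP[s [hs ->]]; rewrite (big_morph L LD L0) big_seq.
  by elim/big_ind: _ => // p /hs hp; rewrite Lin; apply: fS.
pose Z (x : gtens A C) := q (L (gtens_val x)) = 0.
have vS (x : gtens A C) : L (gtens_val x) \in S by apply/LS/(valP (x : gtens_sort A C)).
have vD (x y : gtens A C) : gtens_val (x + y) = gtens_val x + gtens_val y.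
  exact: (raddfD val).
have ZD x y : Z x -> Z y -> Z (x + y).
  by rewrite /Z vD LD qD // => -> ->; rewrite addr0.
have Z0 : Z 0 by rewrite /Z [gtens_val _](raddf0 val) L0 q0.
pose E (p : A * C) : gtens A C := insubd (0 : gtens_sort A C) (tens_in p.1 p.2).
have EP p : composable p -> gtens_val (E p) = tens_in p.1 p.2.
  by case: p => a c /composable_gtens h; apply: (val_gtens h).
have span (u : gtens A C) : exists s : seq (A * C),
    (forall p, p \in s -> composable p) /\ u = \sum_(p <- s) E p.
  have /asboolP[s [hs uE]] := valP (u : gtens_sort A C).
  exists s; split=> //; apply: val_inj; rewrite [LHS]uE.
  rewrite [RHS](raddf_sum val); apply: eq_big_seq => p /hs hp.
  by rewrite [RHS]EP.
have Zsum (J : eqType) (s : seq J) (F : J -> gtens A C) :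
    (forall j, j \in s -> Z (F j)) -> Z (\sum_(j <- s) F j).
  by move=> hF; rewrite big_seq; elim/big_ind: _.
have Zideal x : ideal (@fib_rel _ _ A C) x -> Z x.
  move=> [s [hs ->]]; apply: (Zsum) => -[[u x'] w] /hs /= [b xE].
  have [s1 [hs1 ->]] := span u; have [s2 [hs2 ->]] := span w.
  rewrite mulr_suml mulr_suml; apply: (Zsum) => p /hs1 hp.
  rewrite mulr_sumr; apply: (Zsum) => r /hs2 hr.
  have vM (y z : gtens A C) : gtens_val (y * z) = gtens_val y * gtens_val z.
    exact: (rmorphM val).
  rewrite /Z !vM !EP // xE mulrBr mulrBl !tens_inM !mulr1 LB.
  have [g [h [k [dp1 dp2]]]] := hp; have [g' [h' [k' [dr1 dr2]]]] := hr.
  (* The middle degree [h] is shared by [p.1] and [p.2], so [b] comes to the front as the same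
     element [act h b] in both terms, where [fbal] applies. *)
  rewrite (smap_act _ dp1) (rmap_act _ dp2) -!mulrA.
  have hpr : composable (p.1 * r.1, p.2 * r.2).
    by exists (g * g')%g, (h * h')%g, (k * k')%g; split; apply: degM.
  have hprs : composable (smap A (act h b) * (p.1 * r.1), p.2 * r.2).
    exists (g * g')%g, (h * h')%g, (k * k')%g; split; last exact: degM.
    by have := degM (smap_deg A (act h b)) (degM dp1 dr1); rewrite !mul1g.
  have hprr : composable (p.1 * r.1, rmap C (act h b) * (p.2 * r.2)).
    exists (g * g')%g, (h * h')%g, (k * k')%g; split; first exact: degM.
    by have := degM (rmap_deg C (act h b)) (degM dp2 dr2); rewrite !mul1g.
  rewrite (Lin (_, _)) (Lin (_, _)) qB; [|exact: fS..].
  by apply/eqP; rewrite subr_eq0; apply/eqP; apply: (fbal _ (_, _)).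
have wd t u : t \in gtens_pred (A:=A) (C:=C) -> u \in gtens_pred (A:=A) (C:=C) ->
    fib_class t = fib_class u -> q (L t) = q (L u).
  move=> ht hu /quot_inP /Zideal; rewrite /Z [gtens_val _](raddfB val) LB.
  rewrite /= (val_gtens ht) (val_gtens hu) qB ?LS //.
  by move/eqP; rewrite subr_eq0 => /eqP.
have /choice[T hT] (x : fib A C) :
    exists t, t \in gtens_pred (A:=A) (C:=C) /\ x = fib_class t.
  by have [t h1 h2] := fib_repr x; exists t.
exists (fun x => q (L (T x))); split=> [x y|[a c] hp].
  have [hx xE] := hT x; have [hy yE] := hT y; have [hxy xyE] := hT (x + y).
  rewrite -qD ?LS // -LD; apply: wd => //; first exact: rpredD.
  by rewrite fib_classD // -xE -yE -xyE.
have [hx xE] := hT (fib_in a c); rewrite -[in RHS]Lin; apply: wd => //.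
exact: composable_gtens.
Qed.

(** This makes Sweedler sums independent of the decomposition, so each Hopf axiom becomes a
    statement about [F (Delta a)]. *)
Lemma fib_additive_sweedler (V : zmodType) (F : fib A C -> V) (h : A * C -> V) x s :
  {morph F : x y / x + y} ->
  (forall p, composable p -> F (fib_in p.1 p.2) = h p) ->
  sweedler x s -> F x = \sum_(p <- s) h p.
Proof.
move=> FD Fh [hs ->].
have F0 : F 0 = 0 by apply: (addIr (F 0)); rewrite -FD !add0r.
by rewrite (big_morph F FD F0); apply: eq_big_seq => p /hs/Fh.
Qed.

Lemma fib_additive_mul (V : pzRingType) (F : fib A C -> V) (h : A * C -> V) :
  {morph F : x y / x + y} ->
  (forall p, composable p -> F (fib_in p.1 p.2) = h p) ->
  (forall p r, composable p -> composable r ->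
    h (p.1 * r.1, p.2 * r.2) = h p * h r) ->
  {morph F : x y / x * y}.
Proof.
move=> FD Fh hM x y.
have F0 : F 0 = 0 by apply: (addIr (F 0)); rewrite -FD !add0r.
have [s hs] := sweedler_ex x; have [t ht] := sweedler_ex y.
rewrite (fib_additive_sweedler FD Fh hs) (fib_additive_sweedler FD Fh ht).
case: hs ht => hs -> [ht ->].
rewrite mulr_suml mulr_suml (big_morph F FD F0); apply: eq_big_seq => p /hs hp.
rewrite !mulr_sumr (big_morph F FD F0); apply: eq_big_seq => r /ht hr.
rewrite [X in F X]fib_inM -?surjective_pairing // (Fh (_, _)) ?hM //.
have [g [h1 [k [dp1 dp2]]]] := hp; have [g' [h' [k' [dr1 dr2]]]] := hr.
by exists (g * g')%g, (h1 * h')%g, (k * k')%g; split; apply: degM.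
Qed.

End FiberLift.

(** * Graded algebras by generators and relations *)

Section GradedPresentation.
Variables (K : numClosedFieldType) (G : groupType) (L : choiceType).
Variables (ldeg : L -> G * G) (Rel : set (seq (K * seq L))).

Definition word_deg (w : seq L) : G * G :=
  foldr (fun l d => ((ldeg l).1 * d.1, (ldeg l).2 * d.2)%g) (1, 1)%g w.

Lemma word_deg_cat u w : word_deg (u ++ w) =
  ((word_deg u).1 * (word_deg w).1, (word_deg u).2 * (word_deg w).2)%g.
Proof.
elim: u => [|l u IHu] /=; first by rewrite !mul1g -surjective_pairing.
by rewrite IHu !mulgA.
Qed.

(* Every homogeneous component of a relation is imposed separately, so the
   quotient is graded whether or not the relations are homogeneous. *)
Definition pres_test (V : zmodType) (f : K * seq L -> V) : Prop :=
  (forall y z w, f (y + z, w) = f (y, w) + f (z, w)) /\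
  forall rel, Rel rel -> forall z u u' d,
    \sum_(t <- rel | word_deg t.2 == d) f (z * t.1, u ++ t.2 ++ u') = 0.

Program Definition pres_data : span_data K := {|
  sp_gen := (K * seq L)%type;
  sp_test := pres_test;
  sp_scale z p := (z * p.1, p.2);
  sp_mul p q := (p.1 * q.1, p.2 ++ q.2);
  sp_one := (1, [::]) |}.
Next Obligation.
move=> V t z [tD tR]; split=> [y y' w|rel hrel y u u' d] /=; first by rewrite mulrDr tD.
by under eq_bigr do rewrite mulrA; apply: tR.
Qed.
Next Obligation.
move=> V t x [tD tR]; split=> [y y' w|rel hrel y u u' d] /=; first by rewrite mulrDr tD.
by under eq_bigr do rewrite mulrA catA; apply: tR.
Qed.
Next Obligation.
move=> V t x [tD tR]; split=> [y y' w|rel hrel y u u' d] /=; first by rewrite mulrDl tD.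
by under eq_bigr do rewrite -!catA mulrAC; apply: tR.
Qed.
Next Obligation. by move=> V t y z x [tD _] /=; rewrite mulrDl tD. Qed.
Next Obligation. by move=> [z w]; rewrite mul1r. Qed.
Next Obligation. by move=> y z [z' w] /=; rewrite mulrA. Qed.
Next Obligation. by move=> [z w] [z' w'] [z'' w''] /=; rewrite mulrA catA. Qed.
Next Obligation. by move=> [z w] /=; rewrite mul1r. Qed.
Next Obligation. by move=> [z w] /=; rewrite mulr1 cats0. Qed.
Next Obligation. by move=> z [y w] [y' w'] /=; rewrite mulrA. Qed.
Next Obligation. by move=> z [y w] [y' w'] /=; rewrite mulrCA. Qed.

Definition pres : alg K := span_alg pres_data.
Definition pres_in (z : K) (w : seq L) : pres := @span_in K pres_data (z, w).
Definition letter (l : L) : pres := pres_in 1 [:: l].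

Lemma pres_inM z w z' w' : pres_in z w * pres_in z' w' = pres_in (z * z') (w ++ w').
Proof. exact: span_inM. Qed.

Lemma pres_inZ z z' w : z *: pres_in z' w = pres_in (z * z') w.
Proof. exact: span_inZ. Qed.

Lemma pres_in_cons l w : pres_in 1 (l :: w) = letter l * pres_in 1 w.
Proof. by rewrite [RHS]pres_inM mul1r. Qed.

Lemma pres_inE z w : pres_in z w = z *: \prod_(l <- w) letter l.
Proof.
suff -> : \prod_(l <- w) letter l = pres_in 1 w by rewrite pres_inZ mulr1.
elim: w => [|l w IHw]; first by rewrite big_nil.
by rewrite big_cons IHw -pres_in_cons.
Qed.

Definition eval (A : alg K) (phi : L -> A) (rel : seq (K * seq L)) : A :=
  \sum_(t <- rel) t.1 *: \prod_(l <- t.2) phi l.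

(** Tests kill the homogeneous components of a relation; sorting its terms by degree adds these up
    to the relation itself. *)
Lemma pres_test_rel (V : zmodType) (f : K * seq L -> V) rel z u u' :
  pres_test f -> Rel rel ->
  \sum_(t <- rel) f (z * t.1, u ++ t.2 ++ u') = 0.
Proof.
move=> [_ fR] hrel; pose ds := undup [seq word_deg t.2 | t <- rel].
rewrite big_seq (eq_bigr (fun t => \sum_(d <- ds | word_deg t.2 == d)
    f (z * t.1, u ++ t.2 ++ u'))).
  rewrite -big_seq (exchange_big_dep predT) //=.
  by rewrite big1 // => d _; apply: fR.
move=> t ht; under eq_bigl do rewrite eq_sym.
rewrite sum_pred1_uniq ?undup_uniq // mem_undup.
by apply/mapP; exists t.
Qed.

Lemma eval_letter rel : Rel rel -> eval letter rel = 0.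
Proof.
move=> hrel; rewrite /eval; under eq_bigr do rewrite -pres_inE.
have -> : \sum_(t <- rel) pres_in t.1 t.2 = span_class (D := pres_data) rel.
  by rewrite [RHS]span_classE; apply: eq_bigr => t _; case: t.
apply/span_classP => V f hf; rewrite big_nil.
rewrite -[RHS](pres_test_rel 1 [::] [::] hf hrel).
by apply: eq_bigr => t _; rewrite mul1r cats0 -surjective_pairing.
Qed.

Lemma pres_ind (P : pres -> Prop) :
  P 0 -> (forall x y, P x -> P y -> P (x + y)) -> (forall z w, P (pres_in z w)) ->
  forall x, P x.
Proof.
move=> P0 PD Pw x; rewrite (span_sumE x).
by elim/big_ind: _ => [||[z w] _]; [exact: P0|exact: PD|exact: Pw].
Qed.

Lemma pres_hom_ext (A : alg K) (f h : pres -> A) : is_alg_hom f -> is_alg_hom h ->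
  (forall l, f (letter l) = h (letter l)) -> f =1 h.
Proof.
move=> hf hh e; apply: pres_ind => [|x y ex ey|z w].
- by rewrite (alg_hom0 hf) (alg_hom0 hh).
- by rewrite (alg_homD hf) (alg_homD hh) ex ey.
rewrite -[z]mulr1 -pres_inZ (alg_homZ hf) (alg_homZ hh); congr (_ *: _).
elim: w => [|l w IHw]; first by rewrite (alg_hom1 hf) (alg_hom1 hh).
by rewrite pres_in_cons (alg_homM hf) (alg_homM hh) e IHw.
Qed.

Definition pres_deg (g h : G) : set pres := [set x | exists s : seq (K * seq L),
  (forall t, t \in s -> word_deg t.2 = (g, h)) /\ x = \sum_(t <- s) pres_in t.1 t.2].

Lemma pres_deg_in z w d : word_deg w = d -> pres_deg d.1 d.2 (pres_in z w).
Proof.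
move=> hw; exists [:: (z, w)]; rewrite big_seq1; split=> // t; rewrite inE => /eqP ->.
by rewrite -surjective_pairing.
Qed.

Fact pres_grading : is_grading (fun p : G * G => pres_deg p.1 p.2).
Proof.
have W0 (i : G * G) : pres_deg i.1 i.2 0 by exists [::]; rewrite big_nil.
have WD (i : G * G) z x y : pres_deg i.1 i.2 x -> pres_deg i.1 i.2 y ->
    pres_deg i.1 i.2 (z *: x + y).
  move=> [s [hs ->]] [t [ht ->]]; exists ([seq (z * p.1, p.2) | p <- s] ++ t).
  split=> [p|]; first by rewrite mem_cat => /orP[/mapP[q /hs h ->]|/ht].
  rewrite big_cat big_map scaler_sumr; congr (_ + _).
  by apply: eq_bigr => p _; rewrite pres_inZ.
split=> // [x|s f us hf s0 i si].
  have [|t [f [ut hf E]]] := @grading_span _ _ _ (fun p : G * G => pres_deg p.1 p.2)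
    [seq @span_in K pres_data p | p <- span_repr x] W0 WD; last first.
    by exists t, f; split; rewrite // -E big_map -span_sumE.
  by move=> _ /mapP[[z w] _ ->]; exists (word_deg w); apply: pres_deg_in.
pose p_ (d : G * G) (t : K * seq L) : pres :=
  if word_deg t.2 == d then pres_in t.1 t.2 else 0.
have inD y z w : pres_in (y + z) w = pres_in y w + pres_in z w.
  by rewrite !pres_inE scalerDl.
have pT d : pres_test (p_ d).
  split=> [y z w|rel hrel z u u' d']; rewrite /p_ /=; first by case: ifP; rewrite ?addr0.
  (* Multiplication by [u] and [u'] carries the component [d'] of the relation into the single
     degree [d''], so projecting to [d] keeps all of it or nothing. This is where imposing the
     relations by components is used. *)
  pose d'' : G * G := ((word_deg u).1 * (d'.1 * (word_deg u').1),
    (word_deg u).2 * (d'.2 * (word_deg u').2))%g.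
  transitivity (if d'' == d then
      \sum_(t <- rel | word_deg t.2 == d') pres_in (z * t.1) (u ++ t.2 ++ u') else 0).
    rewrite /d''; case: ifP => e.
      by apply: eq_bigr => t /eqP ht; rewrite !word_deg_cat ht e.
    by rewrite big1 // => t /eqP ht; rewrite !word_deg_cat ht e.
  case: ifP => // _.
  transitivity (span_class (D := pres_data)
      [seq (z * t.1, u ++ t.2 ++ u') | t <- rel & word_deg t.2 == d']).
    by rewrite [RHS]span_classE big_map big_filter.
  apply/span_classP => V h [_ hR].
  by rewrite big_nil big_map big_filter; apply: hR.
pose pr d : pres -> pres := @span_lift K pres_data pres (p_ d).
have prD d : {morph pr d : x y / x + y} := @span_liftD K pres_data pres _ (pT d).
have pr0 d : pr d 0 = 0 := @span_lift0 K pres_data pres _ (pT d).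
have prE d d' x : pres_deg d'.1 d'.2 x -> pr d x = if d' == d then x else 0.
  move=> [t [ht ->]]; rewrite (big_morph _ (prD d) (pr0 d)).
  transitivity (\sum_(p <- t) if d' == d then pres_in p.1 p.2 else 0).
    apply: eq_big_seq => -[z w] /ht /= hw.
    rewrite /pr [LHS](@span_lift_in K pres_data pres _ (z, w) (pT d)) /p_ hw.
    by rewrite -surjective_pairing.
  by case: ifP => // _; rewrite big1.
have := congr1 (pr i) s0; rewrite pr0 (big_morph _ (prD i) (pr0 i)) (bigD1_seq i) //=.
rewrite (prE _ i) // eqxx big1 ?addr0 // => j /negPf ne.
by rewrite (prE _ j) // ne.
Qed.

Fact pres_degM g h g' h' x y : pres_deg g h x -> pres_deg g' h' y ->
  pres_deg (g * g')%g (h * h')%g (x * y).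
Proof.
move=> [s [hs ->]] [t [ht ->]].
exists [seq (p.1 * q.1, p.2 ++ q.2) | p <- s, q <- t]; split.
  by move=> _ /allpairsP[[p q] [/hs hp /ht hq ->]]; rewrite word_deg_cat /= hp hq.
rewrite big_allpairs_dep /= mulr_suml; apply: eq_bigr => p _.
by rewrite mulr_sumr; apply: eq_bigr => q _; rewrite pres_inM.
Qed.

Lemma letter_deg l : pres_deg (ldeg l).1 (ldeg l).2 (letter l).
Proof. by apply: pres_deg_in => /=; rewrite !mulg1 -surjective_pairing. Qed.

(** Multiplicativity of [chi] extends the commutation rule from letters to words. With [chi] equal
    to [fst] and [snd] this gives the rules for [r] and [s]. *)
Lemma pres_deg_commute (B : Type) (rho : B -> pres) (ac : G -> B -> B)
    (chi : G * G -> G) :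
  (forall d d', chi (d.1 * d'.1, d.2 * d'.2)%g = (chi d * chi d')%g) ->
  chi (1, 1)%g = 1%g ->
  (forall b, ac 1%g b = b) -> (forall g h b, ac (g * h)%g b = ac g (ac h b)) ->
  (forall l b, letter l * rho b = rho (ac (chi (ldeg l)) b) * letter l) ->
  forall g h x b, pres_deg g h x -> x * rho b = rho (ac (chi (g, h)) b) * x.
Proof.
move=> chiM chi1 ac1 acM hl g h x b [s [hs ->]].
rewrite mulr_suml mulr_sumr; apply: eq_big_seq => -[z w] /hs /= <-.
rewrite !pres_inE -algZl -algZr; congr (_ *: _).
elim: w {hs z} => [|l w IHw]; first by rewrite big_nil chi1 ac1 mul1r mulr1.
by rewrite big_cons -mulrA IHw mulrA hl chiM acM mulrA.
Qed.

End GradedPresentation.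

(** * Morphisms out of a presented graded algebra *)

Section BGComponents.
Variables (K : numClosedFieldType) (X : base K) (A : bgAlg X).

(** The presentation imposes every homogeneous component of a relation, while in the target only
    their sum is known to vanish; the projections of the grading bridge the gap. *)
Lemma deg_component_eq0 (T : Type) (r : seq T) (F : T -> A)
    (d : T -> base_grp X * base_grp X) d0 :
  (forall t, deg (d t).1 (d t).2 (F t)) -> \sum_(t <- r) F t = 0 ->
  \sum_(t <- r | d t == d0) F t = 0.
Proof.
move=> hF s0; have [pr [prL prE]] := grading_proj (pred1 d0) (deg_grading A).
have prD : {morph pr : x y / x + y} by move=> x y; rewrite -[x in LHS]scale1r prL scale1r.
have pr0 : pr 0 = 0 by apply: (addIr (pr 0)); rewrite -prD !add0r.
have := congr1 pr s0; rewrite (big_morph _ prD pr0) pr0 => e.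
by rewrite -[RHS]e big_mkcond; apply: eq_bigr => t _; rewrite (prE (d t)).
Qed.

Variables (L : choiceType) (ldeg : L -> base_grp X * base_grp X).
Variables (Rel : set (seq (K * seq L))) (phi : L -> A).
Hypothesis phi_deg : forall l, deg (ldeg l).1 (ldeg l).2 (phi l).
Hypothesis phi_rel : forall rel, Rel rel -> eval phi rel = 0.

Lemma word_deg_prod w :
  deg (word_deg ldeg w).1 (word_deg ldeg w).2 (\prod_(l <- w) phi l).
Proof.
elim: w => [|l w IHw]; first by rewrite big_nil; apply: deg1.
by rewrite big_cons /=; apply: degM.
Qed.

Definition pres_lift : pres ldeg Rel -> A :=
  @span_lift K (pres_data ldeg Rel) A (fun t => t.1 *: \prod_(l <- t.2) phi l).

Fact pres_lift_test :
  pres_test ldeg Rel (fun t : K * seq L => t.1 *: \prod_(l <- t.2) phi l).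
Proof.
split=> [y z w|rel hrel z u u' d] /=; first by rewrite scalerDl.
have /(deg_component_eq0 _) e := phi_rel hrel.
have := e (fun t => word_deg ldeg t.2) d (fun t => degZ t.1 (word_deg_prod t.2)).
move=> {}e.
transitivity (z *: (\prod_(l <- u) phi l *
    (\sum_(t <- rel | word_deg ldeg t.2 == d) t.1 *: \prod_(l <- t.2) phi l) *
    \prod_(l <- u') phi l)); last by rewrite e mulr0 mul0r scaler0.
rewrite mulr_sumr mulr_suml scaler_sumr; apply: eq_bigr => t _.
by rewrite -scalerA !big_cat /= -algZr -algZl mulrA.
Qed.

Lemma pres_lift_in z w : pres_lift (pres_in ldeg Rel z w) = z *: \prod_(l <- w) phi l.
Proof. exact: (@span_lift_in _ (pres_data ldeg Rel) _ _ (z, w) pres_lift_test). Qed.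

Lemma pres_lift_letter l : pres_lift (letter ldeg Rel l) = phi l.
Proof. by rewrite pres_lift_in scale1r big_seq1. Qed.

Fact pres_lift_hom : is_alg_hom pres_lift.
Proof.
have fD : {morph pres_lift : x y / x + y} :=
  @span_liftD _ (pres_data ldeg Rel) _ _ pres_lift_test.
have f0 : pres_lift 0 = 0 :=
  @span_lift0 _ (pres_data ldeg Rel) _ _ pres_lift_test.
have sp (x : pres ldeg Rel) : exists s : seq (K * seq L),
    x = \sum_(t <- s) pres_in ldeg Rel t.1 t.2.
  exists (span_repr x); rewrite {1}(span_sumE x); by apply: eq_bigr => -[].
split=> [z x y|].
  rewrite fD; congr (_ + _); have [s ->] := sp x.
  rewrite scaler_sumr !(big_morph _ fD f0) scaler_sumr; apply: eq_bigr => t _.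
  by rewrite pres_inZ !pres_lift_in scalerA.
split=> [|x y]; first by rewrite [LHS](pres_lift_in 1 [::]) scale1r big_nil.
have [s ->] := sp x; have [t ->] := sp y.
rewrite mulr_suml !(big_morph _ fD f0) mulr_suml; apply: eq_bigr => p _.
rewrite !mulr_sumr !(big_morph _ fD f0); apply: eq_bigr => q _.
by rewrite pres_inM !pres_lift_in big_cat /= -scalerA -algZl -algZr.
Qed.

Lemma pres_lift_deg g h (x : pres ldeg Rel) : pres_deg g h x -> deg g h (pres_lift x).
Proof.
move=> [s [hs ->]]; rewrite (alg_hom_sum pres_lift_hom) big_seq.
apply: deg_sum => t /hs ht; rewrite pres_lift_in; apply: degZ.
by have := word_deg_prod t.2; rewrite ht.
Qed.

End BGComponents.

(** * The universal algebra *)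

Section AoRelations.
Variables (K : numClosedFieldType) (X : base K) (n : nat) (g : 'I_n -> base_grp X).
Local Notation ginv := (fun i => (g i)^-1%g).

Definition Ao_rel (F Q : 'M[X]_n) (A : bgAlg X) (v w : 'M[A]_n) : Prop :=
  [/\ mx_inverse v w,
      map_mx (rmap A) (twist g F) *m w^T = v *m map_mx (smap A) F
    & map_mx (rmap A) (twist g Q) *m v = v *m map_mx (smap A) Q].

Lemma supp_Qmx (G : 'M[X]_n) : supp g ginv G -> supp g g (Qmx g G).
Proof.
move=> hG; rewrite QmxE //; apply: (supp_mul hG); apply: supp_conj.
exact/supp_twist/supp_invr.
Qed.

Lemma Ao_matrixE (F G : 'M[X]_n) (A : bgAlg X) (v : 'M[A]_n) :
  supp g ginv F -> supp g ginv G ->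
  Ao_matrix g F G v <-> bideg g g v /\ exists w, Ao_rel F (Qmx g G) v w.
Proof.
move=> hF hG; rewrite /Ao_matrix /Ao_rel nabla_supp // nablaV_supp ?in_crossK //.
exact: supp_Qmx.
Qed.

Lemma Ao_rel_inv (F F1 Q : 'M[X]_n) (A : bgAlg X) (v w : 'M[A]_n) :
  supp g ginv F -> mx_inverse F F1 -> Ao_rel F Q v w ->
  w^T = map_mx (rmap A) (twist ginv F1) *m v *m map_mx (smap A) F.
Proof.
move=> hF FF1 [_ e _]; rewrite -mulmxA -e mulmxA -(map_mx_homM (rmap_hom A)).
have [_ ->] := mx_inverse_twist hF FF1.
by rewrite (map_mx_hom1 (rmap_hom A)) mul1mx.
Qed.

(** The degrees of [v^-1] are read off from [Ao_rel_inv]: the odd matrices [F1] on the left and [F]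
    on the right invert the row and column degrees of [v]. *)
Lemma Ao_rel_bideg (F F1 Q : 'M[X]_n) (A : bgAlg X) (v w : 'M[A]_n) :
  supp g ginv F -> mx_inverse F F1 -> bideg g g v -> Ao_rel F Q v w ->
  bideg ginv ginv w^T.
Proof.
move=> hF FF1 hv /(Ao_rel_inv hF FF1) ->; apply: (bideg_smap hF).
by apply: bideg_rmap hv; apply/supp_twist/(supp_mx_inverse hF FF1).
Qed.

Lemma is_bg_mor_bideg (A C : bgAlg X) (f : A -> C) a b (v : 'M[A]_n) :
  is_bg_mor f -> bideg a b v -> bideg a b (map_mx f v).
Proof. by move=> [_ fd _ _] hv i j; rewrite mxE; apply: fd. Qed.

Lemma is_bg_mor_rmap (A C : bgAlg X) (f : A -> C) (P : 'M[X]_n) :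
  is_bg_mor f -> map_mx f (map_mx (rmap A) P) = map_mx (rmap C) P.
Proof. by move=> [_ _ fr _]; apply/matrixP => i j; rewrite !mxE. Qed.

Lemma is_bg_mor_smap (A C : bgAlg X) (f : A -> C) (P : 'M[X]_n) :
  is_bg_mor f -> map_mx f (map_mx (smap A) P) = map_mx (smap C) P.
Proof. by move=> [_ _ _ fs]; apply/matrixP => i j; rewrite !mxE. Qed.

Lemma is_bg_mor_comp (A C D : bgAlg X) (f : A -> C) (h : C -> D) :
  is_bg_mor f -> is_bg_mor h -> is_bg_mor (h \o f).
Proof.
move=> [f1 f2 f3 f4] [h1 h2 h3 h4]; split=> [|x y a|b|b] /=.
- exact: alg_hom_comp f1 h1.
- by move=> /f2/h2.
- by rewrite f3 h3.
- by rewrite f4 h4.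
Qed.

Lemma is_bg_mor_id (A : bgAlg X) : is_bg_mor (@id A).
Proof. by split=> //; split=> //; split. Qed.

Lemma Ao_rel_mor (F Q : 'M[X]_n) (A C : bgAlg X) (f : A -> C) (v w : 'M[A]_n) :
  is_bg_mor f -> Ao_rel F Q v w -> Ao_rel F Q (map_mx f v) (map_mx f w).
Proof.
move=> fm [vw r1 r2]; have [fh _ _ _] := fm; split; first exact: mx_inverse_hom.
- by rewrite -(is_bg_mor_rmap _ fm) -(is_bg_mor_smap _ fm) map_trmx -!(map_mx_homM fh) r1.
- by rewrite -(is_bg_mor_rmap _ fm) -(is_bg_mor_smap _ fm) -!(map_mx_homM fh) r2.
Qed.

End AoRelations.

(** * Construction of the universal algebra from words in its generators *)

Section AoPresentation.
Variables (K : numClosedFieldType) (X : base K) (n : nat) (g : 'I_n -> base_grp X).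
Local Notation ginv := (fun i => (g i)^-1%g).
Variables (F F1 Q : 'M[X]_n).
Hypotheses (hF : supp g ginv F) (FF1 : mx_inverse F F1).

Definition Ao_letter : choiceType := (X + X + 'I_n * 'I_n)%type.
Definition gr (b : X) : Ao_letter := inl (inl b).
Definition gs (b : X) : Ao_letter := inl (inr b).
Definition gv i j : Ao_letter := inr (i, j).

Definition Ao_deg (l : Ao_letter) : base_grp X * base_grp X :=
  if l is inr p then (g p.1, g p.2) else (1, 1)%g.

Definition word_eqn (u u' : seq Ao_letter) : seq (K * seq Ao_letter) :=
  [:: (1, u); (-1, u')].

(* No generators are needed for the inverse of [v]: its transpose is
   [r(nabla F nabla)^-1 v s(F)]. *)
Inductive Ao_rels : set (seq (K * seq Ao_letter)) :=
| Ao_rD z b c : Ao_rels [:: (1, [:: gr (z *: b + c)]); (- z, [:: gr b]); (-1, [:: gr c])]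
| Ao_r1 : Ao_rels (word_eqn [:: gr 1] [::])
| Ao_rM b c : Ao_rels (word_eqn [:: gr (b * c)] [:: gr b; gr c])
| Ao_sD z b c : Ao_rels [:: (1, [:: gs (z *: b + c)]); (- z, [:: gs b]); (-1, [:: gs c])]
| Ao_s1 : Ao_rels (word_eqn [:: gs 1] [::])
| Ao_sM b c : Ao_rels (word_eqn [:: gs (b * c)] [:: gs b; gs c])
| Ao_rs b c : Ao_rels (word_eqn [:: gr b; gs c] [:: gs c; gr b])
| Ao_vr i j b : Ao_rels (word_eqn [:: gv i j; gr b] [:: gr (act (g i) b); gv i j])
| Ao_vs i j b : Ao_rels (word_eqn [:: gv i j; gs b] [:: gs (act (g j) b); gv i j])
| Ao_vw i j : Ao_rels ((- (i == j)%:R, [::]) ::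
    [seq (1, [:: gv i p.1; gr (twist ginv F1 j p.2.2); gv p.2.2 p.2.1; gs (F p.2.1 p.1)])
    | p <- index_enum ('I_n * ('I_n * 'I_n))%type])
| Ao_wv i j : Ao_rels ((- (i == j)%:R, [::]) ::
    [seq (1, [:: gr (twist ginv F1 p.1 p.2.2); gv p.2.2 p.2.1; gs (F p.2.1 i); gv p.1 j])
    | p <- index_enum ('I_n * ('I_n * 'I_n))%type])
| Ao_Q i j : Ao_rels ([seq (1, [:: gr (twist g Q i k); gv k j]) | k <- index_enum 'I_n] ++
    [seq (-1, [:: gv i k; gs (Q k j)]) | k <- index_enum 'I_n]).

Section Eval.
Variables (A : alg K) (phi : Ao_letter -> A).

Lemma eval_eqn u u' :
  eval phi (word_eqn u u') = \prod_(l <- u) phi l - \prod_(l <- u') phi l.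
Proof. by rewrite /eval big_cons big_seq1 /= scale1r scaleN1r. Qed.

Let V := (\matrix_(i, j) phi (gv i j)) : 'M[A]_n.
Let W := (map_mx (phi \o gr) (twist ginv F1) *m V *m map_mx (phi \o gs) F)^T.

(** Relations are flat lists of words, so a product of four matrices is listed as a sum over triples
    of indices, which is regrouped here. *)
Lemma eval_vw i j :
  eval phi ((- (i == j)%:R, [::]) ::
    [seq (1, [:: gv i p.1; gr (twist ginv F1 j p.2.2); gv p.2.2 p.2.1; gs (F p.2.1 p.1)])
    | p <- index_enum ('I_n * ('I_n * 'I_n))%type]) = (V *m W) i j - (1%:M : 'M[A]_n) i j.
Proof.
rewrite /eval big_cons big_nil /= scaleNr addrC; congr (_ - _); last first.
  by rewrite mxE; case: eqP; rewrite ?scale1r ?scale0r.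
rewrite big_map /= mxE -(pair_big predT predT (fun k p => 1 *:
  \prod_(l <- [:: gv i k; gr (twist ginv F1 j p.2); gv p.2 p.1; gs (F p.1 k)]) phi l)) /=.
apply: eq_bigr => k _; rewrite -(pair_big predT predT (fun m l => 1 *:
  \prod_(l <- [:: gv i k; gr (twist ginv F1 j l); gv l m; gs (F m k)]) phi l)) /=.
rewrite !mxE mulr_sumr; apply: eq_bigr => m _.
rewrite mxE mulr_suml mulr_sumr; apply: eq_bigr => l _.
by rewrite !big_cons big_nil !mxE /= mulr1 scale1r !mulrA.
Qed.

Lemma eval_wv i j :
  eval phi ((- (i == j)%:R, [::]) ::
    [seq (1, [:: gr (twist ginv F1 p.1 p.2.2); gv p.2.2 p.2.1; gs (F p.2.1 i); gv p.1 j])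
    | p <- index_enum ('I_n * ('I_n * 'I_n))%type]) = (W *m V) i j - (1%:M : 'M[A]_n) i j.
Proof.
rewrite /eval big_cons big_nil /= scaleNr addrC; congr (_ - _); last first.
  by rewrite mxE; case: eqP; rewrite ?scale1r ?scale0r.
rewrite big_map /= mxE -(pair_big predT predT (fun k p => 1 *:
  \prod_(l <- [:: gr (twist ginv F1 k p.2); gv p.2 p.1; gs (F p.1 i); gv k j]) phi l)) /=.
apply: eq_bigr => k _; rewrite -(pair_big predT predT (fun m l => 1 *:
  \prod_(l <- [:: gr (twist ginv F1 k l); gv l m; gs (F m i); gv k j]) phi l)) /=.
rewrite !mxE mulr_suml; apply: eq_bigr => m _.
rewrite mxE !mulr_suml; apply: eq_bigr => l _.
by rewrite !big_cons big_nil !mxE /= mulr1 scale1r !mulrA.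
Qed.

Lemma eval_Q i j :
  eval phi ([seq (1, [:: gr (twist g Q i k); gv k j]) | k <- index_enum 'I_n] ++
    [seq (-1, [:: gv i k; gs (Q k j)]) | k <- index_enum 'I_n]) =
  (map_mx (phi \o gr) (twist g Q) *m V) i j - (V *m map_mx (phi \o gs) Q) i j.
Proof.
rewrite /eval big_cat !big_map /= !mxE -sumrN; congr (_ + _).
  by apply: eq_bigr => k _; rewrite !big_cons big_nil !mxE /= mulr1 scale1r.
by apply: eq_bigr => k _; rewrite !big_cons big_nil !mxE /= mulr1 scaleN1r.
Qed.

End Eval.

Local Notation P := (pres Ao_deg Ao_rels).
Local Notation lt := (letter Ao_deg Ao_rels).

Definition Ao_rmap (b : X) : P := lt (gr b).
Definition Ao_smap (b : X) : P := lt (gs b).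

Lemma Ao_eqn u u' : Ao_rels (word_eqn u u') -> \prod_(l <- u) lt l = \prod_(l <- u') lt l.
Proof. by move=> /(@eval_letter _ _ _ Ao_deg) /eqP; rewrite eval_eqn subr_eq0 => /eqP. Qed.

Fact Ao_rmap_hom : is_alg_hom Ao_rmap.
Proof.
split=> [z b c|].
  have := eval_letter Ao_deg (Ao_rD z b c).
  rewrite /eval !big_cons !big_nil /= !mulr1 addr0 scale1r scaleNr scaleN1r -opprD.
  by move/eqP; rewrite subr_eq0 => /eqP.
split=> [|b c]; first by have := Ao_eqn Ao_r1; rewrite big_seq1 big_nil.
by have := Ao_eqn (Ao_rM b c); rewrite !big_cons !big_nil !mulr1.
Qed.

Fact Ao_smap_hom : is_alg_hom Ao_smap.
Proof.
split=> [z b c|].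
  have := eval_letter Ao_deg (Ao_sD z b c).
  rewrite /eval !big_cons !big_nil /= !mulr1 addr0 scale1r scaleNr scaleN1r -opprD.
  by move/eqP; rewrite subr_eq0 => /eqP.
split=> [|b c]; first by have := Ao_eqn Ao_s1; rewrite big_seq1 big_nil.
by have := Ao_eqn (Ao_sM b c); rewrite !big_cons !big_nil !mulr1.
Qed.

Fact Ao_rsmapC b c : Ao_rmap b * Ao_smap c = Ao_smap c * Ao_rmap b.
Proof. by have := Ao_eqn (Ao_rs b c); rewrite !big_cons !big_nil !mulr1. Qed.

Fact Ao_rmap_act (x y : base_grp X) (a : P) b :
  pres_deg x y a -> a * Ao_rmap b = Ao_rmap (act x b) * a.
Proof.
apply: (@pres_deg_commute _ _ _ _ _ _ Ao_rmap (@act K X) fst) => //.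
- exact: act1.
- exact: actM.
move=> [[c|c]|[i j]] d /=.
- rewrite act1 -[lt _]/(Ao_rmap c) -!(alg_homM Ao_rmap_hom).
  by rewrite base_comm.
- by rewrite act1 -[lt _]/(Ao_smap c) Ao_rsmapC.
- by have := Ao_eqn (Ao_vr i j d); rewrite !big_cons !big_nil !mulr1.
Qed.

Fact Ao_smap_act (x y : base_grp X) (a : P) b :
  pres_deg x y a -> a * Ao_smap b = Ao_smap (act y b) * a.
Proof.
apply: (@pres_deg_commute _ _ _ _ _ _ Ao_smap (@act K X) snd) => //.
- exact: act1.
- exact: actM.
move=> [[c|c]|[i j]] d /=.
- by rewrite act1 -[lt _]/(Ao_rmap c) Ao_rsmapC.
- rewrite act1 -[lt _]/(Ao_smap c) -!(alg_homM Ao_smap_hom).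
  by rewrite base_comm.
- by have := Ao_eqn (Ao_vs i j d); rewrite !big_cons !big_nil !mulr1.
Qed.

Definition Ao_alg : bgAlg X := @BGAlg K X P (@pres_deg _ _ _ Ao_deg Ao_rels)
  Ao_rmap Ao_smap (pres_grading Ao_deg Ao_rels) (@pres_degM _ _ _ Ao_deg Ao_rels)
  Ao_rmap_hom Ao_smap_hom (fun b => letter_deg Ao_deg Ao_rels (gr b))
  (fun b => letter_deg Ao_deg Ao_rels (gs b)) Ao_rsmapC Ao_rmap_act Ao_smap_act.

Definition Ao_v : 'M[Ao_alg]_n := \matrix_(i, j) lt (gv i j).

Definition Ao_w : 'M[Ao_alg]_n := (map_mx (rmap Ao_alg) (twist ginv F1) *m Ao_v *m
  map_mx (smap Ao_alg) F)^T.

Lemma Ao_v_bideg : bideg g g Ao_v.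
Proof. by move=> i j; rewrite mxE; apply: (letter_deg Ao_deg Ao_rels (gv i j)). Qed.

Lemma Ao_v_rel : Ao_rel g F Q Ao_v Ao_w.
Proof.
split.
- split; apply/matrixP => i j; apply/eqP; rewrite -subr_eq0; apply/eqP.
    by have := eval_letter Ao_deg (Ao_vw i j); rewrite eval_vw.
  by have := eval_letter Ao_deg (Ao_wv i j); rewrite eval_wv.
(* The first relation holds by the definition of [Ao_w], as [twist g F] cancels [twist ginv F1]. *)
- rewrite trmxK !mulmxA -(map_mx_homM (rmap_hom _)).
  have [-> _] := mx_inverse_twist hF FF1.
  by rewrite (map_mx_hom1 (rmap_hom _)) mul1mx.
- apply/matrixP => i j; apply/eqP; rewrite -subr_eq0; apply/eqP.
  by have := eval_letter Ao_deg (Ao_Q i j); rewrite eval_Q.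
Qed.

Section Lift.
Variables (C : bgAlg X) (u w : 'M[C]_n).
Hypotheses (hu : bideg g g u) (uw : Ao_rel g F Q u w).

Definition Ao_phi (l : Ao_letter) : C :=
  match l with
  | inl (inl b) => rmap C b
  | inl (inr b) => smap C b
  | inr p => u p.1 p.2
  end.

Fact Ao_phi_deg l : deg (Ao_deg l).1 (Ao_deg l).2 (Ao_phi l).
Proof.
by case: l => [[b|b]|[i j]]; [apply: rmap_deg|apply: smap_deg|apply: hu].
Qed.

Fact Ao_phi_rel rel : Ao_rels rel -> eval Ao_phi rel = 0.
Proof.
have VE : (\matrix_(i, j) Ao_phi (gv i j)) = u by apply/matrixP => i j; rewrite mxE.
have wE := Ao_rel_inv hF FF1 uw.
case.
- move=> z b c; rewrite /eval !big_cons !big_nil /= !mulr1 (alg_homP (rmap_hom C)).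
  by rewrite addr0 scale1r scaleNr scaleN1r -opprD subrr.
- by rewrite eval_eqn big_seq1 big_nil /= (alg_hom1 (rmap_hom C)) subrr.
- by move=> b c; rewrite eval_eqn !big_cons !big_nil /= (alg_homM (rmap_hom C)) !mulr1 subrr.
- move=> z b c; rewrite /eval !big_cons !big_nil /= !mulr1 (alg_homP (smap_hom C)).
  by rewrite addr0 scale1r scaleNr scaleN1r -opprD subrr.
- by rewrite eval_eqn big_seq1 big_nil /= (alg_hom1 (smap_hom C)) subrr.
- by move=> b c; rewrite eval_eqn !big_cons !big_nil /= (alg_homM (smap_hom C)) !mulr1 subrr.
- by move=> b c; rewrite eval_eqn !big_cons !big_nil /= !mulr1 rsmapC subrr.
- by move=> i j b; rewrite eval_eqn !big_cons !big_nil /= !mulr1 (rmap_act _ (hu i j)) subrr.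
- by move=> i j b; rewrite eval_eqn !big_cons !big_nil /= !mulr1 (smap_act _ (hu i j)) subrr.
- move=> i j; rewrite eval_vw VE; have [[uw1 _] _ _] := uw.
  by rewrite -[(_ *m _)^T](congr1 trmx wE) trmxK uw1 subrr.
- move=> i j; rewrite eval_wv VE; have [[_ wu1] _ _] := uw.
  by rewrite -[(_ *m _)^T](congr1 trmx wE) trmxK wu1 subrr.
- move=> i j; rewrite eval_Q VE; have [_ _ uQ] := uw.
  by apply/eqP; rewrite subr_eq0; apply/eqP; have := congr1 (fun M : 'M[C]_n => M i j) uQ.
Qed.

Lemma Ao_alg_lift : exists f : Ao_alg -> C, is_bg_mor f /\ map_mx f Ao_v = u.
Proof.
exists (@pres_lift _ _ _ _ Ao_deg Ao_rels Ao_phi); split; last first.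
  by apply/matrixP => i j; rewrite !mxE (pres_lift_letter Ao_phi_deg Ao_phi_rel).
split.
- exact: pres_lift_hom Ao_phi_deg Ao_phi_rel.
- exact: pres_lift_deg Ao_phi_deg Ao_phi_rel.
- by move=> b; apply: (pres_lift_letter Ao_phi_deg Ao_phi_rel (gr b)).
- by move=> b; apply: (pres_lift_letter Ao_phi_deg Ao_phi_rel (gs b)).
Qed.

End Lift.

Lemma Ao_alg_ext (C : bgAlg X) (f h : Ao_alg -> C) : is_bg_mor f -> is_bg_mor h ->
  map_mx f Ao_v = map_mx h Ao_v -> f =1 h.
Proof.
move=> [fh _ fr fs] [hh _ hr hs] e; apply: pres_hom_ext => // -[[b|b]|[i j]].
- by rewrite [LHS]fr [RHS]hr.
- by rewrite [LHS]fs [RHS]hs.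
- by have := congr1 (fun M : 'M[C]_n => M i j) e; rewrite !mxE.
Qed.

(* Closure under scalars is automatic, since [z *: x = r(z 1) x]. *)
Lemma Ao_alg_ind (S : Ao_alg -> Prop) :
  (forall x y, S x -> S y -> S (x + y)) ->
  (forall b, S (rmap Ao_alg b)) -> (forall b, S (smap Ao_alg b)) ->
  (forall i j, S (Ao_v i j)) ->
  (forall a b c d x y, deg a b x -> deg c d y -> S x -> S y -> S (x * y)) ->
  forall x, S x.
Proof.
move=> SD Sr Ss Sv SM; have hr := rmap_hom Ao_alg.
apply: pres_ind => // [|z w]; first by rewrite -[0](alg_hom0 hr); apply: Sr.
have S1 : S (pres_in Ao_deg Ao_rels 1 w).
  elim: w => [|l w IHw] //; first by rewrite -[pres_in _ _ _ _](alg_hom1 hr); apply: Sr.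
  rewrite pres_in_cons; have hw := pres_deg_in Ao_rels 1 (erefl (word_deg Ao_deg w)).
  apply: (SM _ _ _ _ _ _ (letter_deg Ao_deg Ao_rels l) hw) => //.
  case: l => [[b|b]|[i j]]; [exact: Sr|exact: Ss|].
  by have := Sv i j; rewrite mxE.
have -> : pres_in Ao_deg Ao_rels z w = rmap Ao_alg (z *: (1 : X)) * pres_in Ao_deg Ao_rels 1 w.
  by rewrite (alg_homZ hr) (alg_hom1 hr) -algZl mul1r pres_inZ mulr1.
apply: (SM _ _ _ _ _ _ (rmap_deg Ao_alg _)
  (pres_deg_in Ao_rels 1 (erefl (word_deg Ao_deg w)))) => //.
Qed.

End AoPresentation.

(** * Opposite algebras *)

Section ConjugateAlgebra.
Variables (K : numClosedFieldType) (A : alg K).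

Definition conj_scale (z : K) (x : alg_ring A) : alg_ring A := alg_scale z^* x.

Fact conj_scaleA a b v : conj_scale a (conj_scale b v) = conj_scale (a * b) v.
Proof. by rewrite /conj_scale alg_scaleA -rmorphM. Qed.
Fact conj_scale1 : left_id 1 conj_scale.
Proof. by move=> v; rewrite /conj_scale rmorph1 alg_scale1. Qed.
Fact conj_scaleDr : right_distributive conj_scale +%R.
Proof. by move=> z v w; rewrite /conj_scale alg_scaleDr. Qed.
Fact conj_scaleDl v : {morph conj_scale^~ v : a b / a + b}.
Proof. by move=> a b; rewrite /conj_scale rmorphD alg_scaleDl. Qed.
Fact conj_scaleAl z x y : conj_scale z (x * y) = conj_scale z x * y.
Proof. exact: alg_scaleAl. Qed.
Fact conj_scaleAr z x y : conj_scale z (x * y) = x * conj_scale z y.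
Proof. exact: alg_scaleAr. Qed.

Definition conj_alg : alg K := @Alg K (alg_ring A) conj_scale
  conj_scaleA conj_scale1 conj_scaleDr conj_scaleDl conj_scaleAl conj_scaleAr.

End ConjugateAlgebra.

(* An involution of [A] is the same as a morphism from [A] to its conjugate
   opposite, in which all the structure maps are composed with the involution. *)
Section ConjugateOpposite.
Variables (K : numClosedFieldType) (X : base K) (A : bgAlg X).
Local Notation G := (base_grp X).

Definition conj_op_alg : alg K := conj_alg (op_alg A).
Definition conj_op_deg (g h : G) : set conj_op_alg := @deg K X A g^-1%g h^-1%g.
Definition conj_op_rmap (b : X) : conj_op_alg := rmap A (base_star b).
Definition conj_op_smap (b : X) : conj_op_alg := smap A (base_star b).

Fact conj_op_grading : is_grading (fun p : G * G => conj_op_deg p.1 p.2).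
Proof.
have [W0 WD sp ind] := deg_grading A.
pose k (p : G * G) := (p.1^-1, p.2^-1)%g.
have kK : involutive k by move=> [g h]; rewrite /k /= !invgK.
split=> [i|i z x y|x|s f us hf s0 p sp0].
- exact: (W0 (k i)).
- exact: (WD (k i)).
- have [s [f [us hf ->]]] := sp x; exists (map k s), (f \o k); split.
  + by rewrite map_inj_uniq //; apply: inv_inj.
  + by move=> i; apply: (hf (k i)).
  + by rewrite big_map; apply: eq_bigr => i _; rewrite /= kK.
- rewrite -[p]kK; apply: (ind (map k s) (f \o k)) => [|j||].
  + by rewrite map_inj_uniq //; apply: inv_inj.
  + by have := hf (k j); rewrite /conj_op_deg /= !invgK.
  + by rewrite big_map -[RHS]s0; apply: eq_bigr => j _; rewrite /= kK.
  + by rewrite map_f.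
Qed.

Fact conj_op_degM g h g' h' x y : conj_op_deg g h x -> conj_op_deg g' h' y ->
  conj_op_deg (g * g')%g (h * h')%g (x * y).
Proof. by move=> hx hy; rewrite /conj_op_deg !invgM; apply: (degM hy hx). Qed.

Fact conj_op_rmap_hom : is_alg_hom conj_op_rmap.
Proof.
have h := rmap_hom A; have [sD sZ sM sK] := base_starP X; split=> [z b c|].
  by rewrite /conj_op_rmap sD sZ (alg_homP h).
split=> [|b c]; rewrite /conj_op_rmap ?base_star1; first exact: (alg_hom1 h).
by rewrite sM (alg_homM h).
Qed.

Fact conj_op_smap_hom : is_alg_hom conj_op_smap.
Proof.
have h := smap_hom A; have [sD sZ sM sK] := base_starP X; split=> [z b c|].
  by rewrite /conj_op_smap sD sZ (alg_homP h).
split=> [|b c]; rewrite /conj_op_smap ?base_star1; first exact: (alg_hom1 h).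
by rewrite sM (alg_homM h).
Qed.

Fact conj_op_rmap_deg b : conj_op_deg 1%g 1%g (conj_op_rmap b).
Proof. by rewrite /conj_op_deg invg1; apply: rmap_deg. Qed.
Fact conj_op_smap_deg b : conj_op_deg 1%g 1%g (conj_op_smap b).
Proof. by rewrite /conj_op_deg invg1; apply: smap_deg. Qed.
Fact conj_op_rsmapC b c :
  conj_op_rmap b * conj_op_smap c = conj_op_smap c * conj_op_rmap b.
Proof. exact: (esym (rsmapC A (base_star b) (base_star c))). Qed.
Fact conj_op_rmap_act g h a b : conj_op_deg g h a ->
  a * conj_op_rmap b = conj_op_rmap (act g b) * a.
Proof.
move=> ha; transitivity ((rmap A (base_star b) : A) * (a : A)) => //.
transitivity ((a : A) * rmap A (base_star (act g b))) => //.
by rewrite (rmap_act _ ha) -act_star -actM mulVg act1.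
Qed.
Fact conj_op_smap_act g h a b : conj_op_deg g h a ->
  a * conj_op_smap b = conj_op_smap (act h b) * a.
Proof.
move=> ha; transitivity ((smap A (base_star b) : A) * (a : A)) => //.
transitivity ((a : A) * smap A (base_star (act h b))) => //.
by rewrite (smap_act _ ha) -act_star -actM mulVg act1.
Qed.

Definition conj_op : bgAlg X := @BGAlg K X conj_op_alg conj_op_deg conj_op_rmap
  conj_op_smap conj_op_grading conj_op_degM conj_op_rmap_hom conj_op_smap_hom
  conj_op_rmap_deg conj_op_smap_deg conj_op_rsmapC conj_op_rmap_act conj_op_smap_act.

End ConjugateOpposite.

Section OppositeMatrices.
Variables (K : numClosedFieldType) (X : base K) (A : bgAlg X) (n : nat).
Implicit Types (a b c : 'I_n -> base_grp X) (P : 'M[X]_n) (M : 'M[A]_n).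
Local Notation inv a := (fun i => (a i)^-1%g).
Local Notation conjB := (@conj_mx n X (@base_star K X)).
Local Notation rM := (map_mx (rmap A)).
Local Notation sM := (map_mx (smap A)).

(** Over the opposite algebra [M *m N] is the transpose of [N^T *m M^T] over [A], so invertibility
    there concerns the transposes over [A]. *)
Lemma coop_inverse (M N : 'M[coop A]_n) :
  mx_inverse ((N : 'M[A]_n)^T) ((M : 'M[A]_n)^T) -> mx_inverse M N.
Proof.
move=> [NM MN]; split; apply: trmx_inj.
  by rewrite [M *m N]mulmx_op trmxK NM; apply/matrixP => i j; rewrite !mxE eq_sym.
by rewrite [N *m M]mulmx_op trmxK MN; apply/matrixP => i j; rewrite !mxE eq_sym.
Qed.

Lemma conj_op_inverse (M N : 'M[conj_op A]_n) :
  mx_inverse ((N : 'M[A]_n)^T) ((M : 'M[A]_n)^T) -> mx_inverse M N.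
Proof.
move=> [NM MN]; split; apply: trmx_inj.
  by rewrite [M *m N]mulmx_op trmxK NM; apply/matrixP => i j; rewrite !mxE eq_sym.
by rewrite [N *m M]mulmx_op trmxK MN; apply/matrixP => i j; rewrite !mxE eq_sym.
Qed.

(** In the co-opposite, left multiplication by [r] is right multiplication by [s] in [A]. Returning
    the coefficients to the left of the entries of [M] twists them by the column degrees of
    [M^T]. *)
Lemma coop_mul_rmap a b P M : bideg a b M^T ->
  map_mx (rmap (coop A)) P *m (M : 'M[coop A]_n) = sM (twist b P^T)^T *m M.
Proof.
move=> hM; rewrite [LHS](@mulmx_op _ A) -[in RHS](trmxK M) -(trmx_mul_smap _ hM).
by rewrite map_trmx.
Qed.

Lemma coop_mul_smap a b P M : bideg a b M^T ->
  (M : 'M[coop A]_n) *m map_mx (smap (coop A)) (twist a P) = M *m rM P.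
Proof.
move=> hM; rewrite [LHS](@mulmx_op _ A) map_trmx.
by rewrite -[in RHS](trmxK M) (trmx_mul_rmap _ hM).
Qed.

Lemma conj_op_rmapE P : map_mx (rmap (conj_op A)) P = rM (conjB P).
Proof. by apply/matrixP => i j; rewrite !mxE. Qed.

Lemma conj_op_smapE P : map_mx (smap (conj_op A)) P = sM (conjB P).
Proof. by apply/matrixP => i j; rewrite !mxE. Qed.

Lemma conj_op_mul_rmap a b c P M : supp b a P -> bideg a c M ->
  map_mx (rmap (conj_op A)) P *m (M : 'M[conj_op A]_n) = rM (twist b (conjB P)) *m M.
Proof.
move=> hP hM; rewrite conj_op_rmapE [LHS](@mulmx_op _ A) map_trmx.
rewrite (trmx_mul_rmap _ hM) trmxK (@twist_tr _ _ _ a b) ?trmxK //.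
exact/supp_tr/supp_conj.
Qed.

Lemma conj_op_mul_smap a b P M : bideg a b M ->
  (M : 'M[conj_op A]_n) *m map_mx (smap (conj_op A)) P =
    M *m sM (twist (inv b) (conjB P)).
Proof.
move=> hM; rewrite conj_op_smapE [LHS](@mulmx_op _ A) map_trmx.
apply: trmx_inj; rewrite trmxK (trmx_mul_smap _ hM) twistVK.
by rewrite map_trmx.
Qed.

End OppositeMatrices.

(** * The four matrices satisfying the defining relations *)

Lemma mx_inverse_sym (R : pzRingType) n (M N : 'M[R]_n) :
  mx_inverse M N -> mx_inverse N M.
Proof. by case. Qed.

Lemma mx_inverse_mul (R : pzRingType) n (M M' N N' : 'M[R]_n) :
  mx_inverse M M' -> mx_inverse N N' -> mx_inverse (M *m N) (N' *m M').
Proof.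
move=> [h1 h2] [h3 h4]; split; rewrite mulmxA.
  by rewrite -(mulmxA M) h3 mulmx1 h1.
by rewrite -(mulmxA N') h2 mulmx1 h4.
Qed.

Section AoMatrices.
Variables (K : numClosedFieldType) (X : base K) (n : nat) (g : 'I_n -> base_grp X).
Local Notation ginv := (fun i => (g i)^-1%g).
Local Notation conjB := (@conj_mx n X (@base_star K X)).
Variables (F F1 G G1 : 'M[X]_n).
Hypotheses (hF : supp g ginv F) (FF1 : mx_inverse F F1).
Hypotheses (hG : supp g ginv G) (GG1 : mx_inverse G G1).
Hypothesis hFG : conjB F *m G^T = conjB G *m F^T.
Local Notation Q := (Qmx g G).


Let hF1 : supp ginv g F1 := supp_mx_inverse hF FF1.
Let hG1 : supp ginv g G1 := supp_mx_inverse hG GG1.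

Lemma twist_inv_tr P : supp g ginv P -> twist g (twist g P)^T = P^T.
Proof. by move=> hP; rewrite (twist_tr hP) twistVK. Qed.

Lemma twist_Qmx : twist g Q = twist g G *m conjB G.
Proof.
by rewrite QmxE // (twist_mul _ hG) -twist_conj twistK.
Qed.

Lemma bideg_cross_nabla : bideg g g (nabla g : 'M[cross X]_n).
Proof.
move=> i j; rewrite nablaE; case: eqP => [->|_]; last exact: deg0.
by exists 1; rewrite eqxx.
Qed.

(** Written with [nabla] instead of [twist], both relations reduce to cancelling [nabla] against
    [nablaV], the latter being diagonal and hence its own transpose. *)
Lemma Ao_rel_cross : Ao_rel g F Q (nabla g : 'M[cross X]_n) (nablaV g).
Proof.
have [nV Vn] := nablaK g; split; first exact: nablaK.
- rewrite -[map_mx _ (twist g F)](nabla_supp hF) tr_diag_mx -/(nablaV g).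
  by rewrite -mulmxA nV mulmx1.
- rewrite -[map_mx _ (twist g Q)](nablaV_supp (supp_Qmx hG)) -mulmxA.
  by rewrite Vn mulmx1.
Qed.

Section WithA.
Variables (A : bgAlg X) (v w : 'M[A]_n).
Hypotheses (hv : bideg g g v) (vw : Ao_rel g F Q v w).
Local Notation rM := (map_mx (rmap A)).
Local Notation sM := (map_mx (smap A)).

Let hw : bideg ginv ginv w^T := Ao_rel_bideg hF FF1 hv vw.

Lemma bideg_fibmx_v : bideg g g (fibmx v v).
Proof. exact: bideg_fibmx hv hv. Qed.

(** Each relation is used once in either leg: applied in the first, it leaves a coefficient in [s],
    which crosses the tensor sign as the twisted coefficient in [r] with which the relation starts
    in the second. *)
Lemma Ao_rel_fibmx : Ao_rel g F Q (fibmx v v) (fibmx w^T w^T)^T.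
Proof.
have [v1 r1 r2] := vw; split.
- by apply: fibmx_inverse hv hv hw hw _ _; rewrite trmxK.
- rewrite trmxK (fibmx_rmap (supp_twist g hF) hw hw) r1.
  by rewrite (fibmx_balance hF hv hw) r1 (fibmx_smap hF hv hv).
- rewrite (fibmx_rmap (supp_twist g (supp_Qmx hG)) hv hv) r2.
  by rewrite (fibmx_balance (supp_Qmx hG) hv hv) r2 (fibmx_smap (supp_Qmx hG) hv hv).
Qed.

Lemma bideg_coop_w : bideg g g (w : 'M[coop A]_n).
Proof. by move=> i j; have := hw j i; rewrite mxE. Qed.

(* the square of the antipode, applied to [v] *)
Definition Ao_w2 : 'M[A]_n := rM F^T *m w^T *m sM (twist g F1^T).

Let hFw : bideg g ginv (rM F^T *m w^T) := bideg_rmap (supp_invl (supp_tr hF)) hw.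

Lemma tr_Ao_w2 : Ao_w2^T = sM F1 *m w *m rM (twist g F).
Proof.
rewrite -(mulmxA _ w) -[in RHS](trmxK w) (trmx_mul_rmap _ hw) twistK.
by rewrite (trmx_mul_smap _ hFw) twistK trmxK.
Qed.

Lemma bideg_Ao_w2 : bideg g g Ao_w2.
Proof. by apply: bideg_smap hFw; apply/supp_twist/supp_invr/supp_tr. Qed.

Lemma Ao_rel_coop : Ao_rel g F Q (w : 'M[coop A]_n) Ao_w2.
Proof.
have [v1 r1 r2] := vw; have hr := rmap_hom A; have hs := smap_hom A.
split.
(* By the first relation [w^T] is a product of three invertible matrices, and [Ao_w2^T] is the
   product of their inverses in reverse order. *)
- apply: coop_inverse; rewrite tr_Ao_w2 (Ao_rel_inv hF FF1 vw) -(mulmxA _ v).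
  apply: mx_inverse_mul; last exact/(mx_inverse_hom hr)/mx_inverse_twist.
  apply: mx_inverse_mul; last exact: mx_inverse_sym.
  exact/(mx_inverse_hom hs)/mx_inverse_sym.
- rewrite (coop_mul_rmap (M := Ao_w2^T) _ (a := g) (b := g)); last first.
    by rewrite trmxK; apply: bideg_Ao_w2.
  rewrite twist_inv_tr // trmxK tr_Ao_w2 !mulmxA -(map_mx_homM hs).
  have [-> _] := FF1; rewrite (map_mx_hom1 hs) mul1mx.
  by rewrite -[in RHS](twistK g F) (coop_mul_smap _ hw).
- rewrite (coop_mul_rmap _ hw) (twist_tr (supp_Qmx hG)) twistK trmxK.
  rewrite -[X in map_mx (smap (coop A)) X](twistK g Q) (coop_mul_smap _ hw).
  have [vw1 wv1] := v1.
  (* What remains is the second relation for [v], multiplied by [w] on both sides. *)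
  by rewrite -[sM Q]mul1mx -wv1 -(mulmxA w) -r2 -!mulmxA vw1 mulmx1.
Qed.

(* the involution applied to [v] *)
Definition Ao_star_v : 'M[A]_n := rM (twist ginv G1) *m (v *m sM G).

Lemma bideg_Ao_star_v : bideg ginv ginv Ao_star_v.
Proof.
by apply: bideg_rmap (bideg_smap hG hv); apply: supp_twist.
Qed.

(** The transpose of [v^-1] need not invert [v^T]. Transposing the first relation gives
    [s((twist g F)^T) v^T = w r(F^T)], so [v^T] is invertible because [w] is. *)
Lemma tr_v_inverse : mx_inverse v^T (rM F1^T *m v *m sM (twist g F)^T).
Proof.
have hr := rmap_hom A; have hs := smap_hom A; have [v1 r1 _] := vw.
have e : sM (twist g F)^T *m v^T = w *m rM F^T.
  rewrite -(trmx_mul_smap _ hv) -r1 -[w in RHS]trmxK (trmx_mul_rmap _ hw).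
  by rewrite (twist_tr (a := ginv) (b := g)) ?trmxK //; apply: supp_tr.
have FtF := mx_inverse_hom hs (mx_inverse_tr (mx_inverse_twist hF FF1)).
have vE : v^T = sM (twist ginv F1)^T *m (w *m rM F^T).
  by rewrite -e mulmxA; case: FtF => _ ->; rewrite mul1mx.
rewrite vE; apply: mx_inverse_mul; first exact: mx_inverse_sym.
apply: mx_inverse_mul; first exact: mx_inverse_sym.
exact/(mx_inverse_hom hr)/mx_inverse_tr.
Qed.

(** Its transpose is the inverse over [A] of the three factors of [Ao_star_v^T] in [tr_Ao_star_v],
    as an inverse over the conjugate opposite has to be. *)
Definition Ao_star_w : 'M[A]_n :=
  (rM G^T *m (rM F1^T *m v *m sM (twist g F)^T) *m sM (twist ginv G1)^T)^T.

Lemma Ao_star_wE : Ao_star_w = (rM (G^T *m F1^T) *m v *m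
  sM ((twist g F)^T *m (twist ginv G1)^T))^T.
Proof.
by rewrite /Ao_star_w (map_mx_homM (rmap_hom A)) (map_mx_homM (smap_hom A)) !mulmxA.
Qed.

Lemma bideg_tr_Ao_star_w : bideg g g Ao_star_w^T.
Proof.
rewrite Ao_star_wE trmxK; apply: (@bideg_smap _ _ _ _ g g g).
  apply: (supp_mul (b := ginv)); first exact/supp_invl/supp_tr/supp_twist.
  exact/supp_invr/supp_tr/supp_twist.
apply: (@bideg_rmap _ _ _ _ g g g) => //.
apply: (supp_mul (b := ginv)); last exact/supp_invr/supp_tr.
exact/supp_invl/supp_tr.
Qed.

Lemma tr_Ao_star_v : Ao_star_v^T = sM (twist g G)^T *m v^T *m rM G1^T.
Proof.
rewrite -(trmx_mul_smap _ hv) (trmx_mul_rmap _ (bideg_smap hG hv)).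
by rewrite (twist_tr (a := g) (b := ginv)) ?trmxK //; apply/supp_tr.
Qed.

(* The only place where [G F^* = F G^*] matters: the first relation for
   [Ao_star_v] in the conjugate opposite of [A] reduces to this identity over [B]. *)
Lemma Ao_star_key : Q *m (twist g F)^T *m (twist ginv G1)^T = G *m twist g (conjB F).
Proof.
have e : twist g (conjB G) *m (twist g F)^T = twist g (conjB F) *m (twist g G)^T.
  rewrite (twist_tr hF) (twist_tr hG); have cG := supp_conj hG; have cF := supp_conj hF.
  by rewrite -(twist_mul _ cG) -(twist_mul _ cF) hFG.
rewrite QmxE // -!mulmxA; congr (_ *m _); rewrite mulmxA -twist_conj e -mulmxA.
have [GG _] := mx_inverse_tr (mx_inverse_twist hG GG1).
by rewrite GG mulmx1.
Qed.

(** The second relation after cancelling the factor [twist g G] of [twist g Q]. In this form it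
    serves both the relations for [Ao_star_v] and involutivity. *)
Lemma rmap_conj_v : rM (conjB G) *m v = rM (twist ginv G1) *m v *m sM Q.
Proof.
have [_ _ r2] := vw; rewrite -mulmxA -r2 twist_Qmx (map_mx_homM (rmap_hom A)).
rewrite !mulmxA -(map_mx_homM (rmap_hom A)).
have [_ ->] := mx_inverse_twist hG GG1.
by rewrite (map_mx_hom1 (rmap_hom A)) mul1mx.
Qed.

Lemma Ao_rel_conj_op : Ao_rel g F Q (Ao_star_v : 'M[conj_op A]_n) Ao_star_w.
Proof.
have hr := rmap_hom A; have hs := smap_hom A.
have hv' := bideg_Ao_star_v; have hw' := bideg_tr_Ao_star_w.
split.
- apply: conj_op_inverse; rewrite trmxK tr_Ao_star_v -(mulmxA _ v^T).
  apply: mx_inverse_mul; last first.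
    exact/(mx_inverse_hom hs)/mx_inverse_sym/mx_inverse_tr/mx_inverse_twist.
  apply: mx_inverse_mul; last exact/mx_inverse_sym/tr_v_inverse.
  exact/(mx_inverse_hom hr)/mx_inverse_tr.
- have hF' : supp ginv g (twist g F) by apply/supp_invr/supp_twist.
  rewrite (conj_op_mul_rmap hF' hw') (conj_op_mul_smap _ hv') twist_invK.
  (* By [hFG] the coefficients to the left of [v] collapse to [conj G], so that [rmap_conj_v]
     applies; a comparison of the coefficients in [s] is left. *)
  rewrite -twist_conj twistK Ao_star_wE trmxK !mulmxA -(map_mx_homM hr) mulmxA hFG.
  have [FF _] := mx_inverse_tr FF1; rewrite -(mulmxA _ F^T) FF mulmx1 rmap_conj_v.
  by rewrite -[LHS]mulmxA -(map_mx_homM hs) mulmxA Ao_star_key (map_mx_homM hs)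
    /Ao_star_v !mulmxA.
- have hQ : supp ginv ginv (twist g Q) by apply/supp_inv/supp_twist/supp_Qmx.
  rewrite (conj_op_mul_rmap hQ hv') (conj_op_mul_smap _ hv') twist_invK.
  rewrite -twist_conj twistK twist_conj twist_Qmx conjBM conjBK.
  rewrite {1}QmxE // conjBM conjBK.
  (* Both sides become [r(twist ginv G1) v s(Q G)]. *)
  rewrite /Ao_star_v !mulmxA -(map_mx_homM hr) -(mulmxA _ _ (twist ginv G1)).
  have [GG _] := mx_inverse_twist hG GG1; rewrite GG mulmx1 rmap_conj_v.
  by rewrite QmxE // !(map_mx_homM hs) !mulmxA.
Qed.

End WithA.
End AoMatrices.

(** * Coproduct, counit and antipode *)

Section FiberMap.
Variables (K : numClosedFieldType) (X : base K).

Lemma is_bg_mor_additive (A C : bgAlg X) (f : A -> C) : is_bg_mor f ->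
  {morph f : x y / x + y}.
Proof. by move=> [fh _ _ _] x y; apply: alg_homD fh _ _. Qed.

Lemma composable_mor (A C A' C' : bgAlg X) (f : A -> A') (h : C -> C') (p : A * C) :
  is_bg_mor f -> is_bg_mor h -> composable p -> composable (f p.1, h p.2).
Proof.
by move=> [_ fd _ _] [_ hd _ _] [x [y [z [/fd h1 /hd h2]]]]; exists x, y, z.
Qed.

Lemma composableM (A C : bgAlg X) (p r : A * C) : composable p -> composable r ->
  composable (p.1 * r.1, p.2 * r.2).
Proof.
move=> [x [y [z [h1 h2]]]] [x' [y' [z' [h1' h2']]]].
by exists (x * x')%g, (y * y')%g, (z * z')%g; split; apply: degM.
Qed.

Lemma gtens_tens_in (A C : bgAlg X) (p : A * C) :
  composable p -> tens_in p.1 p.2 \in gtens_pred (A:=A) (C:=C).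
Proof. by case: p => a c; apply: composable_gtens. Qed.

Lemma fib_map (A C A' C' : bgAlg X) (f : A -> A') (h : C -> C') :
  is_bg_mor f -> is_bg_mor h ->
  exists F : fib A C -> fib A' C',
  [/\ {morph F : x y / x + y}, {morph F : x y / x * y}
    & forall p, composable p -> F (fib_in p.1 p.2) = fib_in (f p.1) (h p.2)].
Proof.
move=> fm hm; have [fh _ fr fs] := fm; have [hh _ hr hs] := hm.
have [|||p hp|b p hp|F [FD FE]] := @fib_lift _ _ A C (tens A' C') (fib A' C')
  (fun p => tens_in (f p.1) (h p.2)) (gtens_pred (A:=A') (C:=C')) (@fib_class _ _ A' C').
- split=> [a b c|a c d|z a c] /=.
  + by rewrite (alg_homD fh) tens_inDl.
  + by rewrite (alg_homD hh) tens_inDr.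
  + by rewrite (alg_homZ fh) (alg_homZ hh) tens_inZl tens_inZr.
- exact: gtens_zmod_closed.
- by move=> x y hx hy; apply: fib_classD.
- exact: (@gtens_tens_in A' C' (_, _) (composable_mor fm hm hp)).
- rewrite /= (alg_homM fh) fs (alg_homM hh) hr.
  exact: (fib_in_balance b (composable_mor fm hm hp)).
exists F; split=> //.
apply: (fib_additive_mul FD FE) => p r hp hr'.
rewrite /= (alg_homM fh) (alg_homM hh).
by apply/esym; apply: (@fib_inM _ _ A' C'); apply: composable_mor.
Qed.

End FiberMap.

(** * Universal property, induction on generators and the Hopf axioms *)

Section Universal.
Variables (K : numClosedFieldType) (X : base K) (n : nat) (g : 'I_n -> base_grp X).
Local Notation ginv := (fun i => (g i)^-1%g).
Variables (F F1 G : 'M[X]_n).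
Hypotheses (hF : supp g ginv F) (FF1 : mx_inverse F F1) (hG : supp g ginv G).
Local Notation Q := (Qmx g G).

Lemma Ao_alg_is_Ao : is_Ao g F G (Ao_v g F F1 Q).
Proof.
split=> [|C u /(Ao_matrixE _ hF hG) [hu [w uw]]].
  apply/(Ao_matrixE _ hF hG); split; first exact: Ao_v_bideg.
  by exists (Ao_w g F F1 Q); apply: Ao_v_rel.
have [f [fm fv]] := Ao_alg_lift hF FF1 hu uw.
exists f; split=> // h [hm hv]; apply/funext.
by apply: Ao_alg_ext fm hm _; rewrite fv hv.
Qed.

Variables (A : bgAlg X) (v : 'M[A]_n).
Hypothesis univ : is_Ao g F G v.

Lemma Ao_bideg : bideg g g v.
Proof. by case: univ => /(Ao_matrixE _ hF hG) []. Qed.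

Lemma Ao_inverse : exists w, Ao_rel g F Q v w.
Proof. by case: univ => /(Ao_matrixE _ hF hG) []. Qed.

Lemma Ao_lift (C : bgAlg X) (u w : 'M[C]_n) : bideg g g u -> Ao_rel g F Q u w ->
  exists f : A -> C, is_bg_mor f /\ map_mx f v = u.
Proof.
move=> hu uw; case: univ => _ /(_ C u) [|f [fP _]]; last by exists f.
by apply/(Ao_matrixE _ hF hG); split=> //; exists w.
Qed.

Lemma Ao_ext (C : bgAlg X) (f h : A -> C) : is_bg_mor f -> is_bg_mor h ->
  map_mx f v = map_mx h v -> f = h.
Proof.
move=> fm hm e; case: univ => _ /(_ C (map_mx f v)) [|k [_ ku]].
  apply/(Ao_matrixE _ hF hG); split; first exact: is_bg_mor_bideg fm Ao_bideg.
  by have [w vw] := Ao_inverse; exists (map_mx f w); apply: Ao_rel_mor.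
by rewrite -(ku f) // -(ku h).
Qed.

(** Only the presented algebra is visibly generated by letters. An arbitrary universal [A] is a
    retract of it, the composite [h \o f] fixing [v], and inherits the induction principle through
    [h]. *)
Lemma Ao_ind (S : A -> Prop) :
  (forall x y, S x -> S y -> S (x + y)) ->
  (forall b, S (rmap A b)) -> (forall b, S (smap A b)) ->
  (forall i j, S (v i j)) ->
  (forall a b c d x y, deg a b x -> deg c d y -> S x -> S y -> S (x * y)) ->
  forall x, S x.
Proof.
move=> SD Sr Ss Sv SM x; have [w vw] := Ao_inverse.
have [f [fm fv]] := Ao_lift (@Ao_v_bideg _ _ _ _ _ _ _) (Ao_v_rel Q hF FF1).
have [h [hm hv]] := Ao_alg_lift hF FF1 Ao_bideg vw.
have hf : h \o f = id.
  apply: Ao_ext; [exact: is_bg_mor_comp fm hm|exact: is_bg_mor_id|].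
  by rewrite map_mx_comp fv hv; apply/matrixP => i j; rewrite mxE.
rewrite -[x]/(id x) -hf /=; move: (f x) => {x f fm fv hf}.
have [hh hd hr hs] := hm.
apply: Ao_alg_ind => [x y Sx Sy|b|b|i j|a b c d x y dx dy Sx Sy].
- by rewrite (alg_homD hh); apply: SD.
- by rewrite hr; apply: Sr.
- by rewrite hs; apply: Ss.
- by have := Sv i j; rewrite -hv mxE.
- by rewrite (alg_homM hh); apply: SM Sx Sy; apply: hd; eassumption.
Qed.

Section Coproduct.
Variables (Delta : A -> fib A A).
Hypotheses (Dm : is_bg_mor Delta) (Dv : map_mx Delta v = fibmx v v).

Lemma Delta_v i j : Delta (v i j) = \sum_k (fib_in (v i k) (v k j) : fib A A).
Proof. by have := congr1 (fun M : 'M[fib A A]_n => M i j) Dv; rewrite !mxE. Qed.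

Let DD := is_bg_mor_additive Dm.
Let Dr b : Delta (rmap A b) = fib_in (rmap A b) 1.
Proof. by have [_ _ -> _] := Dm. Qed.
Let Ds b : Delta (smap A b) = fib_in 1 (smap A b).
Proof. by have [_ _ _ ->] := Dm. Qed.
Let DM x y : Delta (x * y) = Delta x * Delta y.
Proof. by have [h _ _ _] := Dm; apply: alg_homM. Qed.
Let D1 : Delta 1 = 1.
Proof. by have [h _ _ _] := Dm; apply: alg_hom1. Qed.

Let cvv i k j : composable (v i k, v k j).
Proof. exact: composable_deg (Ao_bideg i k) (Ao_bideg k j). Qed.

Lemma fib_assocD (u u' : fib (fib A A) A) (w w' : fib A (fib A A)) :
  fib_assoc u w -> fib_assoc u' w' -> fib_assoc (u + u') (w + w').
Proof.
move=> [t [ht -> ->]] [t' [ht' -> ->]]; exists (t ++ t'); rewrite !big_cat; split=> // q.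
by rewrite mem_cat => /orP[/ht|/ht'].
Qed.

Lemma fib_assocM (u u' : fib (fib A A) A) (w w' : fib A (fib A A)) :
  fib_assoc u w -> fib_assoc u' w' -> fib_assoc (u * u') (w * w').
Proof.
move=> [t [ht -> ->]] [t' [ht' -> ->]].
exists [seq (p.1.1 * q.1.1, p.1.2 * q.1.2, p.2 * q.2) | p <- t, q <- t']; split.
- move=> _ /allpairsP[[p q] [/ht hp /ht' hq ->]] /=.
  have [a [b [c [d [h1 h2 h3]]]]] := hp; have [a' [b' [c' [d' [h1' h2' h3']]]]] := hq.
  by exists (a * a')%g, (b * b')%g, (c * c')%g, (d * d')%g; split; apply: degM.
- rewrite big_allpairs_dep /= mulr_suml; apply: eq_big_seq => p /ht hp.
  rewrite mulr_sumr; apply: eq_big_seq => q /ht' hq /=.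
  have [a [b [c [d [h1 h2 h3]]]]] := hp; have [a' [b' [c' [d' [h1' h2' h3']]]]] := hq.
  rewrite [LHS]fib_inM ?[X in fib_in X _]fib_inM //.
  + exact: composable_deg h1 h2.
  + exact: composable_deg h1' h2'.
  + exact: composable_deg (fib_deg_in h1 h2) h3.
  + exact: composable_deg (fib_deg_in h1' h2') h3'.
- rewrite big_allpairs_dep /= mulr_suml; apply: eq_big_seq => p /ht hp.
  rewrite mulr_sumr; apply: eq_big_seq => q /ht' hq /=.
  have [a [b [c [d [h1 h2 h3]]]]] := hp; have [a' [b' [c' [d' [h1' h2' h3']]]]] := hq.
  rewrite [LHS]fib_inM ?[X in fib_in _ X]fib_inM //.
  + exact: composable_deg h2 h3.
  + exact: composable_deg h2' h3'.
  + exact: composable_deg h1 (fib_deg_in h2 h3).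
  + exact: composable_deg h1' (fib_deg_in h2' h3').
Qed.

Lemma fib_assoc_in a b c d (x y z : A) : deg a b x -> deg b c y -> deg c d z ->
  fib_assoc (fib_in (fib_in x y : fib A A) z) (fib_in x (fib_in y z : fib A A)).
Proof.
move=> hx hy hz; exists [:: (x, y, z)]; rewrite !big_seq1; split=> // q.
by rewrite inE => /eqP ->; exists a, b, c, d.
Qed.

Lemma fib_assoc_sum (I : Type) (r : seq I) (U : I -> fib (fib A A) A)
    (W : I -> fib A (fib A A)) :
  (forall i, fib_assoc (U i) (W i)) -> fib_assoc (\sum_(i <- r) U i) (\sum_(i <- r) W i).
Proof.
move=> h; elim/big_ind2: _ => // [|u w u' w']; last exact: fib_assocD.
by exists [::]; rewrite !big_nil.
Qed.

(** Associativity of the fiber product is given as a relation, so the induction shows that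
    [P1 (Delta x)] and [P2 (Delta x)] are related, using its closure under sums and products. *)
Lemma Delta_coassociative : coassociative Delta.
Proof.
have [P1 [P1D P1M P1E]] := fib_map Dm (is_bg_mor_id A).
have [P2 [P2D P2M P2E]] := fib_map (is_bg_mor_id A) Dm.
have P10 : P1 0 = 0 by apply: (addIr (P1 0)); rewrite -P1D !add0r.
have P20 : P2 0 = 0 by apply: (addIr (P2 0)); rewrite -P2D !add0r.
suff H x : fib_assoc (P1 (Delta x)) (P2 (Delta x)).
  move=> x s hs; have := H x.
  by rewrite (fib_additive_sweedler P1D P1E hs) (fib_additive_sweedler P2D P2E hs).
elim/Ao_ind: x => [x y hx hy|b|b|i j|a b c d x y _ _ hx hy].
- by rewrite !DD P1D P2D; apply: fib_assocD.
- rewrite !Dr (P1E (_, _)) ?(P2E (_, _)) /=; [|exact: composable_rl..].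
  rewrite Dr D1 -fib_in11; apply: fib_assoc_in (rmap_deg A b) (deg1 A) (deg1 A).
- rewrite !Ds (P1E (_, _)) ?(P2E (_, _)) /=; [|exact: composable_sr..].
  rewrite Ds D1 -fib_in11; apply: fib_assoc_in (deg1 A) (deg1 A) (smap_deg A b).
- have -> : P1 (Delta (v i j)) = \sum_k \sum_l
      (fib_in (fib_in (v i l) (v l k) : fib A A) (v k j) : fib (fib A A) A).
    rewrite Delta_v (big_morph _ P1D P10); apply: eq_bigr => k _.
    rewrite (P1E (_, _)) /= ?Delta_v; last exact: cvv.
    apply: (@fib_in_suml _ _ (fib A A) A (g i) (g k) (g j)); last exact: Ao_bideg.
    by move=> l _; apply: fib_deg_in (Ao_bideg i l) (Ao_bideg l k).
  have -> : P2 (Delta (v i j)) = \sum_k \sum_l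
      (fib_in (v i k) (fib_in (v k l) (v l j) : fib A A) : fib A (fib A A)).
    rewrite Delta_v (big_morph _ P2D P20); apply: eq_bigr => k _.
    rewrite (P2E (_, _)) /= ?Delta_v; last exact: cvv.
    apply: (@fib_in_sumr _ _ A (fib A A) (g i) (g k) (g j)); first exact: Ao_bideg.
    by move=> l _; apply: fib_deg_in (Ao_bideg k l) (Ao_bideg l j).
  rewrite exchange_big; do 2![apply: fib_assoc_sum => ?].
  exact: fib_assoc_in (Ao_bideg _ _) (Ao_bideg _ _) (Ao_bideg _ _).
- by rewrite !DM P1M P2M; apply: fib_assocM.
Qed.

Section Counit.
Variable eps : A -> cross X.
Hypotheses (em : is_bg_mor eps) (ev : map_mx eps v = nabla g).

Lemma eps_v i j : eps (v i j) = if i == j then cross_in 1 (g i) else 0.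
Proof. by rewrite -nablaE -ev mxE. Qed.

Let eD := is_bg_mor_additive em.
Let er b : eps (rmap A b) = cross_in b 1%g.
Proof. by have [_ _ -> _] := em. Qed.
Let es b : eps (smap A b) = cross_in b 1%g.
Proof. by have [_ _ _ ->] := em. Qed.
Let eM x y : eps (x * y) = eps x * eps y.
Proof. by have [h _ _ _] := em; apply: alg_homM. Qed.
Let e1 : eps 1 = cross_in 1 1%g.
Proof. by have [h _ _ _] := em; apply: alg_hom1. Qed.

Lemma eps_homogeneous a b x : deg a b x ->
  eps x = 0 \/ a = b /\ exists c, eps x = cross_in c a.
Proof.
have [_ ed _ _] := em; move=> /ed [c]; case: eqP => [-> ->|_ ->]; last by left.
by right; split=> //; exists c.
Qed.

Lemma span_lift_additive (D : span_data K) (V : zmodType) (f : sp_gen D -> V) :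
  sp_test f -> {morph @span_lift K D V f : x y / x + y} /\ @span_lift K D V f 0 = 0.
Proof. by move=> hf; split; [apply: span_liftD|apply: span_lift0]. Qed.

Lemma rhatD : {morph rhat A : x y / x + y} /\ rhat A 0 = 0.
Proof. by apply: span_lift_additive => c d h; rewrite (alg_homD (rmap_hom A)). Qed.

Lemma shatD : {morph shat A : x y / x + y} /\ shat A 0 = 0.
Proof. by apply: span_lift_additive => c d h; rewrite (alg_homD (smap_hom A)). Qed.

Lemma scheckD : {morph scheck A : x y / x + y} /\ scheck A 0 = 0.
Proof.
apply: span_lift_additive => c d h.
by rewrite (alg_homD (act_hom _)) (alg_homD (smap_hom A)).
Qed.

(** Multiplicativity of [rhat] and [shat] holds only up to a twist by the degree of the left factor.
    Both forms for [rhat] occur, with row degree for the antipode and column degree for the counit;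
    they agree because [eps x] vanishes unless [a = b]. *)
Lemma rhat_shat_eps c d y : deg c d y -> exists u,
  [/\ rhat A (eps y) = rmap A u, shat A (eps y) = smap A u
    & forall a b x, deg a b x ->
        [/\ rhat A (eps x * eps y) = rmap A (act a u) * rhat A (eps x),
            rhat A (eps x * eps y) = rhat A (eps x) * rmap A (act b u)
          & shat A (eps x * eps y) = shat A (eps x) * smap A (act a u)]].
Proof.
have [_ r0] := rhatD; have [_ s0] := shatD.
have hr := rmap_hom A; have hs := smap_hom A.
move=> /eps_homogeneous[->|[_ [u ->]]].
  exists 0; rewrite r0 s0 (alg_hom0 hr) (alg_hom0 hs); split=> // a b x _.
  by rewrite mulr0 !act0 r0 s0 (alg_hom0 hr) (alg_hom0 hs) !mulr0 mul0r.
exists u; rewrite rhatE shatE; split=> // a b x /eps_homogeneous[->|[<- [z ->]]].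
  by rewrite mul0r r0 s0 !mul0r mulr0.
rewrite [X in rhat A X]cross_inM [X in shat A X]cross_inM !rhatE !shatE.
by rewrite -!(alg_homM hr) -(alg_homM hs) [act a u * z]base_comm.
Qed.

Lemma scheck_eps a b x : deg a b x -> exists u, scheck A (eps x) = smap A u /\
  forall c d y, deg c d y ->
    scheck A (eps x * eps y) = smap A (act c^-1%g u) * scheck A (eps y).
Proof.
have [_ c0] := scheckD; have hs := smap_hom A.
have chE w h : scheck A (cross_in w h) = smap A (act h^-1%g w).
  by rewrite -[RHS](scheckE A _ h) cross_inM mul1r mulg1 -actM mulgV act1.
move=> /eps_homogeneous[->|[_ [u ->]]].
  exists 0; rewrite c0 (alg_hom0 hs); split=> // c d y _.
  by rewrite mul0r !act0 c0 (alg_hom0 hs) !mul0r.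
exists (act a^-1%g u); rewrite chE; split=> // c d y /eps_homogeneous[->|[_ [z ->]]].
  by rewrite mulr0 c0 mulr0.
rewrite [X in scheck A X]cross_inM !chE -(alg_homM hs) (alg_homM (act_hom _)).
by rewrite -!actM invgM mulgVK.
Qed.

Lemma rhat_base b x : rhat A (cross_base b * x) = rmap A b * rhat A x.
Proof.
have [rD r0] := rhatD; rewrite (span_sumE x) mulr_sumr !(big_morph _ rD r0) mulr_sumr.
apply: eq_bigr => -[c h] _; rewrite -/(cross_in c h) [X in rhat A X]cross_inM !rhatE act1.
exact: (alg_homM (rmap_hom A)).
Qed.

Lemma shat_base b x : shat A (cross_base b * x) = smap A b * shat A x.
Proof.
have [sD s0] := shatD; rewrite (span_sumE x) mulr_sumr !(big_morph _ sD s0) mulr_sumr.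
apply: eq_bigr => -[c h] _; rewrite -/(cross_in c h) [X in shat A X]cross_inM !shatE act1.
exact: (alg_homM (smap_hom A)).
Qed.

Lemma Delta_counital : counital Delta eps.
Proof.
have [rD r0] := rhatD; have [sD s0] := shatD.
have hr := rmap_hom A; have hs := smap_hom A.
have eZ z x : eps (z *: x) = cross_base (z *: (1 : X)) * eps x.
  by rewrite -[cross_base _]er -eM (alg_homZ hr) (alg_hom1 hr) -algZl mul1r.
have rZ z x : rhat A (eps (z *: x)) = z *: rhat A (eps x).
  by rewrite eZ rhat_base (alg_homZ hr) (alg_hom1 hr) -algZl mul1r.
have sZ z x : shat A (eps (z *: x)) = z *: shat A (eps x).
  by rewrite eZ shat_base (alg_homZ hs) (alg_hom1 hs) -algZl mul1r.
have [|||//|b p hp|P1 [P1D P1E]] := @fib_lift _ _ A A A A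
  (fun p => rhat A (eps p.1) * p.2) predT id.
- split=> [a b c|a c d|z a c] /=; rewrite ?eD ?rD ?rZ ?mulrDl ?mulrDr //.
  by rewrite -algZl algZr.
- by split.
- by [].
- have [x [y [z [h1 _]]]] := hp.
  rewrite /= eM es -/(cross_base b) rhat_base mulrA; congr (_ * _).
  case: (eps_homogeneous h1) => [->|[_ [c ->]]]; first by rewrite r0 mul0r mulr0.
  by rewrite rhatE -!(alg_homM hr) base_comm.
have [|||//|b p hp|P2 [P2D P2E]] := @fib_lift _ _ A A A A
  (fun p => shat A (eps p.2) * p.1) predT id.
- split=> [a b c|a c d|z a c] /=; rewrite ?eD ?sD ?sZ ?mulrDl ?mulrDr //.
  by rewrite -algZl algZr.
- by split.
- by [].
- have [x [y [z [_ h2]]]] := hp.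
  rewrite /= eM er -/(cross_base b) shat_base mulrA; congr (_ * _).
  case: (eps_homogeneous h2) => [->|[_ [c ->]]]; first by rewrite s0 mul0r mulr0.
  by rewrite shatE -!(alg_homM hs) base_comm.
have P10 : P1 0 = 0 by apply: (addIr (P1 0)); rewrite -P1D !add0r.
have P20 : P2 0 = 0 by apply: (addIr (P2 0)); rewrite -P2D !add0r.
(* [rhat] twists by the column degree of [p.1], which is the row degree of [p.2]; moving the
   coefficient through [p.2] undoes the twist. The same happens in [P2M] with the legs exchanged. *)
have P1M : {morph P1 : x y / x * y}.
  apply: (fib_additive_mul P1D P1E) => p q [x [y [z [h1 h2]]]] [x' [y' [z' [h1' _]]]].
  have [u [uE _ uM]] := rhat_shat_eps h1'; have [_ e _] := uM _ _ _ h1.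
  by rewrite /= eM e uE !mulrA -(mulrA _ _ p.2) -(rmap_act _ h2) !mulrA.
have P2M : {morph P2 : x y / x * y}.
  apply: (fib_additive_mul P2D P2E) => p q [x [y [z [h1 h2]]]] [x' [y' [z' [_ h2']]]].
  have [u [_ uE uM]] := rhat_shat_eps h2'; have [_ _ e] := uM _ _ _ h2.
  by rewrite /= eM e uE !mulrA -(mulrA _ _ p.1) -(smap_act _ h1) !mulrA.
suff H x : P1 (Delta x) = x /\ P2 (Delta x) = x.
  move=> x s hsw; have [H1 H2] := H x.
  split; [rewrite -[RHS]H1|rewrite -[RHS]H2].
    exact/esym/(fib_additive_sweedler P1D P1E hsw).
  exact/esym/(fib_additive_sweedler P2D P2E hsw).
elim/Ao_ind: x => [x y [hx hx'] [hy hy']|b|b|i j|a b c d x y _ _ [hx hx'] [hy hy']].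
- by rewrite !DD P1D P2D hx hx' hy hy'.
- rewrite !Dr (P1E (_, _)) ?(P2E (_, _)) /=; [|exact: composable_rl..].
  by rewrite er e1 rhatE shatE (alg_hom1 hs) mulr1 mul1r.
- rewrite !Ds (P1E (_, _)) ?(P2E (_, _)) /=; [|exact: composable_sr..].
  by rewrite es e1 rhatE shatE (alg_hom1 hr) mulr1 mul1r.
- rewrite Delta_v (big_morph _ P1D P10) (big_morph _ P2D P20); split.
    rewrite (bigD1 i) //= [X in _ + X]big1 ?addr0 => [|k /negPf ne].
      by rewrite (P1E (_, _) (cvv _ _ _)) /= eps_v eqxx rhatE (alg_hom1 hr) mul1r.
    by rewrite (P1E (_, _) (cvv _ _ _)) /= eps_v eq_sym ne r0 mul0r.
  rewrite (bigD1 j) //= [X in _ + X]big1 ?addr0 => [|k /negPf ne].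
    by rewrite (P2E (_, _) (cvv _ _ _)) /= eps_v eqxx shatE (alg_hom1 hs) mul1r.
  by rewrite (P2E (_, _) (cvv _ _ _)) /= eps_v ne s0 mul0r.
- by rewrite !DM P1M P2M hx hx' hy hy'.
Qed.

Section Antipode.
Variables (S : A -> coop A) (w : 'M[A]_n).
Hypotheses (Sm : is_bg_mor S) (v_inv : mx_inverse v w).
Hypothesis Sv : forall i j, S (v i j) = w i j.

Let SD : {morph S : x y / x + y} := is_bg_mor_additive Sm.
Let Sr b : S (rmap A b) = smap A b.
Proof. by have [_ _ -> _] := Sm. Qed.
Let Ss b : S (smap A b) = rmap A b.
Proof. by have [_ _ _ ->] := Sm. Qed.
Let SM x y : S (x * y) = (S y : A) * S x.
Proof. by have [h _ _ _] := Sm; apply: (alg_homM h). Qed.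
Let S1 : S 1 = (1 : A).
Proof. by have [h _ _ _] := Sm; apply: (alg_hom1 h). Qed.
Let Sd a b x : deg a b x -> deg b^-1%g a^-1%g (S x : A).
Proof. by have [_ h _ _] := Sm; apply: h. Qed.
Let SZ z x : S (z *: x) = z *: (S x : A).
Proof. by have [h _ _ _] := Sm; apply: (alg_homZ h). Qed.

(** [S] reverses products, so [P1] and [P2] need not be multiplicative. But in
    [S(y_1) S(x_1) x_2 y_2] the inner sum is a base element by induction; pulling it out past
    [S(y_1)] produces exactly the twist of [scheck_eps]. For [P2] the inner sum is the one over
    [y]. *)
Lemma Delta_antipodal : antipodal Delta eps S.
Proof.
have [cD c0] := scheckD; have [rD r0] := rhatD.
have [|||//|b p hp|P1 [P1D P1E]] := @fib_lift _ _ A A A A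
  (fun p => (S p.1 : A) * p.2) predT id.
- split=> [a b c|a c d|z a c] /=; rewrite ?SD ?SZ ?mulrDl ?mulrDr //.
  by rewrite -algZl algZr.
- by split.
- by [].
- by rewrite /= SM Ss mulrA.
have [|||//|b p hp|P2 [P2D P2E]] := @fib_lift _ _ A A A A
  (fun p => p.1 * (S p.2 : A)) predT id.
- split=> [a b c|a c d|z a c] /=; rewrite ?SD ?SZ ?mulrDl ?mulrDr //.
  by rewrite -algZl algZr.
- by split.
- by [].
- have [x [y [z [h1 h2]]]] := hp.
  rewrite /= SM Sr mulrA -mulrA.
  (* The column degrees of [p.1] and [S p.2] are inverse to each other, so [s(b)] commutes with
     their product. *)
  have := smap_act b (degM h1 (Sd h2)).
  by rewrite mulgV act1 => <-.
have P10 : P1 0 = 0 by apply: (addIr (P1 0)); rewrite -P1D !add0r.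
have P20 : P2 0 = 0 by apply: (addIr (P2 0)); rewrite -P2D !add0r.
suff H x : P1 (Delta x) = scheck A (eps x) /\ P2 (Delta x) = rhat A (eps x).
  move=> x s hs; have [<- <-] := H x.
  by rewrite (fib_additive_sweedler P1D P1E hs) (fib_additive_sweedler P2D P2E hs).
have [v1 v2] := v_inv.
elim/Ao_ind: x => [x y [hx hx'] [hy hy']|b|b|i j|a b c d x y dx dy [hx hx'] [hy hy']].
- by rewrite !DD P1D P2D eD cD rD hx hx' hy hy'.
- rewrite !Dr (P1E (_, _)) ?(P2E (_, _)) /=; [|exact: composable_rl..].
  rewrite Sr S1 !mulr1 er rhatE; split=> //.
  by have := scheckE A b 1%g; rewrite cross_inM mul1r mulg1 act1.
- rewrite !Ds (P1E (_, _)) ?(P2E (_, _)) /=; [|exact: composable_sr..].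
  rewrite Ss S1 !mul1r es rhatE; split=> //.
  by have := scheckE A b 1%g; rewrite cross_inM mul1r mulg1 act1.
- rewrite Delta_v (big_morph _ P1D P10) (big_morph _ P2D P20) eps_v; split.
    transitivity ((w *m v) i j).
      rewrite mxE; apply: eq_bigr => k _.
      by rewrite (P1E (_, _) (cvv _ _ _)) /= Sv.
    rewrite v2 mxE; case: eqP => _; last by rewrite c0.
    have := scheckE A 1 (g i); rewrite cross_inM mul1r mulg1 (alg_hom1 (act_hom _)) => ->.
    by rewrite (alg_hom1 (smap_hom A)).
  transitivity ((v *m w) i j).
    rewrite mxE; apply: eq_bigr => k _.
      by rewrite (P2E (_, _) (cvv _ _ _)) /= Sv.
  by rewrite v1 mxE; case: eqP => _; rewrite ?r0 // rhatE (alg_hom1 (rmap_hom A)).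
- have [Dh Dd _ _] := Dm.
  (* Decompositions whose outer degrees are those of [x] and [y], so that the twist is the same for
     all summands. *)
  have [s [hs sE]] := Dd _ _ _ dx; have [t [ht tE]] := Dd _ _ _ dy.
  have hs' p : p \in s -> composable p by move=> /hs/composable_atW.
  have ht' p : p \in t -> composable p by move=> /ht/composable_atW.
  have sw1 : sweedler (Delta x) s by [].
  have sw2 : sweedler (Delta y) t by [].
  have [u [uE uM]] := scheck_eps dx; have [u' [wE _ wM]] := rhat_shat_eps dy.
  have E : Delta (x * y) =
      \sum_(p <- s) \sum_(q <- t) (fib_in (p.1 * q.1) (p.2 * q.2) : fib A A).
    rewrite DM sE tE mulr_suml; apply: eq_big_seq => p /hs' hp.
    rewrite mulr_sumr; apply: eq_big_seq => q /ht' hq.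
    by rewrite [LHS]fib_inM -?surjective_pairing.
  rewrite E eM; split.
  + rewrite (uM _ _ _ dy) -hy (fib_additive_sweedler P1D P1E sw2) mulr_sumr.
    rewrite (big_morph _ P1D P10); under eq_bigr do rewrite (big_morph _ P1D P10).
    rewrite exchange_big; apply: eq_big_seq => q htq.
    have [k [dq _]] := ht _ htq.
    rewrite mulrA -(smap_act _ (Sd dq)) -uE -hx (fib_additive_sweedler P1D P1E sw1).
    rewrite mulr_sumr mulr_suml; apply: eq_big_seq => p /hs' hp.
    rewrite (P1E (_, _)) /= ?SM ?mulrA //.
    exact: (composableM hp (ht' _ htq)).
  + have [-> _ _] := wM _ _ _ dx.
    rewrite -hx' (fib_additive_sweedler P2D P2E sw1) mulr_sumr.
    rewrite (big_morph _ P2D P20); apply: eq_big_seq => p hsp.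
    have [k [dp1 dp2]] := hs _ hsp.
    rewrite mulrA -(rmap_act _ dp1) -wE -hy' (fib_additive_sweedler P2D P2E sw2).
    rewrite (big_morph _ P2D P20) mulr_sumr mulr_suml; apply: eq_big_seq => q htq.
    rewrite (P2E (_, _)) /= ?SM ?mulrA //.
    exact: (composableM (hs' _ hsp) (ht' _ htq)).
Qed.

End Antipode.
End Counit.
End Coproduct.
End Universal.

(** * The involution *)

Section ConjugateOppositeMorphisms.
Variables (K : numClosedFieldType) (X : base K) (A : bgAlg X).

Lemma conj_op_mor_star (star : A -> conj_op A) : is_bg_mor star ->
  [/\ {morph (star : A -> A) : x y / x + y},
      forall z x, star (z *: x) = z^* *: (star x : A),
      forall x y, star (x * y) = (star y : A) * star x,
      forall a b x, deg a b x -> deg a^-1%g b^-1%g (star x : A)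
    & (forall b, star (rmap A b) = rmap A (base_star b)) /\
      (forall b, star (smap A b) = smap A (base_star b))].
Proof.
move=> [h d r s]; split=> //; first exact: alg_homD h.
- exact: alg_homZ h.
- exact: alg_homM h.
Qed.

(** Two conjugations and two reversals of the product cancel, which makes the composite comparable
    with the identity by [Ao_ext]. *)
Lemma conj_op_mor_comp (f h : A -> conj_op A) :
  is_bg_mor f -> is_bg_mor h -> is_bg_mor ((h : A -> A) \o (f : A -> A)).
Proof.
move=> fm hm; have [fD fZ fM fd [fr fs]] := conj_op_mor_star fm.
have [hD hZ hM hd [hr hs]] := conj_op_mor_star hm; have [_ _ _ sK] := base_starP X.
split=> [|a b x|b|b] /=.
- split=> [z x y|]; first by rewrite /= fD fZ hD hZ conjCK.
  split=> [|x y] /=; last by rewrite fM hM.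
  by rewrite -(alg_hom1 (rmap_hom A)) fr hr sK.
- by move=> /fd /hd; rewrite !invgK.
- by rewrite fr hr sK.
- by rewrite fs hs sK.
Qed.

Lemma is_bg_star_mor (star : A -> A) : is_bg_star star ->
  is_bg_mor (star : A -> conj_op A).
Proof.
move=> [[sD sZ sM sK] sd sr ss].
split=> [|a b x hx|b|b].
- split=> [z x y|]; first by rewrite sD sZ.
  split=> [|x y]; last by rewrite sM.
  by rewrite -{1}(alg_hom1 (rmap_hom A)) sr base_star1; apply: (alg_hom1 (rmap_hom A)).
- by rewrite /deg /= /conj_op_deg -sd; exists x.
- exact: sr.
- exact: ss.
Qed.

Lemma is_bg_star_of_mor (star : A -> conj_op A) : is_bg_mor star ->
  involutive (star : A -> A) -> is_bg_star (star : A -> A).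
Proof.
move=> sm sK; have [sD sZ sM sd [sr ss]] := conj_op_mor_star sm; split=> // a b.
apply/seteqP; split=> [_ [x hx <-]|x hx]; first exact: sd.
by exists (star x); [rewrite -[a]invgK -[b]invgK; apply: sd|apply: sK].
Qed.

End ConjugateOppositeMorphisms.

Lemma cross_star_in (K : numClosedFieldType) (X : base K) (b : X) h :
  cross_star (cross_in b h) = cross_in (act h^-1%g (base_star b)) h^-1%g.
Proof. by rewrite cross_starE cross_inM mul1r mulg1. Qed.

Lemma cross_starD (K : numClosedFieldType) (X : base K) :
  {morph @cross_star K X : x y / x + y} /\ cross_star (0 : cross X) = 0.
Proof.
have [sD _ _ _] := base_starP X; apply: span_lift_additive => c d h /=.
by rewrite sD (alg_homD (act_hom _)) cross_inD.
Qed.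

Section Star.
Variables (K : numClosedFieldType) (X : base K) (n : nat) (g : 'I_n -> base_grp X).
Local Notation ginv := (fun i => (g i)^-1%g).
Local Notation conjB := (@conj_mx n X (@base_star K X)).
Variables (F F1 G G1 : 'M[X]_n).
Hypotheses (hF : supp g ginv F) (FF1 : mx_inverse F F1).
Hypotheses (hG : supp g ginv G) (GG1 : mx_inverse G G1).
Local Notation Q := (Qmx g G).
Variables (A : bgAlg X) (v : 'M[A]_n).
Hypothesis univ : is_Ao g F G v.
Local Notation rM := (map_mx (rmap A)).
Local Notation sM := (map_mx (smap A)).

Let hv : bideg g g v := Ao_bideg hF hG univ.

Variable star : A -> conj_op A.
Hypotheses (sm : is_bg_mor star) (sv : map_mx star v = Ao_star_v g G G1 v).

Lemma Ao_star_involutive : involutive (star : A -> A).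
Proof.
have hr := rmap_hom A; have hs := smap_hom A.
have [w vw] := Ao_inverse hF hG univ.
suff E : (star : A -> A) \o (star : A -> A) = id by move=> x; rewrite -[RHS]/(id x) -E.
apply: (Ao_ext hF hG univ (conj_op_mor_comp sm sm) (is_bg_mor_id A)).
rewrite map_mx_comp [map_mx star v]sv.
have [sh _ _ _] := sm; have hu := bideg_Ao_star_v hG GG1 hv.
rewrite [LHS](map_mx_homM sh) (map_mx_homM sh) sv.
rewrite (is_bg_mor_rmap _ sm) (is_bg_mor_smap _ sm) (conj_op_mul_smap _ hu) twist_invK.
rewrite (conj_op_mul_rmap (a := ginv) (b := g) (c := g)); last 2 first.
- exact/supp_twist/supp_invl/(supp_mx_inverse hG GG1).
- by apply: bideg_smap hu; apply/supp_twist/supp_invr/supp_conj.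
rewrite -twist_conj twistVK twist_conj /Ao_star_v -!mulmxA -(map_mx_homM hs) -QmxE //.
rewrite (mulmxA _ v) -(rmap_conj_v hG GG1 vw) mulmxA -(map_mx_homM hr) -conjBM.
have [_ ->] := GG1; rewrite conjB1 (map_mx_hom1 hr) mul1mx.
by apply/matrixP => i j; rewrite mxE.
Qed.

Lemma Ao_star_bg_star : is_bg_star (star : A -> A).
Proof. exact: is_bg_star_of_mor sm Ao_star_involutive. Qed.

Lemma Ao_star_v_eq : rM (twist g G) *m conj_mx (star : A -> A) v = v *m sM G.
Proof.
rewrite [conj_mx _ v]sv mulmxA -(map_mx_homM (rmap_hom A)).
have [-> _] := mx_inverse_twist hG GG1.
by rewrite (map_mx_hom1 (rmap_hom A)) mul1mx.
Qed.

Lemma star_Delta (Delta : A -> fib A A) :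
  is_bg_mor Delta -> map_mx Delta v = fibmx v v ->
  forall x s, sweedler (Delta x) s -> Delta (star x) =
    \sum_(p <- s) (fib_in (star p.1 : A) (star p.2 : A) : fib A A).
Proof.
move=> Dm Dv; have [stD stZ stM std [str sts]] := conj_op_mor_star sm.
have stc p : composable p -> @composable _ _ A A (star p.1, star p.2).
  by move=> [x [y [z [/std h1 /std h2]]]]; exists x^-1%g, y^-1%g, z^-1%g.
have [|||p hp|b p hp|P [PD PE]] := @fib_lift _ _ A A (tens A A) (fib A A)
  (fun p => tens_in (star p.1 : A) (star p.2 : A)) (gtens_pred (A:=A) (C:=A))
  (@fib_class _ _ A A).
- split=> [a b c|a c d|z a c] /=.
  + by rewrite stD tens_inDl.
  + by rewrite stD tens_inDr.
  + by rewrite !stZ tens_inZl tens_inZr.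
- exact: gtens_zmod_closed.
- by move=> x y hx hy; apply: fib_classD.
- exact: (@gtens_tens_in _ _ A A (_, _) (stc p hp)).
- have [x [y [z [/std h1 /std h2]]]] := hp.
  rewrite /= !stM sts str (smap_act _ h1) (rmap_act _ h2).
  exact: (fib_in_balance _ (stc p hp)).
have P0 : P 0 = 0 by apply: (addIr (P 0)); rewrite -PD !add0r.
have PM x y : P (x * y) = P y * P x.
  (* Taking the opposite ring as target turns multiplicativity into the required reversal of
     products. *)
  apply: (@fib_additive_mul _ _ A A ((alg_ring (fib_alg A A))^c) P
    (fun p => fib_in (star p.1 : A) (star p.2 : A))) => // p q hp hq /=.
  by rewrite !stM; apply/esym; apply: (@fib_inM _ _ A A); apply: stc.
suff H x : Delta (star x) = P (Delta x).
  by move=> x s hs; rewrite H (fib_additive_sweedler PD PE hs).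
have [Dh _ Dr Ds] := Dm; have DD := is_bg_mor_additive Dm.
have hr := rmap_hom A; have hs := smap_hom A.
have st1 : star 1 = (1 : A).
  by rewrite -[in LHS](alg_hom1 hr) str base_star1 (alg_hom1 hr).
elim/(Ao_ind hF FF1 hG univ): x => [x y hx hy|b|b|i j|a b c d x y _ _ hx hy].
- by rewrite stD !DD PD hx hy.
- rewrite str !Dr -[rmap _ b]/(fib_in (rmap A b) 1 : fib A A).
  by rewrite (PE (_, _) (composable_rl _ _ _)) /= str st1.
- rewrite sts !Ds -[smap _ b]/(fib_in 1 (smap A b) : fib A A).
  by rewrite (PE (_, _) (composable_sr _ _ _)) /= sts st1.
- transitivity (map_mx Delta (Ao_star_v g G G1 v) i j); first by rewrite -sv !mxE.
  rewrite /Ao_star_v !(map_mx_homM Dh) Dv (is_bg_mor_rmap _ Dm) (is_bg_mor_smap _ Dm).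
  have hG1 := supp_twist ginv (supp_mx_inverse hG GG1).
  rewrite (fibmx_smap hG hv hv) (fibmx_rmap hG1 hv (bideg_smap hG hv)).
  (* The factor [s(G)] of the first leg crosses over as [r(twist g G)] and cancels the inverse at
     the front of the second leg. *)
  have E : fibmx (Ao_star_v g G G1 v) (Ao_star_v g G G1 v) =
      fibmx (rM (twist ginv G1) *m v) (v *m sM G).
    rewrite [X in fibmx X _]mulmxA.
    rewrite (fibmx_balance hG (bideg_rmap hG1 hv) (bideg_Ao_star_v hG GG1 hv)).
    congr fibmx; rewrite mulmxA -(map_mx_homM hr).
    by have [-> _] := mx_inverse_twist hG GG1; rewrite (map_mx_hom1 hr) mul1mx.
  rewrite -E (Delta_v Dv) (big_morph _ PD P0) mxE; apply: eq_bigr => k _.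
  rewrite (PE (_, _) (composable_deg (hv _ _) (hv _ _))) /= -sv.
  by congr fib_in; rewrite mxE.
- by rewrite stM !(alg_homM Dh) PM hx hy.
Qed.

Lemma star_eps (eps : A -> cross X) : is_bg_mor eps -> map_mx eps v = nabla g ->
  forall x, eps (star x) = cross_star (eps x).
Proof.
move=> em ev; have [stD _ stM std [str sts]] := conj_op_mor_star sm.
have [cD c0] := cross_starD X; have [eh _ er es] := em.
have eD := is_bg_mor_additive em.
elim/(Ao_ind hF FF1 hG univ) => [x y hx hy|b|b|i j|a b c d x y dx dy hx hy].
- by rewrite stD !eD cD hx hy.
- by rewrite str !er [RHS]cross_star_in invg1 act1.
- by rewrite sts !es [RHS]cross_star_in invg1 act1.
- transitivity (map_mx eps (Ao_star_v g G G1 v) i j); first by rewrite -sv !mxE.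
  rewrite /Ao_star_v !(map_mx_homM eh) ev (is_bg_mor_rmap _ em) (is_bg_mor_smap _ em).
  have [nV _] := nablaK g.
  (* Since [nabla G = (nabla G nabla) nabla^-1], the coefficients of [Ao_star_v] cancel under [eps]
     and leave [nabla^-1], the entrywise star of [nabla]. *)
  have -> : nabla g *m map_mx (smap (cross X)) G = in_cross (twist g G) *m nablaV g.
    by rewrite -(nabla_supp hG) -[RHS]mulmxA nV mulmx1.
  rewrite mulmxA -[map_mx _ _]/(in_cross _) -in_crossM.
  have [_ ->] := mx_inverse_twist hG GG1.
  rewrite [in_cross _](map_mx_hom1 (cross_base_hom X)) mul1mx nablaVE.
  rewrite (eps_v ev); case: eqP => _; last by rewrite c0.
  by rewrite cross_star_in base_star1 (alg_hom1 (act_hom _)).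
- rewrite stM !(alg_homM eh) hx hy.
  case: (eps_homogeneous em dx) => [->|[_ [u ->]]]; first by rewrite mul0r c0 mulr0.
  case: (eps_homogeneous em dy) => [->|[_ [u' ->]]]; first by rewrite mulr0 c0 mul0r.
  rewrite [X in _ = cross_star X]cross_inM !cross_star_in [LHS]cross_inM invgM.
  by rewrite base_starM !(alg_homM (act_hom _)) -act_star actM -!actM mulgVK base_comm.
Qed.

End Star.

(** * Existence and uniqueness of the Hopf structure *)

Section HopfStructure.
Variables (K : numClosedFieldType) (X : base K) (n : nat) (g : 'I_n -> base_grp X).
Local Notation ginv := (fun i => (g i)^-1%g).
Local Notation conjB := (@conj_mx n X (@base_star K X)).
Variables (F F1 G G1 : 'M[X]_n).
Hypotheses (hF : supp g ginv F) (FF1 : mx_inverse F F1).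
Hypotheses (hG : supp g ginv G) (GG1 : mx_inverse G G1).
Hypothesis hFG : conjB F *m G^T = conjB G *m F^T.
Variables (A : bgAlg X) (v : 'M[A]_n).
Hypothesis univ : is_Ao g F G v.
Let hv : bideg g g v := Ao_bideg hF hG univ.

Definition hopf_spec (H : hopf_data A) : Prop :=
  [/\ is_hopf_star H,
      map_mx (rmap A) (twist g G) *m conj_mx (h_star H) v = v *m map_mx (smap A) G
    & matrix_corep g H v].

Lemma hopf_spec_exists : exists H, hopf_spec H.
Proof.
have [w vw] := Ao_inverse hF hG univ; have [v_inv _ _] := vw.
have [D [Dm Dv]] := Ao_lift hF hG univ (bideg_fibmx_v hv) (Ao_rel_fibmx hF FF1 hG hv vw).
have [e [em ev]] := Ao_lift hF hG univ (bideg_cross_nabla g) (Ao_rel_cross hF hG).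
have [S [Sm Sv]] :=
  Ao_lift hF hG univ (bideg_coop_w hF FF1 hv vw) (Ao_rel_coop hF FF1 hG hv vw).
(* Degrees in the conjugate opposite are inverse to those in [A], so the degrees [ginv] of
   [Ao_star_v] count as [g] there. *)
have [st [sm sv]] := Ao_lift hF hG univ
  (bideg_Ao_star_v hG GG1 hv : bideg g g (_ : 'M[conj_op A]_n))
  (Ao_rel_conj_op hF FF1 hG GG1 hFG hv vw).
have Sw i j : S (v i j) = w i j.
  by have := congr1 (fun M : 'M[coop A]_n => M i j) Sv; rewrite mxE.
exists (HopfData (st : A -> A) D e S); split.
- split; first split=> //=.
  + split.
    * exact: (Delta_coassociative hF FF1 hG univ Dm Dv).
    * exact: (Delta_counital hF FF1 hG univ Dm Dv em ev).
    * exact: (Delta_antipodal hF FF1 hG univ Dm Dv em ev Sm v_inv Sw).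
  + exact: (Ao_star_bg_star hF hG GG1 univ sm sv).
  + exact: (star_Delta hF FF1 hG GG1 univ sm sv Dm Dv).
  + exact: (star_eps hF FF1 hG GG1 univ sm sv em ev).
- exact: (Ao_star_v_eq hG GG1 sv).
- split=> /= [i j|i j|]; [exact: Delta_v Dv i j|exact: eps_v ev i j|].
  by exists w.
Qed.

Lemma hopf_spec_unique H H' : hopf_spec H -> hopf_spec H' -> H = H'.
Proof.
move=> [[[Dm em Sm _] st _ _] gv [Dv ev [w vw Sv]]].
move=> [[[Dm' em' Sm' _] st' _ _] gv' [Dv' ev' [w' vw' Sv']]].
have ext := Ao_ext hF hG univ.
have ED : h_Delta H = h_Delta H'.
  by apply: ext => //; apply/matrixP => i j; rewrite !mxE Dv Dv'.
have Ee : h_eps H = h_eps H'.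
  by apply: ext => //; apply/matrixP => i j; rewrite !mxE ev ev'.
have ES : h_S H = h_S H'.
  apply: ext => //; apply/matrixP => i j; rewrite !mxE Sv Sv'.
  by rewrite (mx_inverse_uniq vw vw').
have starE (t : A -> A) :
    map_mx (rmap A) (twist g G) *m conj_mx t v = v *m map_mx (smap A) G ->
    map_mx t v = Ao_star_v g G G1 v.
  move=> e; rewrite /Ao_star_v -e mulmxA -(map_mx_homM (rmap_hom A)).
  have [_ ->] := mx_inverse_twist hG GG1.
  by rewrite (map_mx_hom1 (rmap_hom A)) mul1mx.
have sm := is_bg_star_mor st; have sm' := is_bg_star_mor st'.
have [[_ _ _ sK] _ _ _] := st; have [[_ _ _ sK'] _ _ _] := st'.
have E : h_star H' \o h_star H = id.
  apply: (ext _ _ _ (conj_op_mor_comp sm sm') (is_bg_mor_id A)).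
  rewrite map_mx_comp (starE _ gv) -(starE _ gv'); apply/matrixP => i j.
  by rewrite !mxE sK'.
have Es : h_star H = h_star H'.
  by apply/funext => x; rewrite -[LHS]sK'; congr (h_star H' _); apply: (congr1 (@^~ x) E).
move: ED Ee ES Es; clear.
by case: H => [? ? ? ?]; case: H' => [? ? ? ?] /= -> -> -> ->.
Qed.

End HopfStructure.

Theorem theorem2p4p12 (R : realType) (X : base R[i]) (n : nat)
    (g : 'I_n -> base_grp X) (F G : 'M[X]_n)
    (hF : GLmx F) (hG : GLmx G)
    (oddF : nabla_odd g F) (oddG : nabla_odd g G)
    (hFG : G *m adj_mx F = F *m adj_mx G) :
  (exists (A : bgAlg X) (v : 'M[A]_n), is_Ao g F G v) /\
  forall (A : bgAlg X) (v : 'M[A]_n), is_Ao g F G v ->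
    exists! H : hopf_data A,
      [/\ is_hopf_star H,
          map_mx (rmap A) (to_base (nabla g *m in_cross G *m nabla g)) *m
            conj_mx (h_star H) v = v *m map_mx (smap A) G
        & matrix_corep g H v].
Proof.
have [F1 FF1] := hF; have [G1 GG1] := hG.
have sF := nabla_odd_supp oddF; have sG := nabla_odd_supp oddG.
(* The hypothesis transposed, which reverses products here because the base is commutative. *)
have hFG' : conj_mx (@base_star _ X) F *m G^T = conj_mx (@base_star _ X) G *m F^T.
  by apply: trmx_inj; rewrite !trmx_mulB !trmxK.
split; first by eexists; eexists; apply: Ao_alg_is_Ao sF FF1 sG.
move=> A v univ; rewrite nabla_supp // in_crossK.
have [H HP] := hopf_spec_exists sF FF1 sG GG1 hFG' univ.
by exists H; split=> // H' HP'; apply: (hopf_spec_unique sF sG GG1 univ HP HP').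
Qed.
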